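(* There is an absolute constant $C>0$ and, for every $K>0$, there is a constant $c_K>0$ depending only on $K$ such that the following holds. Let $n,d\ge 1$ be integers and let $X=(X_1,\ldots,X_n)$ have independent coordinates with $$\mathbb{E}X_i=0,\qquad \mathbb{E}X_i^2=1,\qquad \|X_i\|_{\psi_2}\le K\qquad(1\le i\le n).$$ Let $L>0$, let $f:H_d\to\mathbb{R}$ be convex and $L$-Lipschitz, and put $Z=f(X^{\otimes d})$. Then for every $t$ with $0\le t\le c_KL\,n^{d/2}$, $$\mathbb{P}\left\{|Z-\mathbb{E}Z|>t\right\}\le C\exp\left[-c_K\,\mathcal I_{n,d}\left(\frac{t}{L\,n^{(d-1)/2}}\right)\right].$$
   Context: $H_d=(\mathbb{R}^n)^{\otimes d}$ is the Hilbert-space tensor product of $d$ copies of Euclidean $\mathbb{R}^n$, with its Hilbert norm; Lipschitz is with respect to this norm. $X^{\otimes d}=X\otimes\cdots\otimes X$ ($d$ factors). $\|W\|_{\psi_2}=\inf\{a>0:\mathbb{E}\exp(W^2/a^2)\le 2\}$. The rate function is $$\mathcal I_{n,d}(s)=\min\left\{\frac{s^2}{d^2},\ \frac{s^2}{d\log(e+nd/s^2)}\right\}\quad(s>0),\qquad \mathcal I_{n,d}(0)=0.$$ *)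

(* Defs.v *)
From HB Require Import structures.
From mathcomp Require Import all_boot all_order all_algebra.
From mathcomp Require Import all_classical all_reals all_analysis.

Set Implicit Arguments.
Unset Strict Implicit.
Unset Printing Implicit Defensive.

Import Order.TTheory GRing.Theory Num.Theory.
Import numFieldNormedType.Exports.

Local Open Scope classical_set_scope.
Local Open Scope ring_scope.

(* (R^n)^{(x) d} in the coordinates of the orthonormal basis
   e_(i 0) (x) ... (x) e_(i (d-1)), indexed by i : {0..d-1} -> {0..n-1}.
   The alias R^o makes this a real vector space, as convex_function needs. *)
Notation tensor_space R n d := {ffun {ffun 'I_d -> 'I_n} -> R^o}.

Section tensor.
Context {R : realType} {n d : nat}.
Implicit Types u v : tensor_space R n d.

Definition tensor_inner u v : R := \sum_i (u i : R) * (v i : R).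

Definition tensor_norm u : R := Num.sqrt (tensor_inner u u).

Definition pure_tensor (x : 'I_d -> 'I_n -> R) : tensor_space R n d :=
  [ffun i : {ffun 'I_d -> 'I_n} => \prod_(k < d) x k (i k)].

(* The identity characterizing the Hilbert-space tensor product. *)
Lemma tensor_inner_pure (x y : 'I_d -> 'I_n -> R) :
  tensor_inner (pure_tensor x) (pure_tensor y) =
  \prod_(k < d) \sum_(j < n) x k j * y k j.
Proof.
rewrite bigA_distr_bigA /=; apply: eq_bigr => i _.
by rewrite !ffunE -big_split.
Qed.

Definition tensor_power (x : 'I_n -> R) : tensor_space R n d :=
  pure_tensor (fun=> x).

Definition tensor_lipschitz (L : R) (f : tensor_space R n d -> R) : Prop :=
  forall u v, `|f u - f v| <= L * tensor_norm (u - v).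

End tensor.

Section probability.
Context {disp : measure_display} {T : measurableType disp} {R : realType}.
Variable P : probability T R.

Definition mutually_independent (I : finType) (X : I -> {RV P >-> R}) : Prop :=
  forall (J : {set I}) (B : I -> set R), (forall i, measurable (B i)) ->
    (P (\bigcap_(i in [set j | j \in J]) (X i @^-1` B i)) =
     \prod_(i in J) P (X i @^-1` B i))%E.

(* Extended-real valued: the infimum over the empty set is +oo. *)
Definition psi2_norm (W : T -> R) : \bar R :=
  ereal_inf [set a%:E | a in
    [set a : R | 0 < a /\
      ('E_P[(fun w => expR (W w ^+ 2 / a ^+ 2))] <= 2%:E)%E]].

End probability.

Definition rate_function {R : realType} (n d : nat) (s : R) : R :=
  if s == 0 then 0 else
  Num.min (s ^+ 2 / d%:R ^+ 2)
          (s ^+ 2 / (d%:R * ln (expR 1 + n%:R * d%:R / s ^+ 2))).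

(* Main.v *)
Require Import Defs.
From HB Require Import structures.
From mathcomp Require Import all_boot all_order all_algebra.
From mathcomp Require Import all_classical all_reals all_analysis.
From mathcomp Require Import measurable_realfun ring lra.

Set Implicit Arguments.
Unset Strict Implicit.
Unset Printing Implicit Defensive.

Import Order.TTheory GRing.Theory Num.Theory.
Import numFieldNormedType.Exports.

Local Open Scope classical_set_scope.
Local Open Scope ring_scope.

(** Write N for the square root of n, U for L * N^(d-1) and s for t / U; the
tail of Z = f(X^{(x)d}) has to be compared with the rate of s.

The heart of the proof is an inequality for two level sets
([level_sets_product]): outside an exceptional event of small probability, the
product of P(Z <= a) and P(b <= Z) is at most exp(-eta^2/(272 v)) as soon as
b - a >= 146 eta U, where v = M^2 d + k^2 d^2.  Here k is a scale with
E exp(X_i^2/k) <= 2 and M is a truncation level for the coordinates.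

It comes from Talagrand's convex distance.  Two sets A and B of mass P(A) and
P(B) in a product space contain a point x of B and a law nu on A for which the
probabilities p_i = nu(y_i <> x_i) satisfy
sum_i p_i^2 <= h = 8 log(1/(P(A) P(B))) ([convex_distance_two_sets]).  By
convexity and the Lipschitz property, the drop of f from x to the nu-average
of the points y is at most L times the norm of x^{(x)d} - E_nu y^{(x)d}; the
average is taken before the norm, so the first order terms may cancel.  On the
sphere of radius 1 the derivative of the tensor power in the direction
u = E_nu(x - y) has squared norm d |u|^2 + d (d-1) <x,u>^2, and <x,u> is half
of w = E_nu |x - y|^2 because all the points have the same norm.  The Taylor
remainder is also of order d w.  Hence the drop costs sqrt d |u| + d w, up to
the thickness of the shell in which the points lie ([shell_power_average]).

For coordinates bounded by M one has |u| <= 2 M sqrt h.  The quantity w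
involves E_nu sum_i y_i^2 1(y_i <> x_i), which is not controlled by the p_i
alone; but y_i = x_i off the event y_i <> x_i, so it equals
E_nu |y|^2 - |x|^2 + sum_i x_i^2 p_i, where the first two terms nearly cancel
in a thin shell and the last one is at most sqrt(h sum_i x_i^4), of order
k N sqrt h.  This gives b - a <= U (const (M sqrt d + k d) sqrt h + 73 eta)
([truncated_gap]), that is a lower bound eta^2/v for h up to constants.
Talagrand's inequality is only used on finite product spaces: coordinates are
sorted into finitely many cells on which their truncation is constant.

The exceptional event is that |X|^2 - n exceeds eta N / d in absolute value,
that the energy of the coordinates above M exceeds eta^2/d, or that the
truncated fourth powers sum up to more than 34 k^2 n; Chernoff bounds make it
as unlikely as exp(-eta^2/(272 v)) ([bad_event_probability]). Taking M^2
proportional to log(e + n d/s^2) and eta = s/592 fulfils the requirement on M,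
and turns eta^2/v into the rate of s ([exists_truncation]).

The level set inequality with one of the sets of mass about one half is a
deviation inequality around a median ([tail_about_median]).  Its dyadic sum
for eta up to N/4, completed by |Z - f 0| <= U N (|X|^2/n)^(d/2) and
E(|X|^2/n)^d <= 2 when d^2 is small compared with n, shows that the mean is
within a multiple of U eta of the median ([expected_deviation]).  When the
rate is bounded, in particular when d^2 is not small compared with n, the
claim holds by the choice of the constant in front of the exponential. *)

(** * An upper bound for the exponential *)

Section exp_estimates.
Context {R : realType}.
Implicit Types x y m : R.

(** Squaring 1 - x/2 <= exp(-x/2) gives a lower bound for exp(-x), and the
claim is a polynomial inequality after multiplying by it. *)
Lemma expR_le_quad x : x <= 3 / 8 -> expR x <= 1 + x + x ^+ 2.
Proof.
move=> x1.
have h : 1 - x / 2 <= expR (- (x / 2)) by apply: expR_ge1Dx.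
have e2 : expR x * expR (- (x / 2)) ^+ 2 = 1.
  by rewrite -expRM_natl -expRD -expR0; congr expR; field.
have h2 : 1 <= (1 + x + x ^+ 2) * (1 - x / 2) ^+ 2.
  have -> : (1 + x + x ^+ 2) * (1 - x / 2) ^+ 2 =
            1 + x ^+ 2 * (1 - 3 * x + x ^+ 2) / 4 by field.
  have : 0 <= 1 - 3 * x + x ^+ 2 by nra.
  by move=> h3; rewrite lerDl divr_ge0// mulr_ge0// sqr_ge0.
have h4 : (1 - x / 2) ^+ 2 <= expR (- (x / 2)) ^+ 2.
  by rewrite ler_pXn2r// ?nnegrE ?expR_ge0//; lra.
have q0 : 0 <= 1 + x + x ^+ 2 by nra.
have h5 : 1 <= (1 + x + x ^+ 2) * expR (- (x / 2)) ^+ 2.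
  by apply: le_trans h2 _; rewrite ler_wpM2l.
rewrite -(@ler_pM2r _ (expR (- (x / 2)) ^+ 2)) ?e2//.
by rewrite exprn_gt0// expR_gt0.
Qed.

End exp_estimates.

(** * Finite product spaces *)
Section product_space.
Context {R : realType} {T : finType}.

Definition product_mass n (p : 'I_n -> T -> R) (x : {ffun 'I_n -> T}) : R :=
  \prod_(i < n) p i (x i).

Definition set_mass n (p : 'I_n -> T -> R) (A : {set {ffun 'I_n -> T}}) : R :=
  \sum_(x in A) product_mass p x.

Definition fcons n (t : T) (x : {ffun 'I_n -> T}) : {ffun 'I_n.+1 -> T} :=
  [ffun i => oapp x t (unlift ord0 i)].

Definition fbehead n (x : {ffun 'I_n.+1 -> T}) : {ffun 'I_n -> T} :=
  [ffun i => x (lift ord0 i)].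

Lemma fcons0 n t (x : {ffun 'I_n -> T}) : fcons t x ord0 = t.
Proof. by rewrite ffunE unlift_none. Qed.

Lemma fconsS n t (x : {ffun 'I_n -> T}) i : fcons t x (lift ord0 i) = x i.
Proof. by rewrite ffunE liftK. Qed.

Lemma fconsK n (x : {ffun 'I_n.+1 -> T}) : fcons (x ord0) (fbehead x) = x.
Proof.
apply/ffunP => i; rewrite ffunE; case: unliftP => [j ->|->] //=.
by rewrite ffunE.
Qed.

Lemma fbeheadK n t (x : {ffun 'I_n -> T}) : fbehead (fcons t x) = x.
Proof. by apply/ffunP => i; rewrite ffunE fconsS. Qed.

Lemma sum_fcons n (F : {ffun 'I_n.+1 -> T} -> R) :
  \sum_x F x = \sum_t \sum_x F (fcons t x).
Proof.
rewrite pair_bigA /=.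
rewrite (reindex (fun u : T * {ffun 'I_n -> T} => fcons u.1 u.2)) //=.
exists (fun x : {ffun 'I_n.+1 -> T} => (x ord0, fbehead x)) => [[t x] _|x _] /=.
  by rewrite fcons0 fbeheadK.
by rewrite fconsK.
Qed.

Lemma product_mass_fcons n (p : 'I_n.+1 -> T -> R) t x :
  product_mass p (fcons t x) = p ord0 t * product_mass (fun i => p (lift ord0 i)) x.
Proof.
rewrite /product_mass big_ord_recl fcons0; congr (_ * _).
by apply: eq_bigr => i _; rewrite fconsS.
Qed.

Lemma product_mass_ge0 n (p : 'I_n -> T -> R) x :
  (forall i t, 0 <= p i t) -> 0 <= product_mass p x.
Proof. by move=> p0; apply: prodr_ge0. Qed.

Lemma product_mass_sum1 n (p : 'I_n -> T -> R) :
  (forall i, \sum_t p i t = 1) -> \sum_x product_mass p x = 1.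
Proof. by move=> p1; rewrite -bigA_distr_bigA /=; apply: big1 => i _. Qed.

End product_space.

(** * Talagrand's convex distance inequality *)
Section convex_distance.
Context {R : realType} {T : finType}.

Definition distribution_on n (A : {set {ffun 'I_n -> T}})
    (nu : {ffun 'I_n -> T} -> R) : Prop :=
  [/\ forall y, 0 <= nu y, \sum_y nu y = 1 & forall y, y \notin A -> nu y = 0].

(** The squares of the mismatches of the best law nu on A, summed over the
coordinates, form the squared convex distance from x to A. *)
Definition mismatch n (nu : {ffun 'I_n -> T} -> R) (x : {ffun 'I_n -> T})
  (i : 'I_n) : R := \sum_(y : {ffun 'I_n -> T} | y i != x i) nu y.

(** This is Hoelder's inequality with exponents 1/l and 1/(1-l), obtained from
convexity after normalizing both sums by exp a and exp b. *)
Lemma exp_mix (I : finType) (mu F G : I -> R) (a b l : R) :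
  (forall i, 0 <= mu i) -> 0 <= l <= 1 ->
  \sum_i mu i * expR (F i) <= expR a ->
  \sum_i mu i * expR (G i) <= expR b ->
  \sum_i mu i * expR (l * F i + (1 - l) * G i) <= expR (l * a + (1 - l) * b).
Proof.
move=> mu0 /andP[l0 l1] HF HG.
have conv x y : expR (l * x + (1 - l) * y) <= l * expR x + (1 - l) * expR y.
  have := @convex_expR R (Itv01 l0 l1) x y.
  by rewrite !convRE.
pose c := l * a + (1 - l) * b.
have -> : \sum_i mu i * expR (l * F i + (1 - l) * G i) =
   expR c * \sum_i mu i * expR (l * (F i - a) + (1 - l) * (G i - b)).
  rewrite mulr_sumr; apply: eq_bigr => i _.
  rewrite mulrCA -expRD; congr (_ * expR _); rewrite /c; ring.
rewrite -[leRHS]mulr1 ler_wpM2l ?expR_ge0//.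
rewrite [leRHS](_ : _ = l * 1 + (1 - l) * 1); last by ring.
apply: (@le_trans _ _ (l * (\sum_i mu i * expR (F i - a)) +
                      (1 - l) * (\sum_i mu i * expR (G i - b)))).
  rewrite !mulr_sumr -big_split /=; apply: ler_sum => i _.
  rewrite !(mulrCA _ (mu i)) -mulrDr ler_wpM2l//.
have aux (H : I -> R) (e : R) : \sum_i mu i * expR (H i) <= expR e ->
    \sum_i mu i * expR (H i - e) <= 1.
  move=> HH; under eq_bigr do rewrite expRD mulrA.
  by rewrite -mulr_suml expRN ler_pdivrMr ?expR_gt0// mul1r.
by rewrite lerD// ler_wpM2l ?subr_ge0// aux.
Qed.

(** The induction on the dimension needs
min over l in [0,1] of r^(-l) exp((1-l)^2/8) <= 2 - r.  The optimal weight is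
l = 1 + 4 log r when this is nonnegative, and l = 0 otherwise. *)
Lemma optimal_weight (r : R) : 0 <= r <= 1 ->
  (2 - r >= expR (8^-1)) \/
  (exists2 l : R, 0 <= l <= 1 & 0 < r /\ expR (- l * ln r + (1 - l) ^+ 2 / 8) <= 2 - r).
Proof.
move=> /andP[r0 r1].
have [re|re] := leP r (expR (- 4^-1)).
  left.
  have h1 : expR (- 4^-1) <= 1 - 4^-1 + (4^-1) ^+ 2 :> R.
    by have := @expR_le_quad R (- 4^-1); rewrite sqrrN; apply; lra.
  have h2 : expR (8^-1) <= 1 + 8^-1 + (8^-1) ^+ 2 :> R by apply: expR_le_quad; lra.
  lra.
right.
have rp : 0 < r by apply: lt_trans re; apply: expR_gt0.
pose m := - ln r.
have m0 : 0 <= m by rewrite /m oppr_ge0 ln_le0.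
have m4 : m <= 4^-1.
  rewrite /m lerNl -[leLHS]expRK ler_ln ?posrE ?expR_gt0//; exact: ltW.
exists (1 - 4 * m); first by apply/andP; split; lra.
split => //.
have er : r = expR (- m) by rewrite /m opprK lnK.
have -> : - (1 - 4 * m) * ln r + (1 - (1 - 4 * m)) ^+ 2 / 8 = m - 2 * m ^+ 2.
  by rewrite -[ln r]opprK -/m; field.
have h1 : expR (m - 2 * m ^+ 2) <= 1 + (m - 2 * m ^+ 2) + (m - 2 * m ^+ 2) ^+ 2.
  by apply: expR_le_quad; nra.
have h2 : r <= 1 - m + m ^+ 2.
  by rewrite {1}er; have := @expR_le_quad R (- m); rewrite sqrrN; apply; lra.
nra.
Qed.

End convex_distance.

Section convex_distance_step.
Context {R : realType} {T : finType}.

Lemma mismatch_fcons0 n (nu : {ffun 'I_n.+1 -> T} -> R) t x :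
  mismatch nu (fcons t x) ord0 = \sum_(u | u != t) \sum_y nu (fcons u y).
Proof.
rewrite /mismatch big_mkcond sum_fcons /= [RHS]big_mkcond /=.
apply: eq_bigr => u _; rewrite fcons0.
case: ifP => ut; last by apply: big1 => y _; rewrite fcons0 ut.
by apply: eq_bigr => y _; rewrite fcons0 ut.
Qed.

Lemma mismatch_fconsS n (nu : {ffun 'I_n.+1 -> T} -> R) t x i :
  mismatch nu (fcons t x) (lift ord0 i) =
  mismatch (fun y => \sum_u nu (fcons u y)) x i.
Proof.
rewrite /mismatch big_mkcond sum_fcons /= exchange_big /= [RHS]big_mkcond /=.
apply: eq_bigr => y _; rewrite fconsS.
case: ifP => yx; last by apply: big1 => u _; rewrite fconsS yx.
by apply: eq_bigr => u _; rewrite fconsS yx.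
Qed.

Lemma mismatch_mix n (nu1 nu2 : {ffun 'I_n -> T} -> R) l x i :
  mismatch (fun y => l * nu1 y + (1 - l) * nu2 y) x i =
  l * mismatch nu1 x i + (1 - l) * mismatch nu2 x i.
Proof. by rewrite /mismatch !mulr_sumr -big_split. Qed.

(** To approximate A from the point (t, x), nu1 keeps the first coordinate equal
to t and nu2 may change it at the cost of a unit mismatch there.  The mixture
has first mismatch at most 1 - l, and convexity of the square handles the
other coordinates. *)
Lemma mix_step n (A : {set {ffun 'I_n.+1 -> T}}) (t : T)
    (lift_of : {ffun 'I_n -> T} -> T)
    (nu1 nu2 : {ffun 'I_n -> T} -> R) (l : R) (x : {ffun 'I_n -> T}) :
  0 <= l <= 1 ->
  (l != 0 -> distribution_on [set y | fcons t y \in A] nu1) ->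
  distribution_on [set y | fcons (lift_of y) y \in A] nu2 ->
  exists2 nu, distribution_on A nu &
    \sum_i mismatch nu (fcons t x) i ^+ 2 <=
    l * (\sum_i mismatch nu1 x i ^+ 2) + (1 - l) * (\sum_i mismatch nu2 x i ^+ 2)
    + (1 - l) ^+ 2.
Proof.
move=> /andP[l0 l1] H1 H2.
have [nu20 nu21 nu2A] := H2.
have l1' : 0 <= 1 - l by rewrite subr_ge0.
have [e0 e1 eA] : [/\ forall y, 0 <= l * nu1 y, \sum_y l * nu1 y = l &
    forall y, fcons t y \notin A -> l * nu1 y = 0].
  have [->|lN0] := eqVneq l 0.
    by split => [y||y _]; rewrite ?mul0r//; apply: big1 => y _; rewrite mul0r.
  have [nu10 nu11 nu1A] := H1 lN0; split => [y||y yA]; first exact: mulr_ge0.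
    by rewrite -mulr_sumr nu11 mulr1.
  by rewrite nu1A ?mulr0// inE.
pose nu (z : {ffun 'I_n.+1 -> T}) : R :=
  (z ord0 == t)%:R * (l * nu1 (fbehead z)) +
  (z ord0 == lift_of (fbehead z))%:R * ((1 - l) * nu2 (fbehead z)).
have nuE u y : nu (fcons u y) = (u == t)%:R * (l * nu1 y) +
    (u == lift_of y)%:R * ((1 - l) * nu2 y).
  by rewrite /nu fcons0 fbeheadK.
have delta (c : T) (k : R) : \sum_u (u == c)%:R * k = k.
  rewrite (bigD1 c)//= eqxx mul1r big1 ?addr0// => u /negbTE ->.
  by rewrite mul0r.
have marg y : \sum_u nu (fcons u y) = l * nu1 y + (1 - l) * nu2 y.
  by under eq_bigr do rewrite nuE; rewrite big_split /= !delta.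
have nu0 z : 0 <= nu z by rewrite addr_ge0// mulr_ge0// mulr_ge0.
exists nu; first split => //.
- rewrite sum_fcons exchange_big /=; under eq_bigr do rewrite marg.
  by rewrite big_split /= e1 -mulr_sumr nu21 mulr1 addrC subrK.
- move=> z; rewrite -{1}(fconsK z) => zA; rewrite /nu.
  have [zt|_] := eqVneq (z ord0) t.
    rewrite eA -?zt// mulr0 add0r.
    have [zl|_] := eqVneq (z ord0) (lift_of (fbehead z)); last by rewrite mul0r.
    by rewrite nu2A ?mulr0// inE -zl.
  rewrite mul0r add0r.
  have [zl|_] := eqVneq (z ord0) (lift_of (fbehead z)); last by rewrite mul0r.
  by rewrite nu2A ?mulr0// inE -zl.
rewrite big_ord_recl addrC lerD//.
  rewrite !mulr_sumr -big_split /=; apply: ler_sum => i _.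
  rewrite mismatch_fconsS.
  have -> : mismatch (fun y => \sum_u nu (fcons u y)) x i =
      mismatch (fun y => l * nu1 y + (1 - l) * nu2 y) x i.
    by apply: eq_bigr => y _; rewrite marg.
  rewrite mismatch_mix.
  set a := mismatch _ _ _; set b := mismatch _ _ _.
  have := mulr_ge0 (mulr_ge0 l0 l1') (sqr_ge0 (a - b)); nra.
rewrite mismatch_fcons0 ler_pXn2r ?nnegrE//; last first.
  by apply: sumr_ge0 => u _; apply: sumr_ge0.
rewrite exchange_big /= [leRHS](_ : _ = \sum_y (1 - l) * nu2 y); last first.
  by rewrite -mulr_sumr nu21 mulr1.
apply: ler_sum => y _.
rewrite (eq_bigr (fun u => (u == lift_of y)%:R * ((1 - l) * nu2 y))); last first.
  by move=> u /negbTE ut; rewrite nuE ut mul0r add0r.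
rewrite -[leRHS](delta (lift_of y)).
rewrite [X in X <= _]big_mkcond /=; apply: ler_sum => u _.
by case: ifP => // _; do ?apply: mulr_ge0.
Qed.

End convex_distance_step.

Section talagrand.
Context {R : realType} {T : finType}.

Lemma set_massE n (p : 'I_n -> T -> R) A :
  set_mass p A = \sum_x (x \in A)%:R * product_mass p x.
Proof.
rewrite /set_mass big_mkcond; apply: eq_bigr => x _.
by case: ifP; rewrite ?mul1r ?mul0r.
Qed.

Lemma set_mass_fcons n (p : 'I_n.+1 -> T -> R) A :
  set_mass p A = \sum_t p ord0 t *
    set_mass (fun i => p (lift ord0 i)) [set y | fcons t y \in A].
Proof.
rewrite set_massE sum_fcons; apply: eq_bigr => t _.
rewrite set_massE mulr_sumr; apply: eq_bigr => y _.
by rewrite product_mass_fcons inE mulrCA.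
Qed.

Lemma set_mass_ge0 n (p : 'I_n -> T -> R) A :
  (forall i t, 0 <= p i t) -> 0 <= set_mass p A.
Proof. by move=> p0; apply: sumr_ge0 => x _; apply: product_mass_ge0. Qed.

Lemma set_mass_sub n (p : 'I_n -> T -> R) (A B : {set {ffun 'I_n -> T}}) :
  (forall i t, 0 <= p i t) -> A \subset B -> set_mass p A <= set_mass p B.
Proof.
move=> p0 AB; rewrite !set_massE; apply: ler_sum => x _.
rewrite ler_wpM2r ?product_mass_ge0// ler_nat.
by case xA: (x \in A) => //; rewrite (fintype.subsetP AB).
Qed.

Lemma set_mass_le1 n (p : 'I_n -> T -> R) A :
  (forall i t, 0 <= p i t) -> (forall i, \sum_t p i t = 1) -> set_mass p A <= 1.
Proof.
move=> p0 p1; rewrite -(product_mass_sum1 p1) set_massE; apply: ler_sum => x _.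
rewrite ler_piMl ?product_mass_ge0//; by case: (x \in A).
Qed.

Lemma set_mass_nonempty n (p : 'I_n -> T -> R) A :
  0 < set_mass p A -> exists x, x \in A.
Proof.
have [->|[x xA] _] := set_0Vmem A; last by exists x.
by rewrite /set_mass big_set0 ltxx.
Qed.

(** Talagrand's inequality, by induction on n: condition on the first coordinate
t, compare the section of A above t with the projection of A, and optimize the
weight of the mixture.  The function phi is an upper bound of the squared
convex distance that is constructed along the induction, so that no infimum
over laws is needed. *)
Lemma convex_distance_moment n (p : 'I_n -> T -> R) A :
  (forall i t, 0 <= p i t) -> (forall i, \sum_t p i t = 1) ->
  0 < set_mass p A ->
  exists phi : {ffun 'I_n -> T} -> R,
    \sum_x product_mass p x * expR (phi x / 8) <= (set_mass p A)^-1 /\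
    forall x, exists2 nu, distribution_on A nu &
      \sum_i mismatch nu x i ^+ 2 <= phi x.
Proof.
elim: n p A => [|n IH] p A p0 p1 A0.
  have [y0 y0A] := set_mass_nonempty A0.
  exists (fun=> 0); split.
    rewrite (eq_bigr (product_mass p)); last first.
      by move=> x _; rewrite mul0r expR0 mulr1.
    by rewrite product_mass_sum1// invf_ge1// set_mass_le1.
  move=> x; exists (fun y => (y == y0)%:R); last by rewrite big_ord0.
  split => [y||y yA]; first by [].
  - by rewrite (bigD1 y0)//= eqxx big1 ?addr0// => y /negbTE ->.
  - by case: eqP yA => // ->; rewrite y0A.
have [z0 z0A] := set_mass_nonempty A0.
pose p' i := p (lift ord0 i).
(* As is the projection of A along the first coordinate; lift_of chooses a
   point of A above each of its elements. *)
pose lift_of (y : {ffun 'I_n -> T}) :=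
  odflt (z0 ord0) [pick t | fcons t y \in A].
pose As := [set y | fcons (lift_of y) y \in A]%SET.
pose At t := [set y | fcons t y \in A]%SET.
have AtAs t : At t \subset As.
  apply/fintype.subsetP => y; rewrite !inE /lift_of => yA.
  by case: pickP => [u //|/(_ t)]; rewrite yA.
have p'0 i t : 0 <= p' i t by apply: p0.
have p'1 i : \sum_t p' i t = 1 by apply: p1.
pose a := set_mass p' As.
have muA : set_mass p A = \sum_t p ord0 t * set_mass p' (At t).
  exact: set_mass_fcons.
have Aa : set_mass p A <= a.
  rewrite muA -[leRHS]mul1r -(p1 ord0) mulr_suml; apply: ler_sum => t _.
  by rewrite ler_wpM2l// set_mass_sub.
have a0 : 0 < a by apply: lt_le_trans Aa.
have [phis [phis1 phis2]] := IH p' As p'0 p'1 a0.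
have step t : exists phit : {ffun 'I_n -> T} -> R,
    \sum_x product_mass p' x * expR (phit x / 8) <=
      a^-1 * (2 - set_mass p' (At t) / a) /\
    forall x, exists2 nu, distribution_on A nu &
      \sum_i mismatch nu (fcons t x) i ^+ 2 <= phit x.
  have r01 : 0 <= set_mass p' (At t) / a <= 1.
    rewrite divr_ge0 ?set_mass_ge0//=.
    by rewrite ler_pdivrMr// mul1r set_mass_sub.
  have [r2|[l l01 [r0 r2]]] := optimal_weight r01.
    exists (fun x => phis x + 1); split.
      under eq_bigr do rewrite mulrDl expRD mul1r mulrA.
      rewrite -mulr_suml ler_pM ?expR_ge0//; apply: sumr_ge0 => x _.
      by rewrite mulr_ge0 ?expR_ge0 ?product_mass_ge0.
    move=> x; have [nu2 nu2A nu2x] := phis2 x.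
    have [||nu nuA nux] := @mix_step R T n A t lift_of nu2 nu2 0 x _ _ nu2A.
    - by rewrite lexx ler01.
    - by rewrite eqxx.
    exists nu => //; apply: le_trans nux _.
    by rewrite mul0r add0r subr0 mul1r expr1n lerD2r.
  have mt0 : 0 < set_mass p' (At t).
    by move: r0; rewrite pmulr_lgt0// invr_gt0.
  have [phit [phit1 phit2]] := IH p' (At t) p'0 p'1 mt0.
  exists (fun x => l * phit x + (1 - l) * phis x + (1 - l) ^+ 2); split.
    rewrite (eq_bigr (fun x => product_mass p' x * expR (l * (phit x / 8)
       + (1 - l) * (phis x / 8)) * expR ((1 - l) ^+ 2 / 8))); last first.
      by move=> x _; rewrite -mulrA -expRD; congr (_ * expR _); field.
    rewrite -mulr_suml.
    pose la := ln (set_mass p' (At t)); pose lb := ln a.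
    have E := @exp_mix R _ (product_mass p') (fun x => phit x / 8)
       (fun x => phis x / 8) (- la) (- lb) l.
    apply: (@le_trans _ _ (expR (l * (- la) + (1 - l) * (- lb)) *
        expR ((1 - l) ^+ 2 / 8))).
      rewrite ler_wpM2r ?expR_ge0//; apply: E => //.
      - by move=> x; apply: product_mass_ge0.
      - by rewrite expRN lnK.
      - by rewrite expRN lnK.
    rewrite -expRD.
    rewrite (_ : _ + _ = - lb + (- l * ln (set_mass p' (At t) / a) +
       (1 - l) ^+ 2 / 8)); last first.
      by rewrite ln_div ?posrE// -/la -/lb; ring.
    rewrite expRD expRN lnK ?posrE// ler_wpM2l// invr_ge0; exact: ltW.
  move=> x; have [nu1 nu1A nu1x] := phit2 x.
  have [nu2 nu2A nu2x] := phis2 x.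
  have [nu nuA nux] := @mix_step R T n A t lift_of nu1 nu2 l x l01 (fun=> nu1A) nu2A.
  exists nu => //; apply: le_trans nux _.
  have /andP[l0 l1] := l01.
  by rewrite lerD2r lerD// ler_wpM2l// subr_ge0.
have [phi phiP] := boolp.choice step.
exists (fun z : {ffun 'I_n.+1 -> T} => phi (z ord0) (fbehead z)); split; last first.
  move=> z; have [_ /(_ (fbehead z))] := phiP (z ord0).
  by rewrite fconsK.
rewrite sum_fcons.
apply: (@le_trans _ _ (\sum_t p ord0 t * (a^-1 * (2 - set_mass p' (At t) / a)))).
  apply: ler_sum => t _; have [h _] := phiP t.
  apply: le_trans (ler_wpM2l (p0 ord0 t) h).
  rewrite mulr_sumr ler_sum// => x _.
  by rewrite fcons0 fbeheadK product_mass_fcons mulrA.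
rewrite (_ : \sum_t _ = a^-1 * (2 - set_mass p A / a)); last first.
  rewrite muA mulr_suml -[X in _ * (X - _)]mulr1 -(p1 ord0) mulr_sumr.
  by rewrite -sumrB mulr_sumr; apply: eq_bigr => t _; ring.
set r := set_mass p A in A0 *.
rewrite -[leRHS](_ : r^-1 * a * a^-1 = _); last by rewrite mulfK// gt_eqF.
rewrite mulrC ler_wpM2r ?invr_ge0 ?(ltW a0)//.
rewrite -(@ler_pM2r _ (r / a)) ?divr_gt0//.
rewrite (_ : r^-1 * a * (r / a) = 1); last by field; rewrite !gt_eqF.
set q := r / a; have := sqr_ge0 (1 - q); lra.
Qed.

(** If every point of B were farther from A than the stated bound, the
exponential moment of the convex distance over B alone would exceed 1/P(A). *)
Lemma convex_distance_two_sets n (p : 'I_n -> T -> R)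
    (A B : {set {ffun 'I_n -> T}}) :
  (forall i t, 0 <= p i t) -> (forall i, \sum_t p i t = 1) ->
  0 < set_mass p A -> 0 < set_mass p B ->
  exists2 x, x \in B & exists2 nu, distribution_on A nu &
    \sum_i mismatch nu x i ^+ 2 <= - 8 * ln (set_mass p A * set_mass p B).
Proof.
move=> p0 p1 A0 B0.
have [phi [phi1 phi2]] := convex_distance_moment p0 p1 A0.
set h := - 8 * _.
have [[x xB xh]|H] := pselect (exists2 x, x \in B & phi x <= h).
  exists x => //; have [nu nuA nux] := phi2 x.
  by exists nu => //; apply: le_trans xh.
exfalso; suff : (set_mass p A)^-1 < (set_mass p A)^-1 by rewrite ltxx.
apply: lt_le_trans phi1.
have eh : expR (h / 8) = (set_mass p A)^-1 * (set_mass p B)^-1.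
  rewrite -invfM -[in RHS](@lnK _ (set_mass p A * _)) ?posrE ?mulr_gt0//.
  by rewrite -expRN /h; congr expR; field.
apply: (@lt_le_trans _ _ (\sum_(x in B) product_mass p x * expR (phi x / 8))).
  rewrite -[ltLHS](_ : set_mass p B * expR (h / 8) = _); last first.
    by rewrite eh mulrCA mulfV ?mulr1// gt_eqF.
  rewrite /set_mass mulr_suml.
  have [x xB x0] : exists2 x, x \in B & 0 < product_mass p x.
    apply/not_exists2P => H'.
    move: B0; rewrite /set_mass big1 ?ltxx// => x xB.
    have [//|] := H' x; move/negP; rewrite -leNgt => x0.
    by apply/eqP; rewrite eq_le x0 product_mass_ge0.
  rewrite (bigD1 x)//= [ltRHS](bigD1 x)//=.
  have hx y : y \in B -> h < phi y.
    by move=> yB; rewrite ltNge; apply/negP => yh; apply: H; exists y.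
  rewrite ltr_leD//; first by rewrite ltr_pM2l// ltr_expR ltr_pM2r ?hx// invr_gt0.
  apply: ler_sum => y /andP[yB _].
  by rewrite ler_wpM2l ?product_mass_ge0// ler_expR ler_pM2r ?ltW ?hx// invr_gt0.
rewrite big_mkcond /=; apply: ler_sum => x _; case: ifP => // _.
by rewrite mulr_ge0 ?expR_ge0 ?product_mass_ge0.
Qed.

End talagrand.

(** * Euclidean norm of finite families *)
Section euclid.
Context {R : realType} {I : finType}.
Implicit Types u v w : I -> R.

Definition dot u v : R := \sum_i u i * v i.

Definition enorm u : R := Num.sqrt (dot u u).

Lemma dotC u v : dot u v = dot v u.
Proof. by apply: eq_bigr => i _; rewrite mulrC. Qed.

Lemma dotDl u v w : dot (fun i => u i + v i) w = dot u w + dot v w.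
Proof. by rewrite /dot -big_split; apply: eq_bigr => i _; rewrite mulrDl. Qed.

Lemma dotBl u v w : dot (fun i => u i - v i) w = dot u w - dot v w.
Proof. by rewrite /dot -sumrB; apply: eq_bigr => i _; rewrite mulrBl. Qed.

Lemma dotZl a u v : dot (fun i => a * u i) v = a * dot u v.
Proof. by rewrite /dot mulr_sumr; apply: eq_bigr => i _; rewrite mulrA. Qed.

Lemma dotDr u v w : dot w (fun i => u i + v i) = dot w u + dot w v.
Proof. by rewrite !(dotC w) dotDl. Qed.

Lemma dotBr u v w : dot w (fun i => u i - v i) = dot w u - dot w v.
Proof. by rewrite !(dotC w) dotBl. Qed.

Lemma dotZr a u v : dot v (fun i => a * u i) = a * dot v u.
Proof. by rewrite !(dotC v) dotZl. Qed.

Lemma dot_sumr (J : finType) (nu : J -> R) (F : J -> I -> R) u :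
  dot u (fun i => \sum_j nu j * F j i) = \sum_j nu j * dot u (F j).
Proof.
rewrite /dot; under eq_bigr do rewrite mulr_sumr.
rewrite exchange_big; apply: eq_bigr => j _; rewrite mulr_sumr.
by apply: eq_bigr => i _; rewrite mulrCA.
Qed.

Lemma dot_ge0 u : 0 <= dot u u.
Proof. by apply: sumr_ge0 => i _; rewrite -expr2 sqr_ge0. Qed.

Lemma enorm_ge0 u : 0 <= enorm u. Proof. exact: sqrtr_ge0. Qed.

Lemma enorm_sq u : enorm u ^+ 2 = dot u u.
Proof. by rewrite sqr_sqrtr// dot_ge0. Qed.

Lemma eq_enorm u v : u =1 v -> enorm u = enorm v.
Proof.
by move=> uv; congr Num.sqrt; apply: eq_bigr => i _; rewrite uv.
Qed.

Lemma dot_sq_le u v : dot u v ^+ 2 <= dot u u * dot v v.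
Proof.
have : 0 <= dot (fun i => dot v v * u i - dot u v * v i)
                (fun i => dot v v * u i - dot u v * v i) by apply: dot_ge0.
rewrite dotBl !dotBr !dotZl !dotZr (dotC v u).
set a := dot u u; set b := dot v v; set c := dot u v => h.
have b0 : 0 <= b by apply: dot_ge0.
have [b00|bN0] := eqVneq b 0; last first.
  have bp : 0 < b by rewrite lt_neqAle eq_sym bN0.
  rewrite -subr_ge0 -(pmulr_rge0 _ bp); apply: le_trans h _.
  by rewrite le_eqVlt; apply/orP; left; apply/eqP; ring.
have v0 i : v i = 0.
  have /eqP := @psumr_eq0P _ _ predT (fun i => v i * v i)
    (fun i _ => sqr_ge0 (v i)) b00 i isT.
  by rewrite -expr2 sqrf_eq0 => /eqP.
rewrite (_ : c = 0) ?expr0n ?b00 ?mulr0//.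
by apply: big1 => i _; rewrite v0 mulr0.
Qed.

Lemma dot_le u v : dot u v <= enorm u * enorm v.
Proof.
rewrite -sqrtrM ?dot_ge0//; apply: le_trans (ler_norm _) _.
by rewrite -sqrtr_sqr ler_wsqrtr// dot_sq_le.
Qed.

Lemma enorm_triangle u v : enorm (fun i => u i + v i) <= enorm u + enorm v.
Proof.
rewrite -(@ler_pXn2r _ 2)// ?nnegrE ?addr_ge0 ?enorm_ge0//.
rewrite enorm_sq dotDl !dotDr (dotC v u) sqrrD !enorm_sq.
by have := dot_le u v; lra.
Qed.

Lemma enormZ a u : enorm (fun i => a * u i) = `|a| * enorm u.
Proof. by rewrite /enorm dotZl dotZr mulrA -expr2 sqrtrM ?sqr_ge0// sqrtr_sqr. Qed.

Lemma enormN u : enorm (fun i => - u i) = enorm u.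
Proof.
by rewrite (@eq_enorm _ (fun i => - 1 * u i)) ?enormZ ?normrN1 ?mul1r// => i; rewrite mulN1r.
Qed.

Lemma enormB u v : enorm (fun i => u i - v i) <= enorm u + enorm v.
Proof. by rewrite -(enormN v); apply: enorm_triangle. Qed.

Lemma enorm_sum (J : finType) (nu : J -> R) (F : J -> I -> R) :
  (forall j, 0 <= nu j) ->
  enorm (fun i => \sum_j nu j * F j i) <= \sum_j nu j * enorm (F j).
Proof.
move=> nu0; set S := fun i => _.
have [s0|sN0] := eqVneq (enorm S) 0.
  by rewrite s0; apply: sumr_ge0 => j _; rewrite mulr_ge0 ?enorm_ge0.
have sp : 0 < enorm S by rewrite lt_neqAle eq_sym sN0 enorm_ge0.
rewrite -(@ler_pM2l _ (enorm S))// -expr2 enorm_sq dot_sumr mulr_sumr.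
by apply: ler_sum => j _; rewrite mulrCA ler_wpM2l// dot_le.
Qed.

End euclid.

(** * The derivative of the tensor power *)
Section tensor_powers.
Context {R : realType} {n d : nat}.
Implicit Types (x y z : 'I_n -> R).
Local Notation idx := {ffun 'I_d -> 'I_n}.

Lemma dot_sum (I J : finType) (u : I -> R) (F : J -> I -> R) :
  dot u (fun i => \sum_j F j i) = \sum_j dot u (F j).
Proof.
rewrite /dot; under eq_bigr do rewrite mulr_sumr.
by rewrite exchange_big.
Qed.

Lemma tensor_normE (u : tensor_space R n d) : tensor_norm u = enorm (u : idx -> R).
Proof. by []. Qed.

Lemma dot_pure (x y : 'I_d -> 'I_n -> R) :
  dot (pure_tensor x : idx -> R) (pure_tensor y) = \prod_(k < d) dot (x k) (y k).
Proof. exact: tensor_inner_pure. Qed.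

Lemma dot_tensor_power x y :
  dot (tensor_power x : idx -> R) (tensor_power y) = dot x y ^+ d.
Proof. by rewrite dot_pure prodr_const card_ord. Qed.

Lemma tensor_powerZ (a : R) x (i : idx) :
  tensor_power (fun j => a * x j) i = a ^+ d * tensor_power x i.
Proof. by rewrite !ffunE big_split /= prodr_const card_ord. Qed.

Definition slot x (h : 'I_n -> R) (k j : 'I_d) : 'I_n -> R :=
  if j == k then h else x.

(** The derivative at x of the d-th tensor power, in the direction h. *)
Definition tensor_derivative x h (i : idx) : R :=
  \sum_k (pure_tensor (slot x h k) i : R).

Lemma prod_slot (a b : R) (k : 'I_d) :
  \prod_(j < d) (if j == k then a else b) = a * b ^+ d.-1.
Proof.
rewrite (bigD1 k)//= eqxx; congr (_ * _).
rewrite (eq_bigr (fun=> b)) => [|j /negbTE -> //].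
by rewrite prodr_const cardC1 card_ord.
Qed.

Lemma dot_power_derivative y x h :
  dot (tensor_power y : idx -> R) (tensor_derivative x h) =
  d%:R * (dot y h * dot y x ^+ d.-1).
Proof.
rewrite dot_sum (eq_bigr (fun=> dot y h * dot y x ^+ d.-1)).
  by rewrite sumr_const card_ord mulr_natl.
move=> k _; rewrite dot_pure -(prod_slot _ _ k); apply: eq_bigr => j _.
by rewrite /slot; case: ifP.
Qed.

(** The products of two different slots contribute <x,h>^2 each, and there are
d (d-1) of them. *)
Lemma dot_derivative x h : dot x x = 1 ->
  dot (tensor_derivative x h) (tensor_derivative x h) =
  d%:R * dot h h + d%:R * (d%:R - 1) * dot x h ^+ 2.
Proof.
move=> x1; rewrite dot_sum.
rewrite (eq_bigr (fun=> dot h h + (d%:R - 1) * dot x h ^+ 2)); last first.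
  move=> l _; rewrite dotC dot_sum (bigD1 l)//=.
  congr (_ + _).
    rewrite dot_pure -[RHS]mulr1 -[X in _ * X](expr1n _ d.-1) -(prod_slot _ _ l).
    by apply: eq_bigr => j _; rewrite /slot; case: ifP.
  rewrite (eq_bigr (fun=> dot x h ^+ 2)); last first.
    move=> k kl; rewrite dot_pure (bigD1 l)//= (bigD1 k)//= big1 ?mulr1.
      by rewrite /slot !eqxx (negbTE kl) eq_sym (negbTE kl) (dotC h x) expr2.
    by move=> j /andP[/negbTE jl /negbTE jk]; rewrite /slot jl jk.
  rewrite sumr_const cardC1 card_ord -[LHS]mulr_natl.
  by rewrite -subn1 natrB//; apply: leq_ltn_trans (ltn_ord l).
rewrite sumr_const card_ord -[LHS]mulr_natl; ring.
Qed.

Lemma tensor_derivative_sum (J : finType) (nu : J -> R) x (h : J -> 'I_n -> R) i :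
  tensor_derivative x (fun l => \sum_j nu j * h j l) i =
  \sum_j nu j * tensor_derivative x (h j) i.
Proof.
have slotE g k : (pure_tensor (slot x g k) i : R) =
    g (i k) * \prod_(j < d | j != k) x (i j).
  rewrite ffunE (bigD1 k)//= /slot eqxx; congr (_ * _).
  by apply: eq_bigr => j /negbTE ->.
rewrite /tensor_derivative; under [RHS]eq_bigr do rewrite mulr_sumr.
rewrite exchange_big; apply: eq_bigr => k _.
rewrite slotE mulr_suml; apply: eq_bigr => j _.
by rewrite slotE mulrA.
Qed.

End tensor_powers.

(** * Scalar power estimates *)
Section power_estimates.
Context {R : realType}.
Implicit Types (b p t : R) (m d : nat).

Lemma bernoulli_pow b m : 0 <= b <= 1 -> 1 - b ^+ m <= m%:R * (1 - b).
Proof.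
move=> /andP[b0 b1]; elim: m => [|m IH]; first by rewrite expr0 mul0r subrr.
rewrite exprS -natr1.
have bm : b ^+ m <= 1 by apply: exprn_ile1.
nra.
Qed.

Lemma taylor_pow b d : 0 <= b <= 1 ->
  1 - b ^+ d - d%:R * (1 - b) * b ^+ d.-1 <= d%:R ^+ 2 * (1 - b) ^+ 2.
Proof.
move=> /andP[b0 b1]; case: d => [|d]; first by rewrite expr0 !mul0r !subrr expr0n mul0r.
elim: d => [|d IH]; first by rewrite expr1 expr0 mulr1 !expr1n !mul1r; have := sqr_ge0 (1 - b); lra.
rewrite /= in IH *.
have bd : 0 <= b ^+ d <= 1 by rewrite exprn_ge0// exprn_ile1.
have d0 : 0 <= d.+1%:R :> R by [].
rewrite -(natr1 d.+1) !(exprS b d.+1) !(exprS b d) in IH *.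
set D := d.+1%:R in IH d0 *; set B := b ^+ d in IH bd *.
have : 0 <= D * (1 - b) ^+ 2 * (1 - B).
  by rewrite !mulr_ge0 ?sqr_ge0//; lra.
have : 0 <= D * (1 - b) ^+ 2 by rewrite mulr_ge0 ?sqr_ge0.
have := sqr_ge0 (1 - b).
move: IH; move: bd => /andP[B0 B1]; nra.
Qed.

(** For unit vectors x and y with <x,y> = b, the left-hand side is the squared
norm of the second order Taylor remainder of the tensor power between x
and y.  For b < 0 the right-hand side is already of order d^2. *)
Lemma taylor_pow_norm b d : (0 < d)%N -> `|b| <= 1 ->
  2 - 2 * b ^+ d - 2 * d%:R * (1 - b) * b ^+ d.-1 + d%:R * (d%:R - 1) * (1 - b) ^+ 2
  <= 9 * (d%:R * (1 - b)) ^+ 2.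
Proof.
move=> d0 b1; have d1 : 1 <= d%:R :> R by rewrite ler1n.
set p := 1 - b.
have [bp|bn] := leP 0 b.
  have := @taylor_pow b d; rewrite bp (le_trans (ler_norm b) b1) => /(_ isT).
  rewrite -/p => h; have := sqr_ge0 p; nra.
have p1 : 1 <= p by rewrite /p; lra.
have h m : `|b ^+ m| <= 1 by rewrite normrX exprn_ile1.
have := h d; have := h d.-1; rewrite !ler_norml => /andP[h1 h2] /andP[h3 h4].
have dp : 1 <= d%:R * p by nra.
have : d%:R * p * (- b ^+ d.-1) <= d%:R * p by rewrite ler_piMr//; lra.
nra.
Qed.

Lemma pow_near_one q d t : `|q - 1| <= t -> t <= 1 -> d%:R * t <= 4^-1 ->
  `|q ^+ d - 1| <= 2 * (d%:R * t).
Proof.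
rewrite ler_norml => /andP[q1 q2] t1 dt.
have t0 : 0 <= t by lra.
have dt0 : 0 <= d%:R * t by rewrite mulr_ge0.
have q0 : 0 <= q by lra.
rewrite ler_norml; apply/andP; split.
  have := @bernoulli_pow (1 - t) d; rewrite (_ : 0 <= 1 - t <= 1); last by apply/andP; split; lra.
  move=> /(_ isT).
  have : (1 - t) ^+ d <= q ^+ d by apply: lerXn2r; rewrite ?nnegrE//; lra.
  nra.
have : q ^+ d <= (1 + t) ^+ d by apply: lerXn2r; rewrite ?nnegrE//; lra.
have : (1 + t) ^+ d <= expR (d%:R * t).
  rewrite expRM_natl; apply: lerXn2r; rewrite ?nnegrE ?expR_ge0//; first lra.
  exact: expR_ge1Dx.
have : expR (d%:R * t) <= 1 + d%:R * t + (d%:R * t) ^+ 2 by apply: expR_le_quad; lra.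
nra.
Qed.

End power_estimates.

(** * Averages of tensor powers near a sphere *)
Section power_average.
Context {R : realType} {n d : nat}.
Implicit Types (x y z : 'I_n -> R).
Local Notation idx := {ffun 'I_d -> 'I_n}.
Local Notation pw := (fun x => tensor_power x : idx -> R).
Local Notation D := (@tensor_derivative R n d).

(** On the unit sphere 1 - <x,y> is half of |x - y|^2, so the bound of
[taylor_pow_norm] is quadratic in x - y. *)
Lemma taylor_remainder x y : (0 < d)%N -> dot x x = 1 -> dot y y = 1 ->
  enorm (fun i => pw x i - pw y i - D x (fun l => x l - y l) i) <=
  3 / 2 * d%:R * dot (fun l => x l - y l) (fun l => x l - y l).
Proof.
move=> d0 x1 y1; pose h := fun l => x l - y l; rewrite -/h.
set b := dot x y.
have hh : dot h h = 2 * (1 - b).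
  by rewrite /h dotBl !dotBr x1 y1 (dotC y) -/b; ring.
have xh : dot x h = 1 - b by rewrite /h dotBr x1.
have yh : dot y h = b - 1 by rewrite /h dotBr y1 (dotC y).
have b1 : `|b| <= 1.
  rewrite -(@ler_pXn2r _ 2)// ?nnegrE// expr1n real_normK ?num_real//.
  by apply: le_trans (dot_sq_le x y) _; rewrite x1 y1 mulr1.
rewrite -(@ler_pXn2r _ 2)// ?nnegrE ?enorm_ge0//; last first.
  by rewrite !mulr_ge0 ?dot_ge0//; lra.
rewrite enorm_sq dotBl !dotBr !dotBl.
rewrite ![dot (D x h) (pw _)]dotC !dot_power_derivative dot_derivative//.
rewrite !dot_tensor_power (dotC y x) -/b x1 y1 xh yh hh !expr1n.
have eq_le (a c : R) : a = c -> a <= c by move=> ->.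
apply: (@le_trans _ _ (9 * (d%:R * (1 - b)) ^+ 2)).
  by apply: le_trans (taylor_pow_norm d0 b1); apply: eq_le; ring.
by apply: eq_le; field.
Qed.

(** The first order terms average to the derivative in the direction
u = E(x - y).  Since all points lie on the sphere, <x,u> is half the mean of
|x - y|^2, hence the part of the derivative that is of order d, not sqrt d,
is absorbed by the second order term. *)
Lemma sphere_power_average (J : finType) (nu : J -> R) x (y : J -> 'I_n -> R) :
  (0 < d)%N -> (forall j, 0 <= nu j) -> \sum_j nu j = 1 ->
  dot x x = 1 -> (forall j, dot (y j) (y j) = 1) ->
  enorm (fun i => pw x i - \sum_j nu j * pw (y j) i) <=
  Num.sqrt d%:R * enorm (fun l => \sum_j nu j * (x l - y j l)) +
  2 * d%:R * \sum_j nu j * dot (fun l => x l - y j l) (fun l => x l - y j l).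
Proof.
move=> d0 nu0 nu1 x1 y1.
pose u := fun l => \sum_j nu j * (x l - y j l); rewrite -/u.
set w := \sum_j nu j * dot _ _.
have w0 : 0 <= w by apply: sumr_ge0 => j _; rewrite mulr_ge0 ?dot_ge0.
pose h j := fun l => x l - y j l.
have -> : enorm (fun i => pw x i - \sum_j nu j * pw (y j) i) =
    enorm (fun i => D x u i + \sum_j nu j * (pw x i - pw (y j) i - D x (h j) i)).
  apply: eq_enorm => i; rewrite tensor_derivative_sum -big_split /=.
  rewrite -[X in X - _]mul1r -nu1 mulr_suml -sumrB.
  by apply: eq_bigr => j _; rewrite -/(h j); ring.
apply: le_trans (enorm_triangle _ _) _.
have xu : dot x u = w / 2.
  rewrite /u dot_sumr mulr_suml; apply: eq_bigr => j _.
  by rewrite -/(h j) /h dotBr dotBl !dotBr x1 y1 (dotC (y j)); field.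
have hD : enorm (D x u) <= Num.sqrt d%:R * enorm u + d%:R * w / 2.
  rewrite -(@ler_pXn2r _ 2)// ?nnegrE ?enorm_ge0//; last first.
    by rewrite addr_ge0 ?mulr_ge0 ?sqrtr_ge0 ?enorm_ge0.
  rewrite enorm_sq dot_derivative// sqrrD exprMn sqr_sqrtr// enorm_sq xu.
  have h1 : 0 <= Num.sqrt d%:R * enorm u * (d%:R * w / 2).
    by rewrite !mulr_ge0 ?sqrtr_ge0 ?enorm_ge0.
  have h2 : 0 <= d%:R * (w / 2) ^+ 2 by rewrite mulr_ge0 ?sqr_ge0.
  move: h1 h2; rewrite !expr2; set a := Num.sqrt _; nra.
have hR : enorm (fun i => \sum_j nu j * (pw x i - pw (y j) i - D x (h j) i)) <=
    3 / 2 * d%:R * w.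
  apply: le_trans (enorm_sum _ nu0) _.
  rewrite /w mulr_sumr; apply: ler_sum => j _.
  by rewrite [leRHS]mulrCA ler_wpM2l// taylor_remainder.
lra.
Qed.

(** Projecting a point of a thin shell to the sphere moves its d-th power by
d times the thickness of the shell. *)
Lemma enorm_normalize x t : `|dot x x - 1| <= t -> t <= 2^-1 ->
  let xh := fun l => (enorm x)^-1 * x l in
  [/\ dot xh xh = 1, enorm (fun l => x l - xh l) <= t &
     d%:R * t <= 4^-1 -> enorm (fun i => pw x i - pw xh i) <= 2 * (d%:R * t)].
Proof.
move=> xt t2 xh.
have x0 : 0 < dot x x by move: xt; rewrite ler_norml => /andP[]; lra.
have r0 : 0 < enorm x by rewrite sqrtr_gt0.
have r0' : enorm x != 0 by rewrite gt_eqF.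
have xh1 : dot xh xh = 1.
  by rewrite dotZl dotZr -enorm_sq; field.
have abs1 (a : R) : 0 <= a -> `|a - 1| <= `|a ^+ 2 - 1|.
  move=> a0; rewrite -(expr1n _ 2) subr_sqr expr1n normrM ler_peMr//.
  by rewrite ger0_norm; lra.
split => //.
  rewrite (@eq_enorm _ _ _ (fun l => (enorm x - 1) * xh l)); last first.
    by move=> l; rewrite /xh mulrBl mul1r mulVKf.
  rewrite enormZ /enorm xh1 sqrtr1 mulr1.
  by apply: le_trans (abs1 _ (ltW r0)) _; rewrite enorm_sq.
move=> dt.
have -> : enorm (fun i => pw x i - pw xh i) =
    enorm (fun i => (enorm x ^+ d - 1) * pw xh i).
  apply: eq_enorm => i; rewrite mulrBl mul1r -tensor_powerZ; congr (_ - _).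
  by rewrite !ffunE; apply: eq_bigr => k _; rewrite /xh mulVKf.
rewrite enormZ [enorm (pw xh)](_ : _ = 1) ?mulr1; last first.
  by rewrite /enorm dot_tensor_power xh1 expr1n sqrtr1.
apply: le_trans (abs1 _ (exprn_ge0 _ (ltW r0))) _.
rewrite exprAC enorm_sq; apply: pow_near_one => //; lra.
Qed.

Lemma shell_power_average (J : finType) (nu : J -> R) x (y : J -> 'I_n -> R) t :
  (0 < d)%N -> (forall j, 0 <= nu j) -> \sum_j nu j = 1 ->
  `|dot x x - 1| <= t -> (forall j, `|dot (y j) (y j) - 1| <= t) ->
  d%:R * t <= 4^-1 ->
  enorm (fun i => pw x i - \sum_j nu j * pw (y j) i) <=
  Num.sqrt d%:R * enorm (fun l => \sum_j nu j * (x l - y j l)) +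
  4 * d%:R * (\sum_j nu j * dot (fun l => x l - y j l) (fun l => x l - y j l))
  + 14 * (d%:R * t).
Proof.
move=> d0 nu0 nu1 xt yt dt.
have d1 : 1 <= d%:R :> R by rewrite ler1n.
have t0 : 0 <= t by apply: le_trans xt.
have t2 : t <= 4^-1 by nra.
have t2' : t <= 2^-1 by lra.
have [] := enorm_normalize xt t2'; set xh := fun l => _ => xh1 xxh /(_ dt) pxh.
pose yh j l := (enorm (y j))^-1 * y j l.
have yhP j := enorm_normalize (yt j) t2'.
have yh1 j : dot (yh j) (yh j) = 1 by have [] := yhP j.
have yyh j : enorm (fun l => y j l - yh j l) <= t by have [] := yhP j.
have pyh j : enorm (fun i => pw (y j) i - pw (yh j) i) <= 2 * (d%:R * t).
  by have [_ _ /(_ dt)] := yhP j.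
have avg (F : J -> R) c : (forall j, F j <= c) -> \sum_j nu j * F j <= c.
  move=> Fc; rewrite -[leRHS]mul1r -nu1 mulr_suml; apply: ler_sum => j _.
  by rewrite ler_wpM2l.
have := sphere_power_average d0 nu0 nu1 xh1 yh1.
set uh := enorm (fun l => \sum_j nu j * (xh l - yh j l)).
set wh := \sum_j nu j * dot (fun l => xh l - yh j l) (fun l => xh l - yh j l).
set u := enorm (fun l => \sum_j nu j * (x l - y j l)).
set w := \sum_j nu j * dot (fun l => x l - y j l) (fun l => x l - y j l).
move=> main.
have uhu : uh <= u + 2 * t.
  rewrite /uh (@eq_enorm _ _ _ (fun l => \sum_j nu j * (x l - y j l) +
     (- (x l - xh l) + \sum_j nu j * (y j l - yh j l)))); last first.
    move=> l; rewrite -[X in - X]mul1r -nu1 mulr_suml -sumrN -!big_split /=.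
    by apply: eq_bigr => j _; ring.
  apply: le_trans (enorm_triangle _ _) _; rewrite lerD2l.
  apply: le_trans (enorm_triangle _ _) _; rewrite enormN.
  have := @enorm_sum _ _ _ nu (fun j l => y j l - yh j l) nu0.
  have := avg _ _ yyh; lra.
have whw : wh <= 2 * w + 8 * t ^+ 2.
  rewrite -[X in _ + X]mul1r -nu1 /w mulr_sumr mulr_suml -big_split /=.
  apply: ler_sum => j _; rewrite mulrCA -mulrDr ler_wpM2l//.
  set h := fun l => x l - y j l.
  have : enorm (fun l => xh l - yh j l) <= enorm h + 2 * t.
    rewrite (@eq_enorm _ _ _ (fun l => h l + (- (x l - xh l) + (y j l - yh j l)))); last first.
      by move=> l; rewrite /h; ring.
    apply: le_trans (enorm_triangle _ _) _; rewrite lerD2l.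
    apply: le_trans (enorm_triangle _ _) _; rewrite enormN.
    by have := yyh j; lra.
  rewrite -!enorm_sq; set a := enorm _; set b := enorm h => ab.
  have a0 : 0 <= a by apply: enorm_ge0.
  have b0 : 0 <= b by apply: enorm_ge0.
  have : a ^+ 2 <= (b + 2 * t) ^+ 2 by apply: lerXn2r; rewrite ?nnegrE//; lra.
  have := sqr_ge0 (b - 2 * t); nra.
have fin : enorm (fun i => pw x i - \sum_j nu j * pw (y j) i) <=
    4 * (d%:R * t) + enorm (fun i => pw xh i - \sum_j nu j * pw (yh j) i).
  rewrite (@eq_enorm _ _ _ (fun i => (pw x i - pw xh i) +
    (- (\sum_j nu j * (pw (y j) i - pw (yh j) i)) +
     (pw xh i - \sum_j nu j * pw (yh j) i)))); last first.
    move=> i; under [X in - X + _]eq_bigr do rewrite mulrBr.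
    by rewrite sumrB; ring.
  apply: le_trans (enorm_triangle _ _) _.
  have h1 := enorm_triangle (fun i => - (\sum_j nu j * (pw (y j) i - pw (yh j) i)))
     (fun i => pw xh i - \sum_j nu j * pw (yh j) i).
  rewrite enormN in h1.
  have h2 := @enorm_sum _ _ _ nu (fun j i => pw (y j) i - pw (yh j) i) nu0.
  have h3 := avg _ _ pyh; move: pxh h1 h2 h3; lra.
have sd : Num.sqrt d%:R <= d%:R :> R.
  rewrite -[leRHS]ger0_norm// -sqrtr_sqr ler_wsqrtr// expr2 ler_peMr//.
have sd0 : 0 <= Num.sqrt d%:R :> R by apply: sqrtr_ge0.
have h5 : Num.sqrt d%:R * uh <= Num.sqrt d%:R * u + 2 * (d%:R * t).
  apply: le_trans (ler_wpM2l sd0 uhu) _; nra.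
have h6 : d%:R * wh <= 2 * (d%:R * w) + 2 * (d%:R * t).
  have := ler_wpM2l (ler0n R d) whw; have : 0 <= d%:R * t by rewrite mulr_ge0.
  nra.
have dt0 : 0 <= d%:R * t by rewrite mulr_ge0.
apply: le_trans fin _; move: main h5 h6; lra.
Qed.

End power_average.

(** * The gap of a convex Lipschitz function *)
Section convex_gap.
Context {R : realType} {n d : nat}.
Implicit Types (x y z : 'I_n -> R) (f : tensor_space R n d -> R).

Lemma convex_function2 f (a b : R) (u v : tensor_space R n d) :
  convex_function setT f -> 0 <= a -> 0 <= b -> 0 < a + b ->
  f ((a + b)^-1 *: (a *: u + b *: v)) <= (a + b)^-1 * (a * f u + b * f v).
Proof.
move=> cf a0 b0 ab.
have l0 : 0 <= a / (a + b) by rewrite divr_ge0// ltW.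
have l1 : a / (a + b) <= 1 by rewrite ler_pdivrMr// mul1r lerDl.
have h : f ((a / (a + b)) *: u + (1 - a / (a + b)) *: v) <=
    a / (a + b) * f u + (1 - a / (a + b)) * f v.
  by apply: (cf (Itv01 l0 l1) u v); rewrite inE.
have e : 1 - a / (a + b) = b / (a + b) by field; rewrite gt_eqF.
rewrite e in h; rewrite scalerDr !scalerA mulrDr !mulrA ![(a + b)^-1 * _]mulrC.
exact: h.
Qed.

(** The weight c of the extra point u keeps the total mass positive, so that
the induction never divides by zero. *)
Lemma jensen_seq (J : Type) (s : seq J) (Q : pred J) (nu : J -> R)
    (v : J -> tensor_space R n d) f c u :
  convex_function setT f -> (forall j, 0 <= nu j) -> 0 < c ->
  f ((c + \sum_(j <- s | Q j) nu j)^-1 *: (c *: u + \sum_(j <- s | Q j) nu j *: v j))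
  <= (c + \sum_(j <- s | Q j) nu j)^-1 * (c * f u + \sum_(j <- s | Q j) nu j * f (v j)).
Proof.
move=> cf nu0; elim: s c u => [|j s IH] c u c0.
  by rewrite !big_nil !addr0 scalerA mulrA mulVf ?gt_eqF// scale1r mul1r.
rewrite !big_cons; case: ifP => _; last exact: IH.
have c'0 : 0 < c + nu j by rewrite ltr_wpDr.
pose u' := (c + nu j)^-1 *: (c *: u + nu j *: v j).
have e1 : c *: u + nu j *: v j = (c + nu j) *: u'.
  by rewrite scalerA mulfV ?gt_eqF// scale1r.
rewrite !addrA e1; apply: le_trans (IH _ u' c'0) _.
rewrite ler_wpM2l//.
  by rewrite invr_ge0 addr_ge0 ?(ltW c'0)//; apply: sumr_ge0.
rewrite lerD2r -ler_pdivlMl//; apply: convex_function2 => //; exact: ltW.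
Qed.

Lemma jensen_fin (J : finType) (nu : J -> R) (v : J -> tensor_space R n d) f :
  convex_function setT f -> (forall j, 0 <= nu j) -> \sum_j nu j = 1 ->
  f (\sum_j nu j *: v j) <= \sum_j nu j * f (v j).
Proof.
move=> cf nu0 nu1.
have [j0 j0p] : exists j, 0 < nu j.
  apply/not_existsP => H; have := oner_neq0 R; rewrite -nu1 big1 ?eqxx//.
  by move=> j _; apply/eqP; rewrite eq_le nu0 andbT leNgt; apply/negP/H.
rewrite [\sum_j _ *: _](bigD1 j0)//= [leRHS](bigD1 j0)//=.
have := @jensen_seq J (index_enum J) (fun j => j != j0) nu v f (nu j0) (v j0) cf nu0 j0p.
have -> : nu j0 + \sum_(j | j != j0) nu j = 1 by rewrite -nu1 [RHS](bigD1 j0).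
by rewrite invr1 scale1r mul1r.
Qed.

(** Jensen's inequality replaces the average of f by f of the average, where the
Lipschitz property applies; the rest is [shell_power_average] rescaled to
radius N. *)
Lemma convex_gap f (L N t : R) (J : finType) (nu : J -> R) x (y : J -> 'I_n -> R) :
  (0 < d)%N -> 0 <= L -> convex_function setT f -> tensor_lipschitz L f ->
  (forall j, 0 <= nu j) -> \sum_j nu j = 1 -> 0 < N ->
  `|dot x x - N ^+ 2| <= t * N ^+ 2 ->
  (forall j, `|dot (y j) (y j) - N ^+ 2| <= t * N ^+ 2) ->
  d%:R * t <= 4^-1 ->
  f (tensor_power x) - \sum_j nu j * f (tensor_power (y j)) <=
  L * N ^+ d.-1 * (Num.sqrt d%:R * enorm (fun l => \sum_j nu j * (x l - y j l)) +
  4 * d%:R * (\sum_j nu j * dot (fun l => x l - y j l) (fun l => x l - y j l)) / N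
  + 14 * (d%:R * t) * N).
Proof.
move=> d0 L0 cf lf nu0 nu1 N0 xt yt dt.
have NN0 : N != 0 by rewrite gt_eqF.
pose x' := fun l => N^-1 * x l; pose y' j := fun l => N^-1 * y j l.
have shell z : `|dot z z - N ^+ 2| <= t * N ^+ 2 ->
    `|dot (fun l => N^-1 * z l) (fun l => N^-1 * z l) - 1| <= t.
  move=> zt; rewrite dotZl dotZr.
  rewrite (_ : _ - 1 = N ^- 2 * (dot z z - N ^+ 2)); last by field.
  rewrite normrM gtr0_norm ?invr_gt0 ?exprn_gt0// ler_pdivrMl ?exprn_gt0//.
  by rewrite mulrC.
have scale z (i : {ffun 'I_d -> 'I_n}) : tensor_power z i =
    N ^+ d * tensor_power (fun l => N^-1 * z l) i :> R.
  by rewrite -tensor_powerZ !ffunE; apply: eq_bigr => k _; rewrite mulVKf.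
have main := @shell_power_average R n d J nu x' y' t d0 nu0 nu1 (shell _ xt)
   (fun j => shell _ (yt j)) dt.
apply: (@le_trans _ _ (f (tensor_power x) - f (\sum_j nu j *: tensor_power (y j)))).
  by rewrite lerD2l lerN2; apply: jensen_fin.
apply: le_trans (ler_norm _) _; apply: le_trans (lf _ _) _.
rewrite -mulrA ler_wpM2l// tensor_normE.
have -> : enorm (tensor_power x - \sum_j nu j *: tensor_power (y j) : {ffun {ffun 'I_d -> 'I_n} -> R^o}) =
   N ^+ d * enorm (fun i : {ffun 'I_d -> 'I_n} => tensor_power x' i - \sum_j nu j * tensor_power (y' j) i).
  rewrite -[X in X * _](@ger0_norm _ (N ^+ d)) ?exprn_ge0 ?ltW// -enormZ.
  apply: eq_enorm => i.
  transitivity (tensor_power x i - \sum_j nu j * tensor_power (y j) i : R).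
    rewrite !ffunE sum_ffunE; congr (_ - _).
    by apply: eq_bigr => j _; rewrite !ffunE.
  rewrite mulrBr mulr_sumr; congr (_ - _); first exact: scale.
  by apply: eq_bigr => j _; rewrite mulrCA -scale.
rewrite -{1}(prednK d0) exprSr -mulrA ler_wpM2l ?exprn_ge0 ?(ltW N0)//.
have -> : enorm (fun l => \sum_j nu j * (x l - y j l)) =
    N * enorm (fun l => \sum_j nu j * (x' l - y' j l)).
  rewrite -[X in X * _](gtr0_norm N0) -enormZ; apply: eq_enorm => l.
  by rewrite mulr_sumr; apply: eq_bigr => j _; rewrite /x' /y'; field.
have -> : \sum_j nu j * dot (fun l => x l - y j l) (fun l => x l - y j l) =
    N ^+ 2 * \sum_j nu j * dot (fun l => x' l - y' j l) (fun l => x' l - y' j l).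
  rewrite mulr_sumr; apply: eq_bigr => j _; rewrite mulrCA; congr (_ * _).
  rewrite /dot mulr_sumr; apply: eq_bigr => l _; rewrite /x' /y'; field.
  by [].
apply: le_trans (ler_wpM2l (ltW N0) main) _.
by rewrite le_eqVlt; apply/orP; left; apply/eqP; field.
Qed.

End convex_gap.

(** * Points with truncated coordinates *)
Section truncated_gap.
Context {R : realType} {n d : nat} {C : eqType}.
Variables (D : R -> R) (cell : R -> C).
Implicit Types (x y z : 'I_n -> R).

Local Notation Dv x := (fun l => D (x l)).

(** A point is regular when it lies in a shell of thickness eta around the
sphere of radius N, when its truncation D changes it by order eta / sqrt d
only, and when the truncated coordinates have a fourth moment of
order N^2.  These are the properties that hold with overwhelming probability. *)
Definition regular (N M Q eta : R) x : Prop :=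
  [/\ `|dot x x - N ^+ 2| <= eta * N / d%:R,
      dot (fun l => x l - D (x l)) (fun l => x l - D (x l)) <= 2 * eta ^+ 2 / d%:R,
      dot (Dv x) (Dv x) <= dot x x <= dot (Dv x) (Dv x) + 2 * eta ^+ 2 / d%:R,
      forall l, `|D (x l)| <= M &
      \sum_l D (x l) ^+ 4 <= Q * N ^+ 2].

(** With p_l the probability that y_l and x_l lie in different cells, the first
order displacement is at most 2 M |p|.  For the second order one,
D(y_l)^2 1(cells differ) has mean D(x_l)^2 p_l plus the mean of
D(y_l)^2 - D(x_l)^2, whose sum over l is a difference of squared norms, small
for two points of the shell; Cauchy-Schwarz bounds the sum of D(x_l)^2 p_l
by the fourth moment. *)
Lemma truncated_gap f (L N M Q eta h : R) (J : finType) (nu : J -> R)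
    x (y : J -> 'I_n -> R) :
  (forall a b, cell a = cell b -> D a = D b) ->
  (0 < d)%N -> 0 <= L -> convex_function setT f ->
  @tensor_lipschitz R n d L f ->
  (forall j, 0 <= nu j) -> \sum_j nu j = 1 -> 0 < N -> 0 <= M -> 0 <= Q ->
  0 <= eta -> eta <= N / 4 -> 0 <= h ->
  regular N M Q eta x -> (forall j, regular N M Q eta (y j)) ->
  \sum_l (\sum_(j | cell (y j l) != cell (x l)) nu j) ^+ 2 <= h ->
  f (tensor_power x) - \sum_j nu j * f (tensor_power (y j)) <=
  L * N ^+ d.-1 * ((2 * M * Num.sqrt d%:R + 32 * d%:R * Num.sqrt Q) * Num.sqrt h
    + 73 * eta).
Proof.
move=> cD d0 L0 cf lf nu0 nu1 N0 M0 Q0 e0 eN h0 [x1 x2 x3 x4 x5] yr ph.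
have d1 : 1 <= d%:R :> R by rewrite ler1n.
have dp : 0 < d%:R :> R by rewrite ltr0n.
have dN0 : d%:R != 0 :> R by rewrite gt_eqF.
have NN0 : N != 0 by rewrite gt_eqF.
pose t := eta / (d%:R * N).
have tN : eta * N / d%:R = t * N ^+ 2 by rewrite /t; field; rewrite NN0 dN0.
have dt : d%:R * t = eta / N by rewrite /t; field; rewrite NN0 dN0.
have dt4 : d%:R * t <= 4^-1 by rewrite dt ler_pdivrMr// mulrC.
have yt j : `|dot (y j) (y j) - N ^+ 2| <= t * N ^+ 2 by rewrite -tN; case: (yr j).
apply: le_trans (convex_gap d0 L0 cf lf nu0 nu1 N0 _ yt dt4) _; first by rewrite -tN.
rewrite ler_wpM2l ?mulr_ge0 ?exprn_ge0 ?(ltW N0)//.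
set u := enorm _; set w := \sum_j nu j * _.
have avg (F : J -> R) c : (forall j, F j <= c) -> \sum_j nu j * F j <= c.
  move=> Fc; rewrite -[leRHS]mul1r -nu1 mulr_suml; apply: ler_sum => j _.
  by rewrite ler_wpM2l.
pose p l := \sum_(j | cell (y j l) != cell (x l)) nu j.
have p0 l : 0 <= p l by apply: sumr_ge0.
have pE l : p l = \sum_j nu j * (cell (y j l) != cell (x l))%:R.
  rewrite /p big_mkcond; apply: eq_bigr => j _.
  by case: ifP; rewrite ?mulr1 ?mulr0.
have php : enorm p <= Num.sqrt h.
  by rewrite ler_wsqrtr//; apply: le_trans ph; rewrite /dot; under eq_bigr do rewrite -expr2.
pose e := Num.sqrt (2 * eta ^+ 2 / d%:R).
have ee z : dot (fun l => z l - D (z l)) (fun l => z l - D (z l)) <= 2 * eta ^+ 2 / d%:R ->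
    enorm (fun l => z l - D (z l)) <= e by move=> hz; apply: ler_wsqrtr.
have e2 : e ^+ 2 = 2 * eta ^+ 2 / d%:R.
  by rewrite sqr_sqrtr// divr_ge0// mulr_ge0// sqr_ge0.
have eP : 0 <= e by apply: sqrtr_ge0.
have de : Num.sqrt d%:R * (2 * e) <= 3 * eta.
  rewrite -(@ler_pXn2r _ 2)// ?nnegrE ?mulr_ge0 ?sqrtr_ge0//.
  rewrite !exprMn sqr_sqrtr// e2.
  rewrite (_ : d%:R * (2 ^+ 2 * (2 * eta ^+ 2 / d%:R)) = 8 * eta ^+ 2); last by field.
  by have := sqr_ge0 eta; lra.
have yee j : enorm (fun l => y j l - D (y j l)) <= e by apply: ee; case: (yr j).
have uB : u <= 2 * M * Num.sqrt h + 2 * e.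
  rewrite /u (@eq_enorm _ _ _ (fun l => \sum_j nu j * (D (x l) - D (y j l)) +
     ((x l - D (x l)) - \sum_j nu j * (y j l - D (y j l))))); last first.
    move=> l; rewrite -[X in X - _]mul1r -nu1 mulr_suml -sumrB -big_split /=.
    by apply: eq_bigr => j _; ring.
  apply: le_trans (enorm_triangle _ _) _; rewrite lerD//.
    apply: (@le_trans _ _ (enorm (fun l => 2 * M * p l))); last first.
      rewrite enormZ ger0_norm ?mulr_ge0//; rewrite ler_wpM2l// mulr_ge0//.
    apply: ler_wsqrtr; apply: ler_sum => l _; rewrite -!expr2.
    rewrite -[leLHS]real_normK ?num_real//; apply: lerXn2r; rewrite ?nnegrE//.
      by rewrite !mulr_ge0.
    apply: le_trans (ler_norm_sum _ _ _) _; rewrite pE mulr_sumr; apply: ler_sum => j _.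
    rewrite normrM ger0_norm// mulrCA ler_wpM2l//.
    case: eqP => [/cD ->|_]; first by rewrite subrr normr0 mulr0.
    rewrite mulr1; apply: le_trans (ler_normB _ _) _.
    have [_ _ _ y4 _] := yr j.
    by have := x4 l; have := y4 l; lra.
  apply: le_trans (enormB _ _) _; rewrite mulr2n mulrDl mul1r lerD ?ee//.
  apply: le_trans (enorm_sum _ nu0) _; exact: avg.
have xp : \sum_l D (x l) ^+ 2 * p l <= Num.sqrt Q * N * Num.sqrt h.
  apply: le_trans (dot_le (fun l => D (x l) ^+ 2) p) _.
  apply: ler_pM => //; try exact: enorm_ge0.
  rewrite -[X in _ * X](@ger0_norm _ N) ?(ltW N0)// -sqrtr_sqr -sqrtrM//.
  rewrite ler_wsqrtr//; apply: le_trans x5.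
  by rewrite /dot; apply: ler_sum => l _; rewrite -exprD.
have wB : w <= 8 * (Num.sqrt Q * N * Num.sqrt h) + 14 * (eta * N / d%:R).
  have e2N : 2 * eta ^+ 2 / d%:R <= eta * N / d%:R / 2.
    by rewrite [leRHS]mulrAC ler_pM2r ?invr_gt0//; nra.
  have step j : dot (fun l => x l - y j l) (fun l => x l - y j l) <=
      8 * (\sum_l D (x l) ^+ 2 * (cell (y j l) != cell (x l))%:R) + 14 * (eta * N / d%:R).
    have [y1 y2 y3 y4 _] := yr j.
    (* (a - b)^2 <= 4 a^2 + 2 (b^2 - a^2), used where the cells differ *)
    have wD : dot (fun l => D (x l) - D (y j l)) (fun l => D (x l) - D (y j l)) <=
        4 * (\sum_l D (x l) ^+ 2 * (cell (y j l) != cell (x l))%:R) +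
        2 * (dot (Dv (y j)) (Dv (y j)) - dot (Dv x) (Dv x)).
      rewrite /dot -sumrB !mulr_sumr -big_split /=; apply: ler_sum => l _.
      case: eqP => [/cD ->|_]; rewrite ?subrr ?mulr0 ?addr0 ?mulr0//.
      by rewrite mulr1; have := sqr_ge0 (D (x l) + D (y j l)); nra.
    have tri : enorm (fun l => x l - y j l) <=
        enorm (fun l => D (x l) - D (y j l)) + 2 * e.
      rewrite (@eq_enorm _ _ _ (fun l => (D (x l) - D (y j l)) +
         ((x l - D (x l)) - (y j l - D (y j l))))); last by move=> l; ring.
      apply: le_trans (enorm_triangle _ _) _; rewrite lerD2l.
      by apply: le_trans (enormB _ _) _; rewrite mulr2n mulrDl mul1r lerD ?ee.
    have : dot (fun l => x l - y j l) (fun l => x l - y j l) <=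
        2 * dot (fun l => D (x l) - D (y j l)) (fun l => D (x l) - D (y j l)) + 8 * e ^+ 2.
      rewrite -!enorm_sq; move: tri (enorm_ge0 (fun l => x l - y j l))
        (enorm_ge0 (fun l => D (x l) - D (y j l))).
      set a := enorm _; set b := enorm _ => ab a0 b0.
      have : a ^+ 2 <= (b + 2 * e) ^+ 2.
        by apply: lerXn2r; rewrite ?nnegrE// addr_ge0// mulr_ge0.
      by have := sqr_ge0 (b - 2 * e); nra.
    rewrite e2.
    move: x1 y1; rewrite !ler_norml => /andP[x11 x12] /andP[y11 y12].
    move: x3 y3 => /andP[x31 x32] /andP[y31 y32].
    move: wD e2N x11 x12 y11 y12 x31 x32 y31 y32.
    set A := \sum_l _.
    set a1 := dot (Dv x) _; set a2 := dot (Dv (y j)) _; set a3 := dot x x.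
    set a4 := dot (y j) _; set a5 := dot _ _; set a6 := dot _ _.
    set E := 2 * _ / _; set F := eta * N / _.
    lra.
  rewrite /w; apply: (@le_trans _ _ (\sum_j nu j *
     (8 * (\sum_l D (x l) ^+ 2 * (cell (y j l) != cell (x l))%:R) + 14 * (eta * N / d%:R)))).
    by apply: ler_sum => j _; rewrite ler_wpM2l.
  under eq_bigr do rewrite mulrDr.
  rewrite big_split /= -mulr_suml nu1 mul1r lerD2r.
  under eq_bigr do rewrite mulrCA.
  rewrite -mulr_sumr ler_wpM2l//; apply: le_trans xp.
  under eq_bigr do rewrite mulr_sumr.
  rewrite exchange_big /= le_eqVlt; apply/orP; left; apply/eqP; apply: eq_bigr => l _.
  by rewrite pE mulr_sumr; apply: eq_bigr => j _; rewrite mulrCA.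
have h1 := ler_wpM2l (sqrtr_ge0 (d%:R : R)) uB.
have h2 : 4 * d%:R * w / N <= 32 * d%:R * Num.sqrt Q * Num.sqrt h + 56 * eta.
  rewrite ler_pdivrMr//; apply: le_trans (ler_wpM2l _ wB) _; first by rewrite mulr_ge0.
  by rewrite le_eqVlt; apply/orP; left; apply/eqP; field.
have h3 : 14 * (d%:R * t) * N = 14 * eta by rewrite dt; field.
rewrite h3; move: h1 h2 de; set a := Num.sqrt d%:R; set b := Num.sqrt h.
set q := Num.sqrt Q; lra.
Qed.

End truncated_gap.

(** * Finite-valued functions of independent variables *)
Section finite_valued.
Context {R : realType} {disp : measure_display} {T : measurableType disp}
  (P : probability T R).

Lemma integral_finite_valued (F : finType) (W : T -> F) (g : F -> R) :
  (forall c, measurable (W @^-1` [set c])) -> (forall c, 0 <= g c) ->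
  (\int[P]_w (g (W w))%:E = (\sum_c g c * fine (P (W @^-1` [set c])))%:E)%E.
Proof.
move=> mW g0.
under eq_integral => w _.
  rewrite (_ : (g (W w))%:E = \sum_(c : F) ((g c)%:E * (\1_(W @^-1` [set c]) w)%:E))%E.
    over.
  rewrite (bigD1 (W w))//= indicE mem_set// mule1 big1 ?adde0// => c cW.
  by rewrite indicE memNset ?mule0//= => Wc; rewrite -Wc eqxx in cW.
have mind c : measurable_fun [set: T] (EFin \o (\1_(W @^-1` [set c]) : T -> R)).
  by apply/measurable_EFinP; exact: measurable_indic.
rewrite ge0_integral_sum//=.
- rewrite -sumEFin; apply: eq_bigr => c _.
  rewrite ge0_integralZl//; last by rewrite lee_fin.
    by rewrite integral_indic// setIT EFinM fineK// fin_num_measure.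
  exact: (mind c).
- by move=> k; apply: (measurable_funeM (g k)%:E (mind k)).
- by move=> k w _; rewrite mule_ge0// lee_fin.
Qed.

Lemma probability_finite_valued (F : finType) (W : T -> F) (A : {set F}) :
  (forall c, measurable (W @^-1` [set c])) ->
  (P [set w | W w \in A] = (\sum_(c in A) fine (P (W @^-1` [set c])))%:E)%E.
Proof.
move=> mW; have mA : measurable [set w | W w \in A].
  rewrite (_ : [set _ | _] = \bigcup_(c in [set c | c \in A]) (W @^-1` [set c])).
    by apply: fin_bigcup_measurable => //; exact: finite_finset.
  by apply/seteqP; split => [w /= wA|w [c /= cA ->]//]; exists (W w).
have -> : P [set w | W w \in A] = (\int[P]_w ((W w \in A)%:R : R)%:E)%E.
  transitivity (\int[P]_w (\1_[set w | W w \in A] w)%:E)%E.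
    by rewrite integral_indic// setIT.
  by apply: eq_integral => w _; rewrite indicE; case: (boolP (W w \in A)) => wA; [rewrite mem_set|rewrite memNset //=; apply/negP].
rewrite (integral_finite_valued (g := fun c => (c \in A)%:R))//.
rewrite [in RHS]big_mkcond /=; congr EFin; apply: eq_bigr => c _.
by case: ifP; rewrite ?mul1r ?mul0r.
Qed.

End finite_valued.

Section independent_cells.
Context {R : realType} {disp : measure_display} {T : measurableType disp}
  {P : probability T R} {n : nat} (X : 'I_n -> {RV P >-> R}).
Hypothesis Xind : mutually_independent X.

Section cells.
Context {F : finType} (cell : R -> F).
Hypothesis mcell : forall c, measurable (cell @^-1` [set c]).

Definition cell_law (i : 'I_n) (c : F) : R :=
  fine (P (X i @^-1` (cell @^-1` [set c]))).

Definition cells (w : T) : {ffun 'I_n -> F} := [ffun i => cell (X i w)].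

Let mcells1 i c : measurable (X i @^-1` (cell @^-1` [set c])).
Proof. by rewrite -[X in measurable X]setTI; apply: measurable_funPT. Qed.

Let cells_preimage c :
  cells @^-1` [set c] =
  \bigcap_(i in [set j | j \in [set: 'I_n]%SET]) (X i @^-1` (cell @^-1` [set c i])).
Proof.
apply/seteqP; split => [w /= <- i _ /=|w H /=]; first by rewrite ffunE.
by apply/ffunP => i; rewrite ffunE; apply: H; rewrite /= inE.
Qed.

Lemma measurable_cells c : measurable (cells @^-1` [set c]).
Proof.
rewrite cells_preimage; apply: fin_bigcap_measurable => //; exact: finite_finset.
Qed.

Lemma cells_probability c :
  fine (P (cells @^-1` [set c])) = product_mass cell_law c.
Proof.
rewrite cells_preimage Xind//.
rewrite (eq_bigr (fun i => (cell_law i (c i))%:E)); last first.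
  by move=> i _; rewrite fineK// fin_num_measure.
rewrite prodEFin /= /product_mass; apply: eq_bigl => i; by rewrite inE.
Qed.

Lemma cell_law_ge0 i c : 0 <= cell_law i c.
Proof. exact: fine_ge0. Qed.

Lemma cell_law_sum1 i : \sum_c cell_law i c = 1.
Proof.
have := @probability_finite_valued R _ _ P F (cell \o X i) [set: F]%SET (mcells1 i).
rewrite (_ : [set w | _] = setT); last first.
  by apply/seteqP; split => // w _ /=; rewrite inE.
rewrite probability_setT => /esym[e]; apply: etrans e.
by apply: eq_bigl => c; rewrite inE.
Qed.

Lemma cells_set_probability (A : {set {ffun 'I_n -> F}}) :
  P [set w | cells w \in A] = (set_mass cell_law A)%:E.
Proof.
rewrite (probability_finite_valued _ _ measurable_cells); congr EFin.
by apply: eq_bigr => c _; rewrite cells_probability.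
Qed.

Lemma integral_prod_cells (g : F -> R) : (forall c, 0 <= g c) ->
  (\int[P]_w (\prod_(i < n) g (cell (X i w)))%:E =
   (\prod_(i < n) \int[P]_w (g (cell (X i w)))%:E))%E.
Proof.
move=> g0.
pose G (c : {ffun 'I_n -> F}) := \prod_(i < n) g (c i).
transitivity (\int[P]_w (G (cells w))%:E)%E.
  apply: eq_integral => w _; congr EFin.
  by apply: eq_bigr => i _; rewrite ffunE.
rewrite (integral_finite_valued (g := G) P measurable_cells); last first.
  by move=> c; apply: prodr_ge0.
rewrite (eq_bigr (fun i => (\sum_c g c * cell_law i c)%:E)); last first.
  move=> i _; exact: (integral_finite_valued P (mcells1 i)).
rewrite prodEFin bigA_distr_bigA /=; congr EFin; apply: eq_bigr => c _.
by rewrite cells_probability /product_mass -big_split.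
Qed.

End cells.
End independent_cells.

(** * Chernoff bounds for sums of independent variables *)
Section staircase.
Context {R : realType}.
Implicit Types (delta y : R).

(** The number of thresholds delta, 2 delta, ..., N delta below y; times delta,
it rounds y down.  As a sum of indicators it is measurable, and it depends on
finitely many comparisons. *)
Definition staircase (N : nat) delta y : R := \sum_(j < N) (j.+1%:R * delta <= y)%R%:R.

Lemma staircase_cases N delta y : 0 < delta ->
  (N%:R * delta <= y /\ staircase N delta y = N%:R) \/
  (y < N%:R * delta /\
    (0 <= y -> staircase N delta y * delta <= y < staircase N delta y * delta + delta)).
Proof.
move=> d0; elim: N => [|N [[Ny st]|[Ny st]]].
- rewrite mul0r; have [y0|y0] := leP 0 y; first by left; split; rewrite // /staircase big_ord0.
  by right; split => // /(lt_le_trans y0); rewrite ltxx.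
- have stS : staircase N.+1 delta y = N%:R + (N.+1%:R * delta <= y)%R%:R.
    by rewrite /staircase big_ord_recr /= -/(staircase N delta y) st.
  have [NSy|NSy] := leP (N.+1%:R * delta) y.
    by left; split => //; rewrite stS NSy -natr1.
  right; split => // _; rewrite stS (negbTE (_ : ~~ (N.+1%:R * delta <= y))) -?ltNge//.
  by rewrite addr0 Ny /=; move: NSy; rewrite -natr1 mulrDl mul1r.
- have NSy : y < N.+1%:R * delta.
    by apply: lt_trans Ny _; rewrite ltr_pM2r// ltr_nat.
  right; split => // y0; rewrite /staircase big_ord_recr /=.
  rewrite (negbTE (_ : ~~ (N.+1%:R * delta <= y))) -?ltNge// addr0.
  exact: st.
Qed.

Lemma staircase_ge0 N delta y : 0 <= staircase N delta y.
Proof. exact: sumr_ge0. Qed.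

Lemma staircase_le N delta y : 0 < delta -> 0 <= y -> staircase N delta y * delta <= y.
Proof.
move=> d0 y0; have [[Ny ->]//|[_ /(_ y0) /andP[]//]] := staircase_cases N y d0.
Qed.

Lemma staircase_ge N delta y : 0 < delta -> 0 <= y -> y <= N%:R * delta ->
  y <= staircase N delta y * delta + delta.
Proof.
move=> d0 y0 yN; have [[Ny ->]|[_ /(_ y0) /andP[_ /ltW]//]] := staircase_cases N y d0.
by apply: le_trans yN _; rewrite lerDl ltW.
Qed.

Lemma staircase_cvg y : 0 <= y ->
  staircase (k.+1 * k.+1)%N (k.+1%:R^-1) y * k.+1%:R^-1 @[k --> \oo] --> y.
Proof.
move=> y0; apply/cvgrPdist_le => e e0.
near=> k.
have k0 : 0 < k.+1%:R^-1 :> R by rewrite invr_gt0.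
rewrite ger0_norm ?subr_ge0 ?staircase_le// lerBlDl.
apply: le_trans (@staircase_ge (k.+1 * k.+1)%N _ _ k0 y0 _) _.
  rewrite natrM mulfK ?pnatr_eq0//; near: k.
  apply: filterS (nbhs_infty_ger y) => k /le_trans; apply; by rewrite ler_nat.
rewrite lerD2l; near: k.
by apply: filterS (near_infty_natSinv_lt (PosNum e0)) => k /ltW.
Unshelve. all: by end_near.
Qed.

End staircase.

Lemma measurable_le_set d (S : measurableType d) (R : realType) (f g : S -> R) :
  measurable_fun setT f -> measurable_fun setT g -> measurable [set x | f x <= g x].
Proof.
move=> mf mg; rewrite -[X in measurable X]setTI.
by apply: (measurable_fun_ler mf mg measurableT (Y := [set true])).
Qed.

Lemma lee_prod (R : realType) (I : finType) (F G : I -> \bar R) :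
  (forall i, (0 <= F i <= G i)%E) -> (\prod_i F i <= \prod_i G i)%E.
Proof.
move=> FG.
suff : (0 <= \prod_i F i <= \prod_i G i)%E by case/andP.
elim/big_ind2 : _ => [|a b c e /andP[b0 ba] /andP[e0 ec]|i _]; last exact: FG.
  by rewrite lexx lee01.
by rewrite mule_ge0// lee_pmul.
Qed.

Section product_inequality.
Context {R : realType} {disp : measure_display} {T : measurableType disp}
  {P : probability T R} {n : nat} (X : 'I_n -> {RV P >-> R}).
Hypothesis Xind : mutually_independent X.

Lemma measurable_threshold_cells (h : R -> R) N delta (c : {ffun 'I_N -> bool}) :
  measurable_fun setT h ->
  measurable ((fun x => [ffun j : 'I_N => j.+1%:R * delta <= h x]) @^-1` [set c]).
Proof.
move=> mh.
rewrite (_ : _ @^-1` _ = \bigcap_(j in [set: 'I_N])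
    ((fun x => j.+1%:R * delta <= h x) @^-1` [set c j])); last first.
  apply/seteqP; split => [x /= <- j _ /=|x H /=]; first by rewrite ffunE.
  by apply/ffunP => j; rewrite ffunE; apply: H.
apply: fin_bigcap_measurable => [|j _]; first exact: finite_finset.
rewrite -[X in measurable X]setTI.
by apply: (measurable_fun_ler (@measurable_cst _ _ _ _ _ (j.+1%:R * delta)) mh).
Qed.

Lemma limn_einf_le_bound (u : (\bar R)^nat) (c : \bar R) :
  (forall k, (u k <= c)%E) -> (limn_einf u <= c)%E.
Proof.
move=> uc; rewrite limn_einf_lim; apply: lime_le; first exact: is_cvg_einfs.
apply: nearW => k; apply: le_trans (uc k).
by apply: ereal_inf_lbound; exists k => /=.
Qed.

(** Independence speaks of measurable sets, hence gives the product rule for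
functions of finite-valued cells ([integral_prod_cells]).  Fatou's lemma along
staircase approximations of h from below yields the inequality, which suffices
for upper bounds of exponential moments. *)
Lemma integral_prod_le (h : R -> R) : measurable_fun setT h -> (forall x, 0 <= h x) ->
  (\int[P]_w (\prod_(i < n) h (X i w))%:E <= \prod_(i < n) \int[P]_w (h (X i w))%:E)%E.
Proof.
move=> mh h0.
pose N k := (k.+1 * k.+1)%N.
pose delta k : R := k.+1%:R^-1.
have delta0 k : 0 < delta k by rewrite invr_gt0.
pose cell k x : {ffun 'I_(N k) -> bool} := [ffun j : 'I_(N k) => j.+1%:R * delta k <= h x].
pose g k (c : {ffun 'I_(N k) -> bool}) : R := (\sum_(j < N k) (c j)%:R) * delta k.
have g0 k c : 0 <= g k c by rewrite mulr_ge0 ?(ltW (delta0 k))//; apply: sumr_ge0.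
have gE k x : g k (cell k x) = staircase (N k) (delta k) (h x) * delta k.
  by congr (_ * _); apply: eq_bigr => j _; rewrite ffunE.
have mcell k c : measurable (cell k @^-1` [set c]) by exact: measurable_threshold_cells.
have mhX i : measurable_fun setT (fun w => h (X i w)) by apply: measurableT_comp.
have mg k : measurable_fun setT (fun x => g k (cell k x)).
  rewrite (_ : (fun _ => _) =
    (fun x => (\sum_(j < N k) \1_[set x | j.+1%:R * delta k <= h x] x) * delta k)).
    apply: measurable_funM => //; apply: measurable_sum => j.
    by apply: measurable_indic; apply: measurable_le_set => //; exact: measurable_cst.
  apply/funext => x; rewrite gE; congr (_ * _); apply: eq_bigr => j _.
  rewrite indicE; case: (boolP (_ <= _)) => jx; first by rewrite mem_set.
  by rewrite memNset //=; apply/negP.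
have mgX k : measurable_fun setT (fun w => \prod_(i < n) g k (cell k (X i w))).
  by apply: measurable_prod => i _; apply: (measurableT_comp (mg k)).
have cvgp w : (\prod_(i < n) g k (cell k (X i w)))%:E @[k --> \oo] --> (\prod_(i < n) h (X i w))%:E.
  apply: cvg_EFin; first by apply: nearW.
  apply: cvg_big => [|i _]; first exact: mul_continuous.
  under eq_fun do rewrite gE.
  exact: staircase_cvg.
rewrite (_ : (\int[P]_w _)%E = (\int[P]_w limn_einf (fun k => (\prod_(i < n) g k (cell k (X i w)))%:E))%E); last first.
  by apply: eq_integral => w _; rewrite (cvg_limn_einf_sup (cvgp w)).
have mgE k : measurable_fun setT (fun w => (\prod_(i < n) g k (cell k (X i w)))%:E).
  by apply/measurable_EFinP.
apply: le_trans (fatou P measurableT mgE _) _.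
  by move=> k w _; rewrite lee_fin; apply: prodr_ge0.
apply: limn_einf_le_bound => k.
rewrite (integral_prod_cells Xind (mcell k))//.
apply: lee_prod => i; apply/andP; split.
  by apply: integral_ge0 => w _; rewrite lee_fin.
apply: ge0_le_integral => //.
- by move=> w _; rewrite lee_fin.
- by apply/measurable_EFinP; apply: (measurableT_comp (mg k)).
- by apply/measurable_EFinP.
- by move=> w _; rewrite lee_fin gE staircase_le.
Qed.

Lemma chernoff_sum (h : R -> R) (a b : R) : measurable_fun setT h ->
  (forall i, \int[P]_w (expR (h (X i w)))%:E <= (expR a)%:E)%E ->
  (P [set w | b <= \sum_(i < n) h (X i w)]%R <= (expR (n%:R * a - b))%:E)%E.
Proof.
move=> mh ha.
have mhX i : measurable_fun setT (fun w => h (X i w)) by apply: measurableT_comp.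
have mS : measurable_fun setT (fun w => \sum_(i < n) h (X i w)).
  by apply: measurable_sum.
have mA : measurable [set w | b <= \sum_(i < n) h (X i w)].
  by apply: measurable_le_set => //; exact: measurable_cst.
rewrite -[X in P X]setIT -integral_indic//.
apply: (@le_trans _ _ (\int[P]_w ((expR (- b))%:E * (\prod_(i < n) expR (h (X i w)))%:E))%E).
  apply: ge0_le_integral => //.
  - by apply/measurable_EFinP; apply: measurable_indic.
  - apply: measurable_funeM; apply/measurable_EFinP; apply: measurable_prod => i _.
    exact: measurableT_comp.
  move=> w _; rewrite -EFinM lee_fin -expR_sum -expRD indicE.
  case: (pselect (b <= \sum_(i < n) h (X i w))) => wb.
    rewrite mem_set// -expR0 ler_expR; lra.
  by rewrite memNset// expR_ge0.
rewrite ge0_integralZl//; last 2 first.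
- apply/measurable_EFinP; apply: measurable_prod => i _; exact: measurableT_comp.
- by move=> w _; rewrite lee_fin prodr_ge0// => i _; exact: expR_ge0.
rewrite addrC expRD EFinM lee_wpmul2l ?lee_fin ?expR_ge0//.
apply: le_trans (integral_prod_le (h := fun x => expR (h x)) _ _) _.
- exact: measurableT_comp.
- by move=> x; exact: expR_ge0.
apply: (@le_trans _ _ (\prod_(i < n) (expR a)%:E)%E).
  apply: lee_prod => i; rewrite ha andbT.
  by apply: integral_ge0 => w _; rewrite lee_fin expR_ge0.
by rewrite prodEFin prodr_const card_ord -expRM_natl lexx.
Qed.

End product_inequality.

(** * Discretization of a coordinate *)
Section discretization.
Context {R : realType}.

Definition tail_sq (M x : R) : R := if `|x| <= M then 0 else x ^+ 2.

Lemma measurable_staircase N delta : measurable_fun setT (@staircase R N delta).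
Proof.
rewrite (_ : staircase N delta =
  (fun x => \sum_(j < N) \1_[set x | j.+1%:R * delta <= x] x)).
  apply: measurable_sum => j; apply: measurable_indic.
  by apply: measurable_le_set => //; exact: measurable_cst.
apply/funext => x; apply: eq_bigr => j _.
rewrite indicE; case: (boolP (_ <= _)) => jx; first by rewrite mem_set.
by rewrite memNset //=; apply/negP.
Qed.

(** D rounds x towards 0 to a multiple of delta when |x| <= M and vanishes
otherwise; rounding costs at most 2 M delta + delta^2 in squares. *)
Lemma discretization (M v : R) : 0 < M -> 0 < v ->
  exists (C : finType) (cell : R -> C) (D : R -> R),
    [/\ forall c, measurable (cell @^-1` [set c]),
        measurable_fun setT D,
        forall a b, cell a = cell b -> D a = D b &
        forall x, [/\ `|D x| <= M, `|D x| <= `|x|,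
          (x - D x) ^+ 2 <= tail_sq M x + v &
          x ^+ 2 - D x ^+ 2 <= tail_sq M x + v]].
Proof.
move=> M0 v0.
pose delta := Num.min 1 (v / (2 * M + 1)).
have M1 : 0 < 2 * M + 1 by lra.
have delta0 : 0 < delta by rewrite lt_min ltr01 divr_gt0.
have delta1 : delta <= 1 by rewrite ge_min lexx.
have deltav : delta * (2 * M + 1) <= v by rewrite -ler_pdivlMr// ge_min lexx orbT.
have [N MN] : exists N, M <= N%:R * delta.
  exists (Num.bound (M / delta)); rewrite -ler_pdivrMr//; apply: ltW.
  by apply: archi_boundP; rewrite divr_ge0// ltW.
pose thr x : {ffun 'I_N -> bool} := [ffun j : 'I_N => j.+1%:R * delta <= x].
pose cell x := (thr x, thr (- x), `|x| <= M).
pose D x := if `|x| <= M then (staircase N delta x - staircase N delta (- x)) * delta else 0.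
exists _, cell, D.
have thrE x y : thr x = thr y -> staircase N delta x = staircase N delta y.
  move=> e; apply: eq_bigr => j _.
  by have := congr1 (fun f : {ffun 'I_N -> bool} => f j) e; rewrite !ffunE => ->.
have neg x : x <= 0 -> staircase N delta x = 0.
  move=> x0; apply: big1 => j _; rewrite (negbTE (_ : ~~ (_ <= _)))// -ltNge.
  by apply: le_lt_trans x0 _; rewrite mulr_gt0.
split.
- move=> [[c1 c2] c3].
  rewrite (_ : _ @^-1` _ = thr @^-1` [set c1] `&`
     ((fun x => [ffun j : 'I_N => j.+1%:R * delta <= - x]) @^-1` [set c2] `&`
     (fun x => `|x| <= M) @^-1` [set c3])); last first.
    by apply/seteqP; split => [x /= [<- <- <-]//|x /= [e1 [e2 e3]]]; rewrite -e1 -e2 -e3.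
  apply: measurableI; first exact: (measurable_threshold_cells _ _ (@measurable_id _ _ _)).
  apply: measurableI; first by apply: measurable_threshold_cells; exact: measurable_funN.
  rewrite -[X in measurable X]setTI.
  by apply: (measurable_fun_ler _ (@measurable_cst _ _ _ _ _ M) measurableT).
- apply: measurable_fun_ifT => //.
  + by apply: measurable_fun_ler => //; exact: measurable_cst.
  + apply: measurable_funM => //; apply: measurable_funB.
      exact: measurable_staircase.
    by apply: measurableT_comp => //; exact: measurable_staircase.
- by move=> a b [/thrE e1 /thrE e2 e3]; rewrite /D e1 e2 e3.
move=> x; rewrite /D /tail_sq; case: (leP `|x| M) => xM; last first.
  have x0 := normr_ge0 x.
  by split; rewrite ?normr0 ?subr0 ?expr0n /= ?subr0//; lra.
have [k [k0 kx kM De]] : exists k, [/\ 0 <= k, k <= `|x|, `|x| <= k + delta &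
   (staircase N delta x - staircase N delta (- x)) * delta = Num.sg x * k].
  have [x0|x0] := leP 0 x.
    exists (staircase N delta x * delta); rewrite (neg (- x)) ?oppr_le0// subr0; split.
    - by rewrite mulr_ge0 ?staircase_ge0 ?ltW.
    - by rewrite ger0_norm// staircase_le.
    - by rewrite ger0_norm// staircase_ge//; apply: le_trans MN; rewrite -(ger0_norm x0).
    - have [->|xN0] := eqVneq x 0; first by rewrite neg// !mul0r mulr0.
      by rewrite gtr0_sg ?mul1r// lt_neqAle eq_sym xN0.
  exists (staircase N delta (- x) * delta); rewrite (neg x) ?(ltW x0)// sub0r.
  have nx : 0 <= - x by rewrite oppr_ge0 ltW.
  rewrite ltr0_norm//; split.
  - by rewrite mulr_ge0 ?staircase_ge0 ?ltW.
  - by rewrite staircase_le.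
  - by rewrite staircase_ge//; apply: le_trans MN; rewrite -(ltr0_norm x0).
  - by rewrite ltr0_sg// mulN1r mulNr.
rewrite De add0r.
have xs : x = Num.sg x * `|x| by rewrite -numEsg.
have s2 : x != 0 -> Num.sg x ^+ 2 = 1 by move=> xN0; rewrite sqr_sg xN0.
have nD : `|Num.sg x * k| <= k.
  by rewrite normrM (ger0_norm k0) ler_piMl// normr_sg; case: (x != 0).
split; [lra|lra| |].
  rewrite {1}xs -mulrBr exprMn; apply: (@le_trans _ _ (1 * delta ^+ 2)).
    apply: ler_pM; rewrite ?sqr_ge0//; last by rewrite lerXn2r ?nnegrE; lra.
    by rewrite sqr_sg lern1; case: (x != 0).
  by rewrite mul1r; nra.
rewrite exprMn sqr_sg; have [->|xN0] := eqVneq x 0.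
  by rewrite !mul0r expr0n subr0 ltW.
by rewrite mul1r -(real_normK (num_real x)); nra.
Qed.

End discretization.

(** * Exponential moments of one coordinate *)
Section scalar_exponential_bounds.
Context {R : realType}.
Implicit Types (v z y k l M : R).

Lemma expR_le_linear v : 0 <= v -> expR v <= 1 + v * expR v.
Proof.
move=> v0; have := @expR_ge1Dx R (- v) => h.
have : expR v * (1 - v) <= 1 by rewrite -[leRHS](expRxMexpNx_1 v) ler_wpM2l ?expR_ge0.
lra.
Qed.

Lemma expR_le_quadratic v : expR v <= 1 + v + v ^+ 2 * expR `|v|.
Proof.
have [v0|v0] := leP 0 v.
  rewrite ger0_norm//; have h := expR_le_linear v0.
  have := ler_wpM2l v0 h; lra.
have e1 : 1 <= expR `|v| by rewrite -expR0 ler_expR.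
have : expR v <= 1 + v + v ^+ 2 by apply: expR_le_quad; lra.
by have := sqr_ge0 v; nra.
Qed.

Lemma sqr_le_expR z : 0 <= z -> z ^+ 2 <= 16 * expR (z / 2).
Proof.
move=> z0; have h : 1 + z / 4 <= expR (z / 4) by apply: expR_ge1Dx.
have -> : expR (z / 2) = expR (z / 4) ^+ 2.
  by rewrite -expRM_natl; congr expR; field.
nra.
Qed.

Lemma expR_half : expR 2^-1 <= 2 :> R.
Proof.
have -> : expR 2^-1 = expR 4^-1 ^+ 2 :> R by rewrite -expRM_natl; congr expR; field.
have := @expR_le_quad R 4^-1; have := expR_ge0 (4^-1 : R); nra.
Qed.

(** With z = y^2/k the exponent is at most z/2 + 1/2 in absolute value, which
leaves a factor exp(z/2) to absorb its square. *)
Lemma centered_square_exp k l y : 1 <= k -> `|l| <= (2 * k)^-1 ->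
  expR (l * (y ^+ 2 - 1)) <= 1 + l * (y ^+ 2 - 1) + 34 * l ^+ 2 * k ^+ 2 * expR (y ^+ 2 / k).
Proof.
move=> k1 lk; have k0 : 0 < k by lra.
set v := l * _; pose z := y ^+ 2 / k.
have y2 : y ^+ 2 = k * z by rewrite /z mulrCA mulfV ?mulr1// gt_eqF.
have z0 : 0 <= z by rewrite divr_ge0 ?sqr_ge0// ltW.
apply: le_trans (expR_le_quadratic v) _; rewrite lerD2l -/z.
have va : `|v| <= z / 2 + 2^-1.
  rewrite normrM; have : `|y ^+ 2 - 1| <= k * (z + 1).
    by rewrite y2 ler_norml; apply/andP; split; nra.
  have : `|l| * (2 * k) <= 1 by rewrite -ler_pdivlMr ?mulr_gt0// mul1r.
  have := normr_ge0 l; have := normr_ge0 (y ^+ 2 - 1).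
  set a := `|l|; set b := `|_ - 1|; nra.
have v2 : v ^+ 2 <= 17 * (l ^+ 2 * k ^+ 2) * expR (z / 2).
  rewrite exprMn.
  rewrite (_ : 17 * _ * _ = l ^+ 2 * (17 * k ^+ 2 * expR (z / 2))); last by ring.
  rewrite ler_wpM2l ?sqr_ge0//.
  have e1 : 1 <= expR (z / 2) by rewrite -[leLHS]expR0 ler_expR; lra.
  have e2 := sqr_le_expR z0.
  have k2 : 1 <= k ^+ 2 by rewrite expr_ge1// ltW.
  have := ler_wpM2l (sqr_ge0 k) e2; have := ler_pM ler01 ler01 k2 e1.
  by rewrite y2; have := mulr_ge0 (ltW k0) z0; nra.
have ev : expR `|v| <= 2 * expR (z / 2).
  apply: (@le_trans _ _ (expR (2^-1) * expR (z / 2))).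
    by rewrite -expRD ler_expR addrC.
  by rewrite ler_wpM2r ?expR_ge0// expR_half.
apply: le_trans (ler_pM (sqr_ge0 _) (expR_ge0 _) v2 ev) _.
have -> : expR z = expR (z / 2) ^+ 2 by rewrite -expRM_natl; congr expR; field.
rewrite le_eqVlt; apply/orP; left; apply/eqP; ring.
Qed.

(** The exponent is at most z/2 with z = y^2/k, because x^2 <= M^2, and at most
k z^2/(2 M^2), because x^2 <= y^2. *)
Lemma truncated_fourth_exp k M x y : 0 < k -> k <= M ^+ 2 -> `|x| <= M -> `|x| <= `|y| ->
  expR (x ^+ 4 / (2 * k * M ^+ 2)) <= 1 + 8 * k / M ^+ 2 * expR (y ^+ 2 / k).
Proof.
move=> k0 kM xM xy; have M2 : 0 < M ^+ 2 by apply: lt_le_trans kM.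
pose z := y ^+ 2 / k.
have y2 : y ^+ 2 = k * z by rewrite /z mulrCA mulfV ?mulr1// gt_eqF.
have z0 : 0 <= z by rewrite divr_ge0 ?sqr_ge0// ltW.
have xz : x ^+ 2 <= k * z by rewrite -y2 -(real_normK (num_real x)) -(real_normK (num_real y)) lerXn2r ?nnegrE.
have xM2 : x ^+ 2 <= M ^+ 2.
  by rewrite -(real_normK (num_real x)) lerXn2r ?nnegrE//; apply: le_trans xM.
have x4 : x ^+ 4 = x ^+ 2 * x ^+ 2 by rewrite -exprD.
have x20 := sqr_ge0 x.
set v := x ^+ 4 / _.
have MN0 : M != 0 by rewrite -sqrf_eq0 gt_eqF.
have den : 0 < 2 * k * M ^+ 2 by apply: mulr_gt0 => //; lra.
have v0 : 0 <= v.
  rewrite /v; apply: divr_ge0; first by rewrite exprn_even_ge0.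
  by apply: mulr_ge0; [lra | exact: ltW].
have v1 : v <= z / 2.
  by rewrite /v ler_pdivrMr// x4; nra.
have v2 : v <= 8 * k / M ^+ 2 * expR (z / 2).
  have e2 := sqr_le_expR z0.
  rewrite /v ler_pdivrMr// x4.
  rewrite (_ : 8 * k / M ^+ 2 * expR (z / 2) * (2 * k * M ^+ 2) = k ^+ 2 * (16 * expR (z / 2))); last by field.
  apply: (@le_trans _ _ (k ^+ 2 * z ^+ 2)); last by rewrite ler_wpM2l// sqr_ge0.
  by rewrite [leRHS](_ : _ = (k * z) * (k * z)); [apply: ler_pM|ring].
apply: le_trans (expR_le_linear v0) _; rewrite lerD2l -/z.
have ev : expR v <= expR (z / 2) by rewrite ler_expR.
apply: le_trans (ler_pM v0 (expR_ge0 _) v2 ev) _.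
have -> : expR z = expR (z / 2) ^+ 2 by rewrite -expRM_natl; congr expR; field.
by rewrite [X in _ <= _ * X]expr2 mulrA.
Qed.

Lemma tail_sq_exp k M y : 0 < k -> 0 <= M ->
  expR (tail_sq M y / (2 * k)) <= 1 + expR (- (M ^+ 2 / (2 * k))) * expR (y ^+ 2 / k).
Proof.
move=> k0 M0; rewrite /tail_sq; case: (leP `|y| M) => yM.
  by rewrite mul0r expR0 lerDl mulr_ge0 ?expR_ge0.
apply: (@le_trans _ _ (expR (- (M ^+ 2 / (2 * k))) * expR (y ^+ 2 / k))); last lra.
rewrite -expRD ler_expR.
have : M ^+ 2 <= y ^+ 2 by rewrite -(real_normK (num_real y)) lerXn2r ?nnegrE// ltW.
have -> : y ^+ 2 / k = 2 * (y ^+ 2 / (2 * k)) by field; rewrite gt_eqF.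
move=> h; have : M ^+ 2 / (2 * k) <= y ^+ 2 / (2 * k).
  by rewrite ler_pM2r// invr_gt0 mulr_gt0.
lra.
Qed.

End scalar_exponential_bounds.

Section real_valued_integrals.
Context {R : realType} {disp : measure_display} {T : measurableType disp}
  (P : probability T R).
Implicit Types g : T -> R.

Lemma integral_scale g (x : R) : measurable_fun setT g -> (forall w, 0 <= g w) ->
  0 <= x -> (\int[P]_w (x * g w)%:E = x%:E * \int[P]_w (g w)%:E)%E.
Proof.
move=> mg g0 x0; under eq_integral do rewrite EFinM.
rewrite ge0_integralZl//; first by apply/measurable_EFinP.
by move=> w _; rewrite lee_fin.
Qed.

Lemma integral_add g1 g2 : measurable_fun setT g1 -> measurable_fun setT g2 ->
  (forall w, 0 <= g1 w) -> (forall w, 0 <= g2 w) ->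
  (\int[P]_w (g1 w + g2 w)%:E = \int[P]_w (g1 w)%:E + \int[P]_w (g2 w)%:E)%E.
Proof.
move=> m1 m2 p1 p2; under eq_integral do rewrite EFinD.
rewrite ge0_integralD//.
- by move=> w _; rewrite lee_fin.
- exact/measurable_EFinP.
- by move=> w _; rewrite lee_fin.
- exact/measurable_EFinP.
Qed.

Lemma integral_bigsum (I : Type) (s : seq I) (g : I -> T -> R) :
  (forall i, measurable_fun setT (g i)) -> (forall i w, 0 <= g i w) ->
  (\int[P]_w (\sum_(i <- s) g i w)%:E = \sum_(i <- s) \int[P]_w (g i w)%:E)%E.
Proof.
move=> mg g0; under eq_integral do rewrite -sumEFin.
rewrite ge0_integral_sum//.
- by move=> i; apply/measurable_EFinP.
- by move=> i w _; rewrite lee_fin.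
Qed.

Lemma integral_le g1 g2 : measurable_fun setT g1 -> measurable_fun setT g2 ->
  (forall w, 0 <= g1 w) -> (forall w, g1 w <= g2 w) ->
  (\int[P]_w (g1 w)%:E <= \int[P]_w (g2 w)%:E)%E.
Proof.
move=> m1 m2 p1 p12; apply: ge0_le_integral => //.
- by move=> w _; rewrite lee_fin.
- exact/measurable_EFinP.
- exact/measurable_EFinP.
- by move=> w _; rewrite lee_fin.
Qed.

Lemma integral_constant (x : R) : (\int[P]_w (x)%:E = x%:E)%E.
Proof. by have := expectation_cst P x; rewrite unlock. Qed.

Lemma integral_indicator (A : set T) : measurable A ->
  (\int[P]_w (\1_A w)%:E = P A)%E.
Proof. by move=> mA; rewrite integral_indic// setIT. Qed.

End real_valued_integrals.

Section moments.
Context {R : realType} {disp : measure_display} {T : measurableType disp}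
  {P : probability T R}.
Variables (Y : {RV P >-> R}) (k : R).
Hypothesis k0 : 0 < k.
Hypothesis Yexp : (\int[P]_w (expR (Y w ^+ 2 / k))%:E <= 2%:E)%E.
Hypothesis Ysq : (\int[P]_w (Y w ^+ 2)%:E = 1)%E.

(** Adding a Y^2 on the left allows a negative coefficient of Y^2 in the bound
for F while all integrands stay nonnegative. *)
Lemma moment_bound (F : R -> R) (a b c e : R) :
  measurable_fun setT F -> (forall y, 0 <= F y) ->
  0 <= a -> 0 <= b -> 0 <= c -> 0 <= e ->
  (forall y, F y + a * y ^+ 2 <= b + c * y ^+ 2 + e * expR (y ^+ 2 / k)) ->
  (\int[P]_w (F (Y w))%:E <= (b + c + 2 * e - a)%:E)%E.
Proof.
move=> mF F0 a0 b0 c0 e0 H.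
have mY : measurable_fun setT Y by [].
have mY2 : measurable_fun setT (fun w => Y w ^+ 2) by apply: measurable_funX.
have mFY : measurable_fun setT (fun w => F (Y w)) by apply: measurableT_comp.
have mE : measurable_fun setT (fun w => expR (Y w ^+ 2 / k)).
  by apply: measurableT_comp => //; apply: measurable_funM.
have H1 : (\int[P]_w (F (Y w) + a * Y w ^+ 2)%:E <=
    \int[P]_w (b + c * Y w ^+ 2 + e * expR (Y w ^+ 2 / k))%:E)%E.
  apply: ge0_le_integral => //.
  - by move=> w _; rewrite lee_fin addr_ge0// mulr_ge0// sqr_ge0.
  - by apply/measurable_EFinP; apply: measurable_funD => //; apply: measurable_funM.
  - apply/measurable_EFinP; apply: measurable_funD; last by apply: measurable_funM.
    by apply: measurable_funD => //; apply: measurable_funM.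
  - by move=> w _; rewrite lee_fin.
have cY0 w : 0 <= c * Y w ^+ 2 by rewrite mulr_ge0// sqr_ge0.
have aY0 w : 0 <= a * Y w ^+ 2 by rewrite mulr_ge0// sqr_ge0.
have mcY : measurable_fun setT (fun w => c * Y w ^+ 2) by apply: measurable_funM.
have maY : measurable_fun setT (fun w => a * Y w ^+ 2) by apply: measurable_funM.
have meE : measurable_fun setT (fun w => e * expR (Y w ^+ 2 / k)) by apply: measurable_funM.
have eE0 w : 0 <= e * expR (Y w ^+ 2 / k) by rewrite mulr_ge0// expR_ge0.
have sq0 w : 0 <= Y w ^+ 2 by apply: sqr_ge0.
have ex0 w : 0 <= expR (Y w ^+ 2 / k) by apply: expR_ge0.
move: H1; rewrite (integral_add P mFY maY)// (integral_scale P mY2)// Ysq mule1.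
rewrite (@integral_add _ _ _ P (fun w => b + c * Y w ^+ 2) _ _ meE)//; last 2 first.
- by apply: measurable_funD.
- by move=> w; rewrite addr_ge0.
rewrite (integral_add P (@measurable_cst _ _ _ _ _ b) mcY)// (integral_scale P mY2)// Ysq mule1 (integral_scale P mE)//.
have -> : (\int[P]_w (cst b w)%:E = b%:E)%E := integral_constant P b.
move=> H1; rewrite -leeBrDr// in H1; apply: le_trans H1 _.
have E2 : (e%:E * \int[P]_w (expR (Y w ^+ 2 / k))%:E <= (2 * e)%:E)%E.
  by rewrite mulrC EFinM lee_wpmul2l// lee_fin.
by rewrite EFinB !EFinD; apply: leeB => //; apply: leeD.
Qed.

End moments.

Section single_variable.
Context {R : realType} {disp : measure_display} {T : measurableType disp}
  {P : probability T R}.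
Variable Y : {RV P >-> R}.

(** The norm is an infimum, so some a < 2 K is admissible, and the moment
decreases in a. *)
Lemma psi2_norm_exp_moment (K : R) : 0 < K -> (psi2_norm P Y <= K%:E)%E ->
  (\int[P]_w (expR (Y w ^+ 2 / (4 * K ^+ 2)))%:E <= 2%:E)%E.
Proof.
move=> K0 YK.
have : (psi2_norm P Y < (2 * K)%:E)%E.
  by apply: le_lt_trans YK _; rewrite lte_fin; lra.
move=> /ereal_inf_lt [_ /= [a [a0 aE] <-]]; rewrite lte_fin => aK.
rewrite unlock in aE; apply: le_trans aE.
apply: ge0_le_integral => //.
- apply/measurable_EFinP; apply: measurableT_comp => //; apply: measurable_funM => //.
  exact: measurable_funX.
- apply/measurable_EFinP; apply: measurableT_comp => //; apply: measurable_funM => //.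
  exact: measurable_funX.
move=> w _; rewrite lee_fin ler_expR ler_wpM2l ?sqr_ge0// lef_pV2 ?posrE ?exprn_gt0//.
  by rewrite (_ : 4 * K ^+ 2 = (2 * K) ^+ 2); [rewrite lerXn2r ?nnegrE; lra|ring].
by rewrite mulr_gt0 ?exprn_gt0.
Qed.

Variable k : R.
Hypothesis k0 : 0 < k.
Hypothesis Yexp : (\int[P]_w (expR (Y w ^+ 2 / k))%:E <= 2%:E)%E.
Hypothesis Ysq : (\int[P]_w (Y w ^+ 2)%:E = 1)%E.

(** Integrate k + y^2 <= k exp(y^2/k). *)
Lemma exp_moment_scale_ge1 : 1 <= k.
Proof.
have := @moment_bound _ _ _ _ Y k Yexp Ysq (cst k) 1 0 0 k.
have -> : (\int[P]_w (cst k (Y w))%:E = k%:E)%E := integral_constant P k.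
move=> /(_ (@measurable_cst _ _ _ _ _ _)); rewrite lee_fin.
suff H : forall y : R, cst k y + 1 * y ^+ 2 <= 0 + 0 * y ^+ 2 + k * expR (y ^+ 2 / k).
  by move=> /(_ (fun=> ltW k0) ler01 (lexx _) (lexx _) (ltW k0) H); lra.
move=> y /=; rewrite mul0r !add0r mul1r.
have := @expR_ge1Dx R (y ^+ 2 / k) => /(ler_wpM2l (ltW k0)).
by rewrite mulrDr mulr1 mulrCA mulfV ?mulr1// gt_eqF.
Qed.

Lemma centered_square_mgf (l : R) : `|l| <= (2 * k)^-1 ->
  (\int[P]_w (expR (l * (Y w ^+ 2 - 1)))%:E <= (expR (68 * k ^+ 2 * l ^+ 2))%:E)%E.
Proof.
move=> lk; have k1 := exp_moment_scale_ge1.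
have l1 : `|l| <= 1.
  by apply: le_trans lk _; rewrite invf_le1 ?mulr_gt0//; lra.
move: l1; rewrite ler_norml => /andP[l1 l2].
have mF : measurable_fun setT (fun y : R => expR (l * (y ^+ 2 - 1))).
  apply: measurableT_comp => //; apply: measurable_funM => //.
  by apply: measurable_funB => //; exact: measurable_cst.
have e0 : 0 <= 34 * l ^+ 2 * k ^+ 2 by rewrite -mulrA mulr_ge0// mulr_ge0// sqr_ge0.
apply: (@le_trans _ _ (1 + 68 * k ^+ 2 * l ^+ 2)%:E); last first.
  by rewrite lee_fin expR_ge1Dx.
have [lp|ln] := leP 0 l.
  have := @moment_bound _ _ _ _ Y k Yexp Ysq _ 0 (1 - l) l _ mF
    (fun y => expR_ge0 _) (lexx _) _ lp e0.
  move=> H; apply: le_trans (H _ _) _; first lra.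
  - move=> y; have := @centered_square_exp R k l y k1 lk; lra.
  - by rewrite lee_fin; lra.
have := @moment_bound _ _ _ _ Y k Yexp Ysq _ (- l) (1 - l) 0 _ mF
    (fun y => expR_ge0 _) _ _ (lexx _) e0.
move=> H; apply: le_trans (H _ _ _) _; [lra|lra| |].
- move=> y; have := @centered_square_exp R k l y k1 lk; lra.
- by rewrite lee_fin; lra.
Qed.

Lemma truncated_fourth_mgf (M : R) (D : R -> R) :
  k <= M ^+ 2 -> measurable_fun setT D ->
  (forall x, `|D x| <= M) -> (forall x, `|D x| <= `|x|) ->
  (\int[P]_w (expR (D (Y w) ^+ 4 / (2 * k * M ^+ 2)))%:E
    <= (expR (16 * k / M ^+ 2))%:E)%E.
Proof.
move=> kM mD DM Dx.
have mF : measurable_fun setT (fun y : R => expR (D y ^+ 4 / (2 * k * M ^+ 2))).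
  apply: measurableT_comp => //; apply: measurable_funM => //.
  exact: measurable_funX.
have e0 : 0 <= 8 * k / M ^+ 2 by rewrite divr_ge0 ?sqr_ge0// mulr_ge0// ltW.
apply: le_trans (moment_bound Yexp Ysq mF (fun y => expR_ge0 _) (lexx 0) ler01 (lexx 0) e0 _) _.
  move=> y; rewrite !mul0r !addr0; exact: truncated_fourth_exp.
rewrite lee_fin; apply: le_trans (expR_ge1Dx _); lra.
Qed.

Lemma tail_sq_mgf (M : R) : 0 <= M ->
  (\int[P]_w (expR (tail_sq M (Y w) / (2 * k)))%:E
    <= (expR (2 * expR (- (M ^+ 2 / (2 * k)))))%:E)%E.
Proof.
move=> M0.
have mF : measurable_fun setT (fun y : R => expR (tail_sq M y / (2 * k))).
  apply: measurableT_comp => //; apply: measurable_funM => //.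
  apply: measurable_fun_ifT => //.
  by apply: measurable_fun_ler => //; exact: measurable_cst.
apply: le_trans (moment_bound Yexp Ysq mF (fun y => expR_ge0 _) (lexx 0) ler01 (lexx 0) (expR_ge0 _) _) _.
  move=> y; rewrite !mul0r !addr0; exact: tail_sq_exp.
rewrite lee_fin; apply: le_trans (expR_ge1Dx _); lra.
Qed.

End single_variable.

(** * Probability of irregular samples *)
Section regularity_events.
Context {R : realType} {disp : measure_display} {T : measurableType disp}
  {P : probability T R} {n : nat} (X : 'I_n -> {RV P >-> R}).
Hypothesis Xind : mutually_independent X.
Variable k : R.
Hypothesis n0 : (0 < n)%N.
Hypothesis k0 : 0 < k.
Hypothesis Xexp : forall i, (\int[P]_w (expR (X i w ^+ 2 / k))%:E <= 2%:E)%E.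
Hypothesis Xsq : forall i, (\int[P]_w (X i w ^+ 2)%:E = 1)%E.

Let nR : 0 < n%:R :> R. Proof. by rewrite ltr0n. Qed.

Let k1 : 1 <= k.
Proof. exact: (exp_moment_scale_ge1 k0 (Xexp (Ordinal n0)) (Xsq _)). Qed.

Lemma probability_le_union (A B C : set T) :
  measurable A -> measurable B -> measurable C -> A `<=` B `|` C ->
  (P A <= P B + P C)%E.
Proof.
move=> mA mB mC AB; apply: (@le_trans _ _ (P (B `|` C))).
  by apply: le_measure => //; rewrite inE//; apply: measurableU.
exact: measureU2.
Qed.

Lemma measurable_sum_event (h : R -> R) (b : R) : measurable_fun setT h ->
  measurable [set w | b <= \sum_(i < n) h (X i w)].
Proof.
move=> mh; apply: measurable_le_set; first exact: measurable_cst.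
by apply: measurable_sum => i; apply: measurableT_comp.
Qed.

Lemma measurable_square_deviation (r : R) :
  measurable [set w | r <= `|\sum_(i < n) (X i w ^+ 2 - 1)|].
Proof.
apply: measurable_le_set; first exact: measurable_cst.
apply: measurableT_comp => //; apply: measurable_sum => i.
apply: measurable_funB; last exact: measurable_cst.
exact: measurable_funX.
Qed.

Lemma square_deviation_probability (r : R) : 0 <= r -> r <= n%:R ->
  (P [set w | r <= `|\sum_(i < n) (X i w ^+ 2 - 1)|]%R <=
   (2 * expR (- (r ^+ 2 / (272 * n%:R * k ^+ 2))))%:E)%E.
Proof.
move=> r0 rn.
pose l := r / (136 * n%:R * k ^+ 2).
have k2 : 0 < k ^+ 2 by rewrite exprn_gt0.
have den : 0 < 136 * n%:R * k ^+ 2 by rewrite !mulr_gt0.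
have l0 : 0 <= l by rewrite divr_ge0// ltW.
have lk : l <= (2 * k)^-1.
  rewrite ler_pdivrMr// mulrC ler_pdivlMr ?mulr_gt0//.
  have nk : n%:R <= n%:R * k by rewrite ler_peMr// ltW.
  have -> : 136 * n%:R * k ^+ 2 = 68 * (n%:R * k) * (2 * k) by ring.
  by rewrite ler_pM2r ?mulr_gt0//; nra.
have mh (c : R) : measurable_fun setT (fun y : R => c * (y ^+ 2 - 1)).
  apply: measurable_funM => //; apply: measurable_funB => //.
have bound (c : R) : `|c| = l ->
    (P [set w | l * r <= \sum_(i < n) c * (X i w ^+ 2 - 1)]%R <=
      (expR (- (r ^+ 2 / (272 * n%:R * k ^+ 2))))%:E)%E.
  move=> cl; have := @chernoff_sum _ _ _ _ _ _ Xind _ (68 * k ^+ 2 * c ^+ 2) (l * r) (mh c).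
  move=> H; apply: le_trans (H _) _.
    by move=> i; apply: centered_square_mgf => //; rewrite cl.
  rewrite lee_fin ler_expR -(real_normK (num_real c)) cl.
  rewrite le_eqVlt; apply/orP; left; apply/eqP; rewrite /l; field.
  by rewrite !gt_eqF.
rewrite mulr2n mulrDl mul1r EFinD.
apply: le_trans (leeD (bound l (ger0_norm l0)) (bound (- l) _)); last first.
  by rewrite normrN ger0_norm.
apply: probability_le_union.
- exact: measurable_square_deviation.
- exact: (measurable_sum_event (l * r) (mh l)).
- exact: (measurable_sum_event (l * r) (mh (- l))).
move=> w /=; rewrite -!mulr_sumr; set S := \sum_(i < n) _ => rS.
case: (leP 0 S) => S0; [left|right].
  by rewrite ler_wpM2l// -(ger0_norm S0).
by rewrite /= mulNr -mulrN ler_wpM2l// -(ltr0_norm S0).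
Qed.

Lemma truncated_fourth_probability (M : R) (D : R -> R) :
  k <= M ^+ 2 -> measurable_fun setT D ->
  (forall x, `|D x| <= M) -> (forall x, `|D x| <= `|x|) ->
  (P [set w | 34 * k ^+ 2 * n%:R <= \sum_(i < n) D (X i w) ^+ 4]%R <=
   (expR (- (k * n%:R / M ^+ 2)))%:E)%E.
Proof.
move=> kM mD DM Dx.
have M2 : 0 < M ^+ 2 by apply: lt_le_trans kM.
have MN0 : M != 0 by rewrite -sqrf_eq0 gt_eqF.
have den : 0 < 2 * k * M ^+ 2 by apply: mulr_gt0 => //; apply: mulr_gt0.
have mh : measurable_fun setT (fun y => D y ^+ 4 / (2 * k * M ^+ 2)).
  by apply: measurable_funM => //; apply: measurable_funX.
have := @chernoff_sum _ _ _ _ _ _ Xind _ (16 * k / M ^+ 2)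
  (34 * k ^+ 2 * n%:R / (2 * k * M ^+ 2)) mh.
move=> H; rewrite (_ : [set w | _] = [set w | 34 * k ^+ 2 * n%:R / (2 * k * M ^+ 2) <=
    \sum_(i < n) D (X i w) ^+ 4 / (2 * k * M ^+ 2)]); last first.
  by apply/seteqP; split => w /=; rewrite -mulr_suml ler_pM2r ?invr_gt0.
apply: le_trans (H _) _; first by move=> i; apply: truncated_fourth_mgf.
rewrite lee_fin ler_expR le_eqVlt; apply/orP; left; apply/eqP; field.
by rewrite MN0 gt_eqF.
Qed.

Lemma measurable_tail_sq (M : R) : measurable_fun setT (tail_sq M).
Proof.
apply: measurable_fun_ifT => //.
by apply: measurable_fun_ler => //; exact: measurable_cst.
Qed.

Lemma tail_sq_probability (M v : R) : 0 <= M ->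
  (P [set w | v <= \sum_(i < n) tail_sq M (X i w)]%R <=
   (expR (n%:R * (2 * expR (- (M ^+ 2 / (2 * k)))) - v / (2 * k)))%:E)%E.
Proof.
move=> M0.
have mh : measurable_fun setT (fun y => tail_sq M y / (2 * k)).
  by apply: measurable_funM => //; exact: measurable_tail_sq.
have := @chernoff_sum _ _ _ _ _ _ Xind _ (2 * expR (- (M ^+ 2 / (2 * k))))
  (v / (2 * k)) mh.
move=> H; rewrite (_ : [set w | _] = [set w | v / (2 * k) <=
    \sum_(i < n) tail_sq M (X i w) / (2 * k)]); last first.
  by apply/seteqP; split => w /=; rewrite -mulr_suml ler_pM2r// invr_gt0 mulr_gt0.
by apply: H => i; apply: tail_sq_mgf.
Qed.

Definition bad_event (r v M : R) (D : R -> R) : set T :=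
  [set w | r <= `|\sum_(i < n) (X i w ^+ 2 - 1)|] `|`
  ([set w | v <= \sum_(i < n) tail_sq M (X i w)] `|`
   [set w | 34 * k ^+ 2 * n%:R <= \sum_(i < n) D (X i w) ^+ 4]).

Lemma measurable_bad_event r v M D : measurable_fun setT D ->
  measurable (bad_event r v M D).
Proof.
move=> mD; apply: measurableU; first exact: measurable_square_deviation.
apply: measurableU; first by apply: measurable_sum_event; exact: measurable_tail_sq.
by apply: (measurable_sum_event (h := fun x => D x ^+ 4)); exact: measurable_funX.
Qed.

(** Each of the three events has a Chernoff bound with an exponent at least
eta^2/(272 (M^2 d + k^2 d^2)).  The hypothesis on M makes the expected energy
of the coordinates above M smaller than the allowed eta^2/d. *)
Lemma bad_event_probability (d : nat) (eta M : R) (D : R -> R) :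
  (0 < d)%N -> 0 <= eta -> eta ^+ 2 <= n%:R ->
  k <= M ^+ 2 -> 0 <= M -> measurable_fun setT D ->
  (forall x, `|D x| <= M) -> (forall x, `|D x| <= `|x|) ->
  8 * k * n%:R * expR (- (M ^+ 2 / (2 * k))) <= eta ^+ 2 / d%:R ->
  (P (bad_event (eta * Num.sqrt n%:R / d%:R) (eta ^+ 2 / d%:R) M D) <=
   (4 * expR (- (eta ^+ 2 / (272 * (M ^+ 2 * d%:R + k ^+ 2 * d%:R ^+ 2)))))%:E)%E.
Proof.
move=> d0 e0 en kM M0 mD DM Dx hM.
have d1 : 1 <= d%:R :> R by rewrite ler1n.
have dp : 0 < d%:R :> R by rewrite ltr0n.
have dN0 : d%:R != 0 :> R by rewrite gt_eqF.
have nN0 : n%:R != 0 :> R by rewrite gt_eqF.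
have kN0 : k != 0 by rewrite gt_eqF.
have M2 : 0 < M ^+ 2 by apply: lt_le_trans kM.
have k2 : 0 < k ^+ 2 by rewrite exprn_gt0.
set r := eta * _ / _; set v := eta ^+ 2 / _; set e := expR (- _).
have sn : 0 <= Num.sqrt n%:R :> R by apply: sqrtr_ge0.
have r0 : 0 <= r by rewrite divr_ge0// mulr_ge0.
have en' : eta <= Num.sqrt n%:R.
  by rewrite -[leLHS]ger0_norm// -sqrtr_sqr ler_wsqrtr.
have rn : r <= n%:R.
  rewrite ler_pdivrMr//; apply: (@le_trans _ _ (n%:R * 1)); last by rewrite ler_wpM2l.
  by rewrite mulr1 -[leRHS](@sqr_sqrtr _ n%:R)// expr2 ler_wpM2r.
have dd : d%:R <= d%:R ^+ 2 :> R by rewrite expr2 ler_peMr.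
pose s2 := M ^+ 2 * d%:R + k ^+ 2 * d%:R ^+ 2.
have s20 : 0 < s2 by apply: addr_gt0; apply: mulr_gt0 => //; exact: exprn_gt0.
have G0 : 0 < 272 :> R by rewrite ltr0n.
have cmp (c : R) : 0 < c -> c <= 272 * s2 -> expR (- (eta ^+ 2 / c)) <= e.
  move=> c0 cs; rewrite /e ler_expR lerN2 ler_wpM2l ?sqr_ge0//.
  by rewrite lef_pV2 ?posrE ?(mulr_gt0 G0 s20).
have b1 : expR (- (r ^+ 2 / (272 * n%:R * k ^+ 2))) <= e.
  rewrite (_ : r ^+ 2 / _ = eta ^+ 2 / (272 * (k ^+ 2 * d%:R ^+ 2))); last first.
    by rewrite /r !exprMn sqr_sqrtr// exprVn; field; rewrite kN0 nN0 dN0.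
  apply: cmp; first by apply: (mulr_gt0 G0); apply: mulr_gt0 => //; exact: exprn_gt0.
  by rewrite (ler_pM2l G0) lerDr mulr_ge0// ltW.
have b2 : expR (n%:R * (2 * expR (- (M ^+ 2 / (2 * k)))) - v / (2 * k)) <= e.
  apply: (@le_trans _ _ (expR (- (eta ^+ 2 / (4 * k * d%:R))))); last first.
    apply: cmp; first by rewrite !mulr_gt0.
    have h1 : k * d%:R <= k ^+ 2 * d%:R ^+ 2.
      have kk : k <= k ^+ 2 by rewrite expr2 ler_peMr// ltW.
      by apply: ler_pM => //; exact: ltW.
    have : 0 <= M ^+ 2 * d%:R by rewrite mulr_ge0// ltW.
    have : 0 <= k ^+ 2 * d%:R ^+ 2 by rewrite mulr_ge0 ?sqr_ge0.
    by rewrite /s2; lra.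
  rewrite ler_expR (_ : eta ^+ 2 / (4 * k * d%:R) = v / (4 * k)); last first.
    by rewrite /v; field; rewrite dN0 kN0.
  have : n%:R * (2 * expR (- (M ^+ 2 / (2 * k)))) <= v / (4 * k).
    rewrite ler_pdivlMr ?mulr_gt0//; apply: le_trans hM.
    rewrite le_eqVlt; apply/orP; left; apply/eqP; ring.
  have : v / (2 * k) = 2 * (v / (4 * k)) by field; rewrite kN0.
  lra.
have b3 : expR (- (k * n%:R / M ^+ 2)) <= e.
  apply: (@le_trans _ _ (expR (- (eta ^+ 2 / M ^+ 2)))); last first.
    apply: cmp => //; rewrite /s2.
    have h1 : M ^+ 2 <= M ^+ 2 * d%:R by rewrite ler_peMr// ltW.
    have : 0 <= k ^+ 2 * d%:R ^+ 2 by rewrite mulr_ge0 ?sqr_ge0.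
    lra.
  rewrite ler_expR lerN2 ler_wpM2r ?invr_ge0 ?(ltW M2)//.
  by apply: le_trans en _; rewrite ler_peMl// ltW.
rewrite (_ : 4 * e = 2 * e + (e + e)); last by ring.
rewrite !EFinD.
have m1 := measurable_square_deviation r.
have m2 : measurable [set w | v <= \sum_(i < n) tail_sq M (X i w)].
  by apply: measurable_sum_event; exact: measurable_tail_sq.
have m3 : measurable [set w | 34 * k ^+ 2 * n%:R <= \sum_(i < n) D (X i w) ^+ 4].
  by apply: (measurable_sum_event (h := fun x => D x ^+ 4)); exact: measurable_funX.
apply: le_trans (measureU2 _ m1 (measurableU _ _ m2 m3)) _.
apply: leeD.
  apply: le_trans (square_deviation_probability r0 rn) _.
  by rewrite lee_fin ler_wpM2l.
apply: le_trans (measureU2 _ m2 m3) _; apply: leeD.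
  by apply: le_trans (tail_sq_probability _ M0) _; rewrite lee_fin.
by apply: le_trans (truncated_fourth_probability kM mD DM Dx) _; rewrite lee_fin.
Qed.

End regularity_events.

(** * Measurability of Lipschitz functions of the tensor power *)
Section measurability.
Context {R : realType} {disp : measure_display} {T : measurableType disp}
  {P : probability T R} {n d : nat} (X : 'I_n -> {RV P >-> R}).

Lemma measurable_finite_valued (F : finType) (W : T -> F) (g : F -> R) :
  (forall c, measurable (W @^-1` [set c])) -> measurable_fun setT (fun w => g (W w)).
Proof.
move=> mW.
rewrite (_ : (fun _ => _) = (fun w => \sum_(c : F) g c * \1_(W @^-1` [set c]) w)).
  by apply: measurable_sum => c; apply: measurable_funM => //; exact: measurable_indic.
apply/funext => w; rewrite (bigD1 (W w))//= indicE mem_set// mulr1 big1 ?addr0// => c cW.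
by rewrite indicE memNset ?mulr0//= => Wc; rewrite -Wc eqxx in cW.
Qed.

Lemma enorm_le_sum (I : finType) (u : I -> R) : enorm u <= \sum_i `|u i|.
Proof.
have s0 : 0 <= \sum_i `|u i| by apply: sumr_ge0.
rewrite -[leRHS]ger0_norm// -sqrtr_sqr ler_wsqrtr//.
rewrite expr2 mulr_suml; apply: ler_sum => i _.
rewrite -expr2 -(real_normK (num_real (u i))) expr2 ler_wpM2l//.
by rewrite (bigD1 i)//= lerDl sumr_ge0.
Qed.

Lemma lipschitz_cvg (f : tensor_space R n d -> R) (L : R) (x : ('I_n -> R))
    (xk : nat -> 'I_n -> R) :
  0 <= L -> tensor_lipschitz L f -> (forall i, xk k i @[k --> \oo] --> x i) ->
  f (tensor_power (xk k)) @[k --> \oo] --> f (tensor_power x).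
Proof.
move=> L0 lf xkx.
pose g k := \sum_(i : {ffun 'I_d -> 'I_n})
   `|(tensor_power (xk k) i : R) - tensor_power x i|.
have cg : L * g k @[k --> \oo] --> 0.
  rewrite -[0](mulr0 L); apply: cvgM; first exact: cvg_cst.
  rewrite [X in _ --> X](_ : 0 = \sum_(i : {ffun 'I_d -> 'I_n}) 0); last by rewrite big1.
  apply: cvg_big => [|i _]; first exact: add_continuous.
  rewrite -[0](@normr0 _ R); apply: cvg_norm.
  rewrite -[0](subrr (tensor_power x i : R)); apply: cvgB; last exact: cvg_cst.
  rewrite ffunE; under eq_fun do rewrite ffunE.
  by apply: cvg_big => [|j _]; [exact: mul_continuous | exact: xkx].
apply/cvgrPdist_le => e e0.
move/cvgrPdist_le : cg => /(_ e e0); apply: filterS => k.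
rewrite sub0r normrN => h; rewrite distrC.
apply: le_trans (lf _ _) _; apply: le_trans h.
apply: le_trans (ler_norm _); rewrite ler_wpM2l// tensor_normE.
apply: le_trans (enorm_le_sum _) _; apply: ler_sum => i _.
by rewrite !ffunE.
Qed.

(** A Lipschitz function is continuous, so f(X^{(x)d}) is the pointwise limit of
its values at staircase approximations of X, which are functions of finitely
many cells. *)
Lemma measurable_tensor_function (f : tensor_space R n d -> R) (L : R) :
  0 <= L -> tensor_lipschitz L f ->
  measurable_fun setT (fun w => f (tensor_power (fun i => X i w))).
Proof.
move=> L0 lf.
pose N k := (k.+1 * k.+1)%N.
pose delta k : R := k.+1%:R^-1.
have delta0 k : 0 < delta k by rewrite invr_gt0.
pose thr k x : {ffun 'I_(N k) -> bool} := [ffun j : 'I_(N k) => j.+1%:R * delta k <= x].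
pose cell k x := (thr k x, thr k (- x)).
pose cnt k (c : {ffun 'I_(N k) -> bool}) : R := (\sum_(j < N k) (c j)%:R) * delta k.
pose rep k c := cnt k c.1 - cnt k c.2.
have cntE k x : cnt k (thr k x) = staircase (N k) (delta k) x * delta k.
  by congr (_ * _); apply: eq_bigr => j _; rewrite ffunE.
have neg k x : x <= 0 -> staircase (N k) (delta k) x = 0.
  move=> x0; apply: big1 => j _; rewrite (negbTE (_ : ~~ (_ <= _)))// -ltNge.
  by apply: le_lt_trans x0 _; rewrite mulr_gt0.
have mcell k c : measurable (cell k @^-1` [set c]).
  case: c => c1 c2.
  rewrite (_ : _ @^-1` _ = thr k @^-1` [set c1] `&`
     ((fun x => [ffun j : 'I_(N k) => j.+1%:R * delta k <= - x]) @^-1` [set c2])); last first.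
    by apply/seteqP; split => [x /= [<- <-]//|x /= [e1 e2]]; rewrite -e1 -e2.
  apply: measurableI; first exact: (measurable_threshold_cells _ _ (@measurable_id _ _ _)).
  by apply: measurable_threshold_cells; exact: measurable_funN.
have repc x : rep k (cell k x) @[k --> \oo] --> x.
  rewrite /rep /cell /=; under eq_fun do rewrite !cntE.
  have [x0|x0] := leP 0 x.
    under eq_fun do rewrite (neg _ (- x)) ?oppr_le0// mul0r subr0.
    exact: staircase_cvg.
  under eq_fun do rewrite (neg _ x) ?(ltW x0)// mul0r sub0r.
  have nx : 0 <= - x by rewrite oppr_ge0 ltW.
  have h := cvgN (staircase_cvg nx); rewrite opprK in h; exact: h.
apply: (@measurable_fun_cvg _ _ _ _
   (fun k w => f (tensor_power (fun i => rep k (cell k (X i w)))))) => //.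
- move=> k.
  pose g (c : {ffun 'I_n -> _}) := f (tensor_power (fun i => rep k (c i))).
  rewrite (_ : (fun _ => _) = (fun w => g (cells X (cell k) w))); last first.
    apply/funext => w; congr f; apply/ffunP => i; rewrite !ffunE.
    by apply: eq_bigr => j _; rewrite ffunE.
  by apply: measurable_finite_valued; apply: measurable_cells; exact: mcell.
- by move=> w _; apply: lipschitz_cvg lf _ => //.
Qed.

End measurability.

(** * Sublevel sets against superlevel sets *)
Section two_level_sets.
Context {R : realType} {disp : measure_display} {T : measurableType disp}
  {P : probability T R} {n d : nat} (X : 'I_n -> {RV P >-> R}).
Hypothesis Xind : mutually_independent X.
Hypothesis d0 : (0 < d)%N.

Local Notation point w := (fun i => X i w).

(** The cells of the samples in A and in B are two sets of a finite product
space.  Talagrand's inequality for them yields cells of a sample of B and a law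
on cells of samples of A; choosing one sample in each cell brings back points
at which the values of f are known. *)
Lemma two_regular_sets (C : finType) (cell : R -> C) (D : R -> R)
    (f : tensor_space R n d -> R) (L N M Q eta a b : R) (A B : set T) :
  (forall c, measurable (cell @^-1` [set c])) ->
  (forall x y, cell x = cell y -> D x = D y) ->
  0 <= L -> convex_function setT f -> tensor_lipschitz L f ->
  0 < N -> 0 <= M -> 0 <= Q -> 0 <= eta -> eta <= N / 4 ->
  measurable A -> measurable B -> (0 < P A)%E -> (0 < P B)%E ->
  (forall w, A w \/ B w -> regular D (d := d) N M Q eta (point w)) ->
  (forall w, A w -> f (tensor_power (point w)) <= a) ->
  (forall w, B w -> b <= f (tensor_power (point w))) ->
  b - a <= L * N ^+ d.-1 * ((2 * M * Num.sqrt d%:R + 32 * d%:R * Num.sqrt Q) *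
    Num.sqrt (- 8 * ln (fine (P A) * fine (P B))) + 73 * eta).
Proof.
move=> mcell cD L0 cf lf N0 M0 Q0 e0 eN mA mB PA0 PB0 reg fA fB.
pose cs := cells X cell.
pose As := [set c | `[< exists2 w, A w & cs w = c >]]%SET.
pose Bs := [set c | `[< exists2 w, B w & cs w = c >]]%SET.
pose p := cell_law X cell.
have mcs (S : {set {ffun 'I_n -> C}}) : measurable [set w | cs w \in S].
  rewrite (_ : [set _ | _] = \bigcup_(c in [set c | c \in S]) (cs @^-1` [set c])).
    apply: fin_bigcup_measurable; first exact: finite_finset.
    by move=> c _; apply: measurable_cells.
  by apply/seteqP; split => [w /= wA|w [c /= cA ->]//]; exists (cs w).
have mass (E : set T) (S : {set {ffun 'I_n -> C}}) : measurable E ->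
    (forall w, E w -> cs w \in S) -> fine (P E) <= set_mass p S.
  move=> mE ES; rewrite -[leRHS]/(fine (set_mass p S)%:E).
  rewrite -(cells_set_probability Xind mcell).
  apply: fine_le; rewrite ?fin_num_measure//.
  by apply: le_measure; rewrite ?inE.
have massA : fine (P A) <= set_mass p As.
  by apply: mass => // w wA; rewrite inE; apply/asboolP; exists w.
have massB : fine (P B) <= set_mass p Bs.
  by apply: mass => // w wB; rewrite inE; apply/asboolP; exists w.
have fA0 : 0 < fine (P A) by rewrite fine_gt0// PA0 ltey_eq fin_num_measure.
have fB0 : 0 < fine (P B) by rewrite fine_gt0// PB0 ltey_eq fin_num_measure.
have pA0 : 0 < set_mass p As by apply: lt_le_trans massA.
have pB0 : 0 < set_mass p Bs by apply: lt_le_trans massB.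
have p0 i c : 0 <= p i c by apply: cell_law_ge0.
have p1 i : \sum_c p i c = 1 by apply: cell_law_sum1.
have [xc xcB [nu [nu0 nu1 nuA] nux]] := convex_distance_two_sets p0 p1 pA0 pB0.
move: xcB; rewrite inE => /asboolP [wx wxB xcE].
have [c0 c0A] := set_mass_nonempty pA0.
have rep c : exists w, A w /\ (c \in As -> cs w = c).
  have [cA|cA] := boolP (c \in As).
    by move: (cA); rewrite inE => /asboolP [w wA wc]; exists w.
  by move: c0A; rewrite inE => /asboolP [w wA wc]; exists w.
have [r rP] := boolp.choice rep.
set h := - 8 * ln (fine (P A) * fine (P B)).
have lnle : ln (fine (P A) * fine (P B)) <= ln (set_mass p As * set_mass p Bs).
  by rewrite ler_ln ?posrE ?mulr_gt0// ler_pM// ltW.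
have ln0 : ln (set_mass p As * set_mass p Bs) <= 0.
  apply: ln_le0; rewrite -[leRHS](mulr1 1); apply: ler_pM; rewrite ?(ltW pA0) ?(ltW pB0)//.
    exact: set_mass_le1.
  exact: set_mass_le1.
have h0 : 0 <= h by rewrite /h; lra.
have mism : \sum_l (\sum_(j | cell (X l (r j)) != cell (X l wx)) nu j) ^+ 2 <= h.
  apply: (@le_trans _ _ (\sum_l mismatch nu xc l ^+ 2)); last by rewrite /h; lra.
  apply: ler_sum => l _; rewrite le_eqVlt; apply/orP; left; apply/eqP.
  congr (_ ^+ 2); rewrite /mismatch big_mkcond [RHS]big_mkcond /=.
  apply: eq_bigr => j _.
  have [jA|jA] := boolP (j \in As); last by rewrite nuA//; do 2 case: ifP.
  have [_ /(_ jA) e] := rP j.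
  have -> : j l = cell (X l (r j)).
    by have := congr1 (fun g : {ffun 'I_n -> C} => g l) e; rewrite ffunE.
  by rewrite -xcE ffunE.
have := @truncated_gap R n d C D cell f L N M Q eta h _ nu (point wx) (fun j => point (r j))
  cD d0 L0 cf lf nu0 nu1 N0 M0 Q0 e0 eN h0 (reg _ (or_intror wxB))
  (fun j => reg _ (or_introl (rP j).1)) mism.
apply: le_trans; apply: lerB; first exact: fB.
rewrite -[leRHS]mul1r -nu1 mulr_suml; apply: ler_sum => j _.
by rewrite ler_wpM2l//; apply: fA; exact: (rP j).1.
Qed.

End two_level_sets.

Section level_set_concentration.
Context {R : realType} {disp : measure_display} {T : measurableType disp}
  {P : probability T R} {n d : nat} (X : 'I_n -> {RV P >-> R}).
Hypothesis Xind : mutually_independent X.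
Variable k : R.
Hypothesis n0 : (0 < n)%N.
Hypothesis d0 : (0 < d)%N.
Hypothesis k0 : 0 < k.
Hypothesis Xexp : forall i, (\int[P]_w (expR (X i w ^+ 2 / k))%:E <= 2%:E)%E.
Hypothesis Xsq : forall i, (\int[P]_w (X i w ^+ 2)%:E = 1)%E.
Variables (f : tensor_space R n d -> R) (L : R).
Hypothesis L0 : 0 < L.
Hypothesis cf : convex_function setT f.
Hypothesis lf : tensor_lipschitz L f.

Local Notation Z := (fun w => f (tensor_power (fun i => X i w))).
Local Notation N := (Num.sqrt n%:R : R).
Local Notation U := (L * N ^+ d.-1).

(** The variance in the Gaussian-type tails of Z / U. *)
Definition variance_proxy (M : R) : R := M ^+ 2 * d%:R + k ^+ 2 * d%:R ^+ 2.

(** The last condition bounds the energy of the coordinates above M at the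
scale eta of the deviation, and is preserved when eta grows up to N/4. *)
Definition admissible_level (M eta : R) : Prop :=
  [/\ 0 < eta, eta <= N / 4, 0 < M, k <= M ^+ 2 &
     8 * k * n%:R * expR (- (M ^+ 2 / (2 * k))) <= eta ^+ 2 / d%:R].

(** The exceptional event E consists of the irregular samples.  Outside E,
[two_regular_sets] bounds b - a by U (S sqrt h + 73 eta) with
h = 8 log(1/(P(A) P(B))); as b - a exceeds 146 eta U, this forces
S^2 h >= (73 eta)^2, a lower bound for h because S^2 is of the order of the
variance proxy. *)
Lemma level_sets_product (M eta : R) : admissible_level M eta ->
  exists2 E : set T, measurable E /\
    (P E <= (4 * expR (- (eta ^+ 2 / (272 * variance_proxy M))))%:E)%E &
  forall a b, a + 146 * eta * U <= b ->
    fine (P ([set w | Z w <= a] `\` E)) * fine (P ([set w | b <= Z w] `\` E)) <=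
    expR (- (eta ^+ 2 / (272 * variance_proxy M))).
Proof.
move=> [e0 eN M0 kM hM].
have nR : 0 < n%:R :> R by rewrite ltr0n.
have dR : 0 < d%:R :> R by rewrite ltr0n.
have dN0 : d%:R != 0 :> R by rewrite gt_eqF.
have nN0 : n%:R != 0 :> R by rewrite gt_eqF.
have N0 : 0 < N by rewrite sqrtr_gt0.
have N2 : N ^+ 2 = n%:R by rewrite sqr_sqrtr.
pose v := eta ^+ 2 / d%:R.
have v0 : 0 < v by rewrite divr_gt0// exprn_gt0.
have vn0 : 0 < v / n%:R by rewrite divr_gt0.
have [C [cell [D [mcell mD cD Dprop]]]] := discretization M0 vn0.
have DM x : `|D x| <= M by case: (Dprop x).
have Dx x : `|D x| <= `|x| by case: (Dprop x).
exists (bad_event X k (eta * N / d%:R) v M D).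
  split; first exact: measurable_bad_event.
  apply: (bad_event_probability Xind n0 k0 Xexp Xsq) => //; rewrite ?(ltW e0) ?(ltW M0)//.
  by rewrite -N2 lerXn2r ?nnegrE; lra.
set E := bad_event _ _ _ _ _ _ => a b ab.
have mE : measurable E by apply: measurable_bad_event.
have mZ : measurable_fun setT Z by apply: (measurable_tensor_function _ (ltW L0) lf).
have mA : measurable ([set w | Z w <= a] `\` E).
  by apply: measurableD => //; apply: measurable_le_set => //; exact: measurable_cst.
have mB : measurable ([set w | b <= Z w] `\` E).
  by apply: measurableD => //; apply: measurable_le_set => //; exact: measurable_cst.
set A := _ `\` E in mA *; set B := _ `\` E in mB *.
have [PA0|PA0] := leP (P A) 0%E.
  have -> : P A = 0%E by apply/eqP; rewrite eq_le PA0 measure_ge0.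
  by rewrite mul0r expR_ge0.
have [PB0|PB0] := leP (P B) 0%E.
  have -> : P B = 0%E by apply/eqP; rewrite eq_le PB0 measure_ge0.
  by rewrite mulr0 expR_ge0.
have nE w : ~ E w -> regular D (d := d) N M (34 * k ^+ 2) eta (fun i => X i w).
  rewrite /E /bad_event => /not_orP[h1 /not_orP[h2 h3]].
  move/negP: h1; rewrite -ltNge => h1.
  move/negP: h2; rewrite -ltNge => h2.
  move/negP: h3; rewrite -ltNge => h3.
  have nv : \sum_(i < n) (v / n%:R) = v.
    by rewrite sumr_const card_ord -[LHS]mulr_natl mulrCA mulfV// mulr1.
  have v2 : 2 * eta ^+ 2 / d%:R = v + v by rewrite /v -mulrA mulr2n mulrDl mul1r.
  split.
  - rewrite N2 (_ : dot _ _ - _ = \sum_(i < n) (X i w ^+ 2 - 1)); first exact: ltW.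
    by rewrite sumrB sumr_const card_ord.
  - apply: (@le_trans _ _ (\sum_(i < n) (tail_sq M (X i w) + v / n%:R))).
      by apply: ler_sum => i _; rewrite -expr2; case: (Dprop (X i w)).
    by rewrite big_split /= nv v2 lerD2r ltW.
  - apply/andP; split.
      apply: ler_sum => i _; rewrite -!expr2 -(real_normK (num_real (D _))).
      by rewrite -(real_normK (num_real (X i w))) lerXn2r ?nnegrE.
    rewrite -lerBlDl -sumrB v2.
    apply: (@le_trans _ _ (\sum_(i < n) (tail_sq M (X i w) + v / n%:R))).
      by apply: ler_sum => i _; rewrite -!expr2; case: (Dprop (X i w)).
    by rewrite big_split /= nv lerD2r ltW.
  - by move=> l.
  - by rewrite N2; apply: ltW.
have Q0 : 0 <= 34 * k ^+ 2 by rewrite mulr_ge0// sqr_ge0.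
have := @two_regular_sets _ _ _ _ n d X Xind d0 C cell D f L N M (34 * k ^+ 2) eta a b
  A B mcell cD (ltW L0) cf lf N0 (ltW M0) Q0 (ltW e0) eN mA mB PA0 PB0.
move=> /(_ _ _ _)H.
have {H} H := H (fun w wAB => nE w (match wAB with or_introl h => h.2 | or_intror h => h.2 end))
  (fun w h => h.1) (fun w h => h.1).
have U0 : 0 < U by rewrite mulr_gt0// exprn_gt0.
have fA0 : 0 < fine (P A) by rewrite fine_gt0// PA0 ltey_eq fin_num_measure.
have fB0 : 0 < fine (P B) by rewrite fine_gt0// PB0 ltey_eq fin_num_measure.
have fAB : 0 < fine (P A) * fine (P B) by rewrite mulr_gt0.
rewrite -[leLHS]lnK ?posrE// ler_expR.
set x := ln _ in H *.
have x0 : 0 <= - 8 * x.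
  rewrite /x; have : ln (fine (P A) * fine (P B)) <= 0.
    apply: ln_le0; rewrite -[leRHS](mulr1 1); apply: ler_pM; rewrite ?(ltW fA0) ?(ltW fB0)//.
      by rewrite -[leRHS]/(fine 1%:E) fine_le ?fin_num_measure// probability_le1.
    by rewrite -[leRHS]/(fine 1%:E) fine_le ?fin_num_measure// probability_le1.
  lra.
set S := 2 * M * Num.sqrt d%:R + 32 * d%:R * Num.sqrt (34 * k ^+ 2) in H.
have H1 : 73 * eta <= S * Num.sqrt (- 8 * x).
  have : 146 * eta * U <= U * (S * Num.sqrt (- 8 * x) + 73 * eta) by lra.
  rewrite [leLHS]mulrC ler_pM2l//; lra.
have S0 : 0 <= S.
  by rewrite addr_ge0// mulr_ge0 ?sqrtr_ge0// mulr_ge0// ltW.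
have H2 : (73 * eta) ^+ 2 <= S ^+ 2 * (- 8 * x).
  rewrite -[X in _ <= _ * X](sqr_sqrtr x0) -exprMn lerXn2r ?nnegrE ?mulr_ge0 ?sqrtr_ge0//.
  exact: ltW.
have s20 : 0 < variance_proxy M.
  by rewrite /variance_proxy addr_gt0// mulr_gt0// exprn_gt0.
have S2 : S ^+ 2 <= 272 * 256 * variance_proxy M.
  have e1 : (2 * M * Num.sqrt d%:R) ^+ 2 = 4 * (M ^+ 2 * d%:R).
    by rewrite !exprMn sqr_sqrtr ?ltW//; ring.
  have e2 : (32 * d%:R * Num.sqrt (34 * k ^+ 2)) ^+ 2 = 136 * 256 * (k ^+ 2 * d%:R ^+ 2).
    by rewrite !exprMn sqr_sqrtr//; ring.
  have : S ^+ 2 <= 2 * (2 * M * Num.sqrt d%:R) ^+ 2 + 2 * (32 * d%:R * Num.sqrt (34 * k ^+ 2)) ^+ 2.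
    rewrite /S; set p := 2 * M * _; set q := _ * Num.sqrt _.
    by have := sqr_ge0 (p - q); lra.
  rewrite e1 e2 /variance_proxy.
  have : 0 <= M ^+ 2 * d%:R by rewrite mulr_ge0 ?sqr_ge0.
  lra.
have H3 : eta ^+ 2 <= 112 * variance_proxy M * (- x).
  have sx : 0 <= variance_proxy M * - x by rewrite mulr_ge0 ?(ltW s20)//; lra.
  have := ler_wpM2r x0 S2; move: H2; rewrite exprMn.
  by set Y := S ^+ 2 * _; lra.
rewrite lerNr ler_pdivrMr ?mulr_gt0//; apply: le_trans H3 _.
have : 0 <= variance_proxy M * - x by rewrite mulr_ge0 ?(ltW s20)//; lra.
lra.
Qed.

End level_set_concentration.

(** * Deviation from a median *)
Section approximate_median.
Context {R : realType} {disp : measure_display} {T : measurableType disp}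
  (P : probability T R).

(** The supremum m of the levels r with P(Z <= r) < 1/2 satisfies both bounds up
to an arbitrarily small shift, which spares one-sided limits of the
distribution function. *)
Lemma exists_approximate_median (Z : T -> R) (delta : R) :
  measurable_fun setT Z -> 0 < delta ->
  exists m : R, 2^-1 <= fine (P [set w | Z w <= m + delta]) /\
                2^-1 <= fine (P [set w | m - delta <= Z w]).
Proof.
move=> mZ d0.
pose ZR : {RV P >-> R} := mfun_Sub (mem_set mZ : Z \in mfun).
pose F r := fine (P [set w | Z w <= r]).
have mle r : measurable [set w | Z w <= r].
  by apply: measurable_le_set => //; exact: measurable_cst.
have FE r : cdf ZR r = (F r)%:E.
  by rewrite /F fineK ?fin_num_measure// /cdf /distribution /pushforward.
have Fmono r s : r <= s -> F r <= F s.
  move=> rs; apply: fine_le; rewrite ?fin_num_measure//.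
  by apply: le_measure; rewrite ?inE// => w /= /le_trans; apply.
have [a Fa] : exists a, F a < 2^-1.
  have /fine_cvgP [_ h] := cvg_cdfNy0 ZR.
  have near_h : \forall t \near -oo%R, (fine \o cdf ZR) t < 2^-1.
    by apply: (cvgr_lt _ h); rewrite invr_gt0.
  by have [a] := filter_ex near_h; rewrite /= FE; exists a.
have [b Fb] : exists b, 2^-1 <= F b.
  have /fine_cvgP [_ h] := cvg_cdfy1 ZR.
  have near_h : \forall t \near +oo%R, 2^-1 < (fine \o cdf ZR) t.
    by apply: (cvgr_gt _ h); rewrite invf_lt1 ?ltr1n.
  by have [b] := filter_ex near_h; rewrite /= FE => /ltW; exists b.
pose S := [set r | F r < 2^-1].
have supS : has_sup S.
  split; first by exists a.
  exists b; move=> r /= Fr; rewrite leNgt; apply/negP => /ltW /Fmono Fbr.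
  by have : F r < 2^-1 := Fr; rewrite ltNge (le_trans Fb Fbr).
exists (sup S); split.
  rewrite -/(F _) leNgt; apply/negP => Fs.
  by have := ub_le_sup supS.2 Fs; lra.
have [r Sr rs] := sup_adherent d0 supS.
have c : fine (P [set w | r < Z w]) = 1 - F r.
  rewrite (_ : [set w | _] = ~` [set w | Z w <= r]); last first.
    by apply/seteqP; split => w /= h; [apply/negP; rewrite -ltNge|rewrite ltNge; apply/negP].
  by rewrite probability_setC// fineB ?fin_num_measure.
have Sr' : F r < 2^-1 := Sr.
have mgt : measurable [set w | r < Z w].
  rewrite (_ : [set w | _] = ~` [set w | Z w <= r]); first exact: measurableC.
  by apply/seteqP; split => w /= h; [apply/negP; rewrite -ltNge|rewrite ltNge; apply/negP].
have mge : measurable [set w | sup S - delta <= Z w].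
  by apply: measurable_le_set => //; exact: measurable_cst.
have : fine (P [set w | r < Z w]) <= fine (P [set w | sup S - delta <= Z w]).
  apply: fine_le; rewrite ?fin_num_measure//.
  by apply: le_measure; rewrite ?inE// => w /= rw; apply/ltW/(lt_trans rs).
lra.
Qed.

End approximate_median.

Section tail_about_median.
Context {R : realType} {disp : measure_display} {T : measurableType disp}
  {P : probability T R} {n d : nat} (X : 'I_n -> {RV P >-> R}).
Hypothesis Xind : mutually_independent X.
Variable k : R.
Hypothesis n0 : (0 < n)%N.
Hypothesis d0 : (0 < d)%N.
Hypothesis k0 : 0 < k.
Hypothesis Xexp : forall i, (\int[P]_w (expR (X i w ^+ 2 / k))%:E <= 2%:E)%E.
Hypothesis Xsq : forall i, (\int[P]_w (X i w ^+ 2)%:E = 1)%E.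
Variables (f : tensor_space R n d -> R) (L : R).
Hypothesis L0 : 0 < L.
Hypothesis cf : convex_function setT f.
Hypothesis lf : tensor_lipschitz L f.

Local Notation Z := (fun w => f (tensor_power (fun i => X i w))).
Local Notation N := (Num.sqrt n%:R : R).
Local Notation U := (L * N ^+ d.-1).

Let mZ : measurable_fun setT Z.
Proof. exact: (measurable_tensor_function _ (ltW L0) lf). Qed.

Let fineP_le1 (A : set T) : measurable A -> fine (P A) <= 1.
Proof.
move=> mA; rewrite -[leRHS]/(fine 1%:E) fine_le ?fin_num_measure//.
exact: probability_le1.
Qed.

(** If q <= 1/16, removing E leaves A a mass of at least 1/4, which bounds the
mass of B; otherwise 16 q is at least 1. *)
Let half_sets (A B E : set T) (q : R) : measurable A -> measurable B -> measurable E ->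
  0 <= q -> (P E <= (4 * q)%:E)%E -> 2^-1 <= fine (P A) ->
  fine (P (A `\` E)) * fine (P (B `\` E)) <= q -> fine (P B) <= 16 * q.
Proof.
move=> mA mB mE q0 PE PA.
have fE : fine (P E) <= 4 * q.
  by rewrite -[leRHS]/(fine (4 * q)%:E) fine_le ?fin_num_measure.
have split_le (S : set T) : measurable S -> fine (P S) <= fine (P (S `\` E)) + fine (P E).
  move=> mS; rewrite -fineD ?fin_num_measure//; last exact: measurableD.
  apply: fine_le; rewrite ?fin_num_measure//.
    by rewrite fin_numD !fin_num_measure//; exact: measurableD.
  apply: probability_le_union => //; first exact: measurableD.
  by move=> w Sw; case: (pselect (E w)) => Ew; [right|left].
have := split_le _ mA; have := split_le _ mB.
have B0 : 0 <= fine (P (B `\` E)) by apply: fine_ge0.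
have B1 := fineP_le1 mB.
set a := fine (P (A `\` E)); set b := fine (P (B `\` E)) in B0 *.
move=> Bb Aa ab; have [q16|q16] := leP q (16^-1); last lra.
have a4 : 4^-1 <= a by lra.
have : 4^-1 * b <= a * b by rewrite ler_wpM2r.
lra.
Qed.

(** The level set inequality is used twice, with the sublevel and with the
superlevel set of the median as the set of mass one half. *)
Lemma tail_about_median (m delta M eta : R) :
  2^-1 <= fine (P [set w | Z w <= m + delta]) ->
  2^-1 <= fine (P [set w | m - delta <= Z w]) ->
  admissible_level (n := n) (d := d) k M eta -> delta <= eta * U ->
  (P [set w | 148 * U * eta <= `|Z w - m|]%R <=
    (32 * expR (- (eta ^+ 2 / (272 * variance_proxy (d := d) k M))))%:E)%E.
Proof.
move=> m1 m2 adm dU.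
have [E [mE PE] HE] := level_sets_product Xind n0 d0 k0 Xexp Xsq L0 cf lf adm.
set q := expR _ in PE HE *.
have q0 : 0 <= q by apply: expR_ge0.
have e0 : 0 < eta by case: adm.
have U0 : 0 < eta * U.
  by rewrite mulr_gt0// mulr_gt0// exprn_gt0// sqrtr_gt0 ltr0n.
have mle r : measurable [set w | Z w <= r].
  by apply: measurable_le_set => //; exact: measurable_cst.
have mge r : measurable [set w | r <= Z w].
  by apply: measurable_le_set => //; exact: measurable_cst.
have up : fine (P [set w | m + 148 * U * eta <= Z w]) <= 16 * q.
  apply: (half_sets (mle (m + delta)) (mge _) mE q0 PE m1).
  by apply: HE; lra.
have low : fine (P [set w | Z w <= m - 148 * U * eta]) <= 16 * q.
  apply: (half_sets (mge (m - delta)) (mle _) mE q0 PE m2).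
  by rewrite mulrC; apply: HE; lra.
apply: (@le_trans _ _ (P [set w | m + 148 * U * eta <= Z w]%R +
    P [set w | Z w <= m - 148 * U * eta]%R)%E).
  apply: probability_le_union => //.
    apply: measurable_le_set; first exact: measurable_cst.
    by apply: measurableT_comp => //; apply: measurable_funB => //; exact: measurable_cst.
  move=> w /=; case: (leP 0 (Z w - m)) => h.
    by rewrite ger0_norm// => hw; left => /=; lra.
  by rewrite ltr0_norm// => hw; right => /=; lra.
rewrite -(@fineK _ (P [set w | m + _ <= Z w])) ?fin_num_measure//.
rewrite -(@fineK _ (P [set w | Z w <= m - _])) ?fin_num_measure//.
by rewrite -EFinD lee_fin; lra.
Qed.

End tail_about_median.

(** * Dyadic decomposition *)
Section dyadic.
Context {R : realType}.

Lemma dyadic_bound (J : nat) (eta x : R) : 0 < eta -> x <= 2 ^+ J * eta ->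
  x <= eta + \sum_(j < J) 2 ^+ j * eta * (2 ^+ j * eta <= x)%R%:R.
Proof.
move=> e0; elim: J => [|J IH] xJ; first by rewrite big_ord0 addr0; lra.
have S0 m : 0 <= \sum_(j < m) 2 ^+ j * eta * (2 ^+ j * eta <= x)%R%:R.
  by apply: sumr_ge0 => j _; rewrite mulr_ge0// mulr_ge0// ltW.
have [xJ'|xJ'] := leP x (2 ^+ J * eta).
  by apply: le_trans (IH xJ') _; rewrite big_ord_recr /= lerD2l lerDl mulr_ge0// mulr_ge0// ltW.
suff -> : eta + \sum_(j < J.+1) 2 ^+ j * eta * (2 ^+ j * eta <= x)%R%:R = 2 ^+ J.+1 * eta by [].
rewrite (eq_bigr (fun j : 'I_J.+1 => eta * 2 ^+ j)); last first.
  move=> j _; have -> : 2 ^+ j * eta <= x; last by rewrite mulr1 mulrC.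
  apply: le_trans (ltW xJ'); rewrite ler_pM2r//.
  by rewrite ler_eXn2l ?ltr1n// -ltnS.
rewrite -mulr_sumr; elim: J.+1 => [|m IHm]; first by rewrite big_ord0 mulr0 addr0 expr0 mul1r.
by rewrite big_ord_recr /= mulrDr addrA IHm exprS; ring.
Qed.

Lemma exists_dyadic (eta c : R) : 0 < eta ->
  exists J : nat, c <= 2 ^+ J * eta /\ forall j : nat, (j < J)%N -> 2 ^+ j * eta <= c.
Proof.
move=> e0.
have ex : exists J : nat, c <= 2 ^+ J * eta.
  exists (Num.bound `|c / eta|); rewrite -ler_pdivrMr//.
  apply: (@le_trans _ _ (Num.bound `|c / eta|)%:R).
    by apply: le_trans (ler_norm _) (ltW _); apply: archi_boundP.
  by rewrite -natrX ler_nat ltnW// ltn_expl.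
case: (ex_minnP ex) => J cJ Jmin; exists J; split => // j jJ.
rewrite leNgt; apply/negP => /ltW /Jmin; by rewrite leqNgt jJ.
Qed.

Lemma expRN_le_inv (x : R) : 0 < x -> expR (- x) <= x^-1.
Proof.
move=> x0; rewrite expRN lef_pV2 ?posrE ?expR_gt0//.
by apply: le_trans (expR_ge1Dx x); lra.
Qed.

Lemma geometric_half_sum (J : nat) : \sum_(j < J) (2 ^+ j)^-1 <= 2 :> R.
Proof.
suff : \sum_(j < J) (2 ^+ j)^-1 = 2 - 2 / 2 ^+ J :> R.
  by move=> ->; rewrite gerBl divr_ge0// exprn_ge0.
elim: J => [|J IH]; first by rewrite big_ord0 expr0; lra.
rewrite big_ord_recr /= IH exprS; field.
by rewrite expf_neq0.
Qed.

End dyadic.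

(** * Deviation from the mean *)
Section mean_deviation.
Context {R : realType} {disp : measure_display} {T : measurableType disp}
  {P : probability T R} {n d : nat} (X : 'I_n -> {RV P >-> R}).
Hypothesis Xind : mutually_independent X.
Variable k : R.
Hypothesis n0 : (0 < n)%N.
Hypothesis d0 : (0 < d)%N.
Hypothesis k0 : 0 < k.
Hypothesis Xexp : forall i, (\int[P]_w (expR (X i w ^+ 2 / k))%:E <= 2%:E)%E.
Hypothesis Xsq : forall i, (\int[P]_w (X i w ^+ 2)%:E = 1)%E.
Hypothesis dn : 136 * k ^+ 2 * d%:R ^+ 2 <= n%:R.

Local Notation N := (Num.sqrt n%:R : R).

Let nR : 0 < n%:R :> R. Proof. by rewrite ltr0n. Qed.
Let dR : 0 < d%:R :> R. Proof. by rewrite ltr0n. Qed.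
Let d1 : 1 <= d%:R :> R. Proof. by rewrite ler1n. Qed.
Let k1 : 1 <= k.
Proof. exact: (exp_moment_scale_ge1 k0 (Xexp (Ordinal n0)) (Xsq _)). Qed.
Let N0 : 0 < N. Proof. by rewrite sqrtr_gt0. Qed.
Let N2 : N ^+ 2 = n%:R. Proof. by rewrite sqr_sqrtr// ltW. Qed.

Let sqn (w : T) : R := (dot (fun i => X i w) (fun i => X i w)) / n%:R.

Let sqn_ge0 w : 0 <= sqn w. Proof. by rewrite divr_ge0 ?dot_ge0// ltW. Qed.

Let msqn : measurable_fun setT sqn.
Proof.
apply: measurable_funM => //; apply: measurable_sum => i.
by apply: measurable_funM.
Qed.

(** Since (1 + u)^d <= exp(d u), this is an exponential moment of the centered
squares with parameter d/n, which by [centered_square_mgf] is at most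
exp(68 k^2 d^2/n). *)
Lemma normalized_square_pow_moment : (\int[P]_w (sqn w ^+ d)%:E <= 2%:E)%E.
Proof.
pose l := d%:R / n%:R : R.
have l0 : 0 <= l by rewrite divr_ge0// ltW.
have kk : k <= k ^+ 2 by rewrite expr2 ler_peMr// ltW.
have dd : d%:R <= d%:R ^+ 2 :> R by rewrite expr2 ler_peMr.
have kd : k * d%:R <= k ^+ 2 * d%:R ^+ 2.
  by apply: ler_pM => //; exact: ltW.
have kd0 : 0 < k * d%:R by rewrite mulr_gt0.
have lk : `|l| <= (2 * k)^-1.
  rewrite ger0_norm// ler_pdivrMr// mulrC ler_pdivlMr ?mulr_gt0//.
  by move: dn kd kd0; lra.
have pointwise w : sqn w ^+ d <= \prod_(i < n) expR (l * (X i w ^+ 2 - 1)).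
  apply: (@le_trans _ _ (expR (sqn w - 1) ^+ d)).
    apply: lerXn2r; rewrite ?nnegrE ?expR_ge0//.
    by apply: le_trans (expR_ge1Dx _); lra.
  rewrite -expRM_natl -expR_sum ler_expR -mulr_sumr sumrB sumr_const card_ord.
  rewrite le_eqVlt; apply/orP; left; apply/eqP.
  rewrite /sqn /l (_ : \sum_(i < n) X i w ^+ 2 = dot (fun i => X i w) (fun i => X i w))//.
  by field; rewrite gt_eqF.
have mh : measurable_fun setT (fun y : R => expR (l * (y ^+ 2 - 1))).
  apply: measurableT_comp => //; apply: measurable_funM => //.
  by apply: measurable_funB => //; exact: measurable_cst.
apply: (@le_trans _ _ (\int[P]_w (\prod_(i < n) expR (l * (X i w ^+ 2 - 1)))%:E)%E).
  apply: integral_le => //.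
  - exact: measurable_funX.
  - apply: measurable_prod => i _.
    exact: (measurableT_comp mh).
  - by move=> w; exact: exprn_ge0.
apply: le_trans (integral_prod_le Xind mh (fun=> expR_ge0 _)) _.
apply: (@le_trans _ _ (\prod_(i < n) (expR (68 * k ^+ 2 * l ^+ 2))%:E)%E).
  apply: lee_prod => i; apply/andP; split.
    by apply: integral_ge0 => w _; rewrite lee_fin expR_ge0.
  exact: centered_square_mgf.
rewrite prodEFin prodr_const card_ord -expRM_natl lee_fin.
apply: le_trans expR_half; rewrite ler_expR.
rewrite (_ : n%:R * _ = 68 * k ^+ 2 * d%:R ^+ 2 / n%:R); last first.
  by rewrite /l; field; rewrite gt_eqF.
by rewrite ler_pdivrMr//; move: dn; lra.
Qed.

Section function.
Variables (f : tensor_space R n d -> R) (L : R).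
Hypothesis L0 : 0 < L.
Hypothesis lf : tensor_lipschitz L f.

Local Notation Z := (fun w => f (tensor_power (fun i => X i w))).
Local Notation U := (L * N ^+ d.-1).

Let U0 : 0 < U. Proof. by rewrite mulr_gt0// exprn_gt0. Qed.

Let q (w : T) : R := Num.sqrt (sqn w ^+ d).

Let q0 w : 0 <= q w. Proof. exact: sqrtr_ge0. Qed.
Let q2 w : q w ^+ 2 = sqn w ^+ d. Proof. by rewrite sqr_sqrtr// exprn_ge0. Qed.

Let mZ : measurable_fun setT Z.
Proof. exact: (measurable_tensor_function _ (ltW L0) lf). Qed.

Let distance_to_origin w : `|Z w - f 0| <= U * N * q w.
Proof.
apply: le_trans (lf _ _) _; rewrite -!mulrA ler_wpM2l ?(ltW L0)//.
rewrite subr0 mulrA -exprSr prednK// tensor_normE.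
have e : enorm (tensor_power (fun i => X i w) : {ffun 'I_d -> 'I_n} -> R) ^+ 2 =
    (N ^+ d * q w) ^+ 2.
  rewrite enorm_sq dot_tensor_power exprMn q2 -exprM mulnC exprM N2 -exprMn.
  by rewrite /sqn mulrC divfK// gt_eqF.
rewrite -(@ler_pXn2r _ 2)// ?nnegrE ?enorm_ge0 ?e//.
by rewrite mulr_ge0// exprn_ge0// ltW.
Qed.

Let large_q_probability : fine (P [set w | 9 <= sqn w ^+ d]) < 2^-1.
Proof.
have mA : measurable [set w | 9 <= sqn w ^+ d].
  by apply: measurable_le_set; [exact: measurable_cst|exact: measurable_funX].
have : (9%:E * P [set w | 9 <= sqn w ^+ d]%R <= 2%:E)%E.
  rewrite -integral_indicator// -integral_scale//.
  apply: le_trans normalized_square_pow_moment.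
  apply: integral_le => //.
  - by apply: measurable_funM => //; exact: measurable_indic.
  - exact: measurable_funX.
  - move=> w; rewrite indicE; case: (pselect (9 <= sqn w ^+ d)) => h.
      by rewrite mem_set// mulr1.
    by rewrite memNset// mulr0 exprn_ge0.
rewrite -[P _]fineK ?fin_num_measure// -EFinM lee_fin; lra.
Qed.

(** With probability more than one half (|X|^2/n)^d < 9, so both level
sets of the median meet the event |Z - f 0| <= 3 U N. *)
Lemma median_near_origin (m delta : R) : delta <= U * N / 4 ->
  2^-1 <= fine (P [set w | Z w <= m + delta]) ->
  2^-1 <= fine (P [set w | m - delta <= Z w]) ->
  `|f 0 - m| <= 4 * (U * N).
Proof.
move=> dU m1 m2.
have UN : 0 < U * N by rewrite mulr_gt0.
have pick (A : set T) : measurable A -> 2^-1 <= fine (P A) ->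
    exists2 w, A w & `|Z w - f 0| <= 3 * (U * N).
  move=> mA PA; apply: contrapT => H.
  have : fine (P A) <= fine (P [set w | 9 <= sqn w ^+ d]).
    have mB : measurable [set w | 9 <= sqn w ^+ d].
      by apply: measurable_le_set; [exact: measurable_cst|exact: measurable_funX].
    apply: fine_le; rewrite ?fin_num_measure//; apply: le_measure; rewrite ?inE//.
    move=> w Aw /=; rewrite leNgt; apply/negP => hw; apply: H; exists w => //.
    apply: le_trans (distance_to_origin w) _; rewrite mulrC ler_wpM2r ?(ltW UN)//.
    rewrite -(@ler_pXn2r _ 2)// ?nnegrE// q2; lra.
  by have := large_q_probability; lra.
have [w1 /= h1] := pick _ (measurable_le_set mZ (@measurable_cst _ _ _ _ _ (m + delta))) m1.
have [w2 /= h2] := pick _ (measurable_le_set (@measurable_cst _ _ _ _ _ (m - delta)) mZ) m2.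
rewrite !ler_norml => /andP[a1 a2] /andP[b1 b2].
by apply/andP; split; lra.
Qed.

Hypothesis cf : convex_function setT f.

(** The numerical constant of [far_tail_probability]: 32 is the factor of the
median tail, 16 comes from eta = N/4, and 257 k^2 d^2 is the variance proxy
for M^2 = 256 k^2 d. *)
Let Q : R := 32 * (16 * (272 * 257)).

(** At the largest level eta = N/4 a truncation at M^2 = 256 k^2 d is already
admissible, and exp(-x) <= 1/x gives decay in n. *)
Lemma far_tail_probability (m delta : R) : 0 < delta -> delta <= U * N / 4 ->
  2^-1 <= fine (P [set w | Z w <= m + delta]) ->
  2^-1 <= fine (P [set w | m - delta <= Z w]) ->
  fine (P [set w | 148 * U * (N / 4) <= `|Z w - m|]) <= Q * (k ^+ 2 * d%:R ^+ 2) / n%:R.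
Proof.
move=> de0 dU m1 m2.
pose M : R := 16 * k * Num.sqrt d%:R.
have M2 : M ^+ 2 = 256 * k ^+ 2 * d%:R by rewrite !exprMn sqr_sqrtr ?ltW//; ring.
have sd0 : 0 < Num.sqrt d%:R :> R by rewrite sqrtr_gt0.
have k2 : 0 < k ^+ 2 by rewrite exprn_gt0.
have kd0 : 0 < k * d%:R by rewrite mulr_gt0.
have adm : admissible_level (n := n) (d := d) k M (N / 4).
  split; [by rewrite divr_gt0| by []| |rewrite M2|].
  - by rewrite /M mulr_gt0// mulr_gt0.
  - have kk : k <= k ^+ 2 by rewrite expr2 ler_peMr// ltW.
    have : k ^+ 2 <= k ^+ 2 * d%:R by rewrite ler_peMr// ltW.
    lra.
  - rewrite M2 (_ : 256 * k ^+ 2 * d%:R / (2 * k) = 128 * (k * d%:R)); last first.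
      by field; rewrite gt_eqF.
    have := @expRN_le_inv R (128 * (k * d%:R)); rewrite pmulr_rgt0// => /(_ kd0) h.
    apply: (@le_trans _ _ (8 * k * n%:R * (128 * (k * d%:R))^-1)).
      by rewrite ler_wpM2l// !mulr_ge0// ltW.
    rewrite exprMn N2 le_eqVlt; apply/orP; left; apply/eqP; field.
    by rewrite !gt_eqF.
have := tail_about_median Xind n0 d0 k0 Xexp Xsq L0 cf lf m1 m2 adm.
have -> : N / 4 * U = U * N / 4 by ring.
move=> /(_ dU) /fine_le.
have mA : measurable [set w | 148 * U * (N / 4) <= `|Z w - m|].
  apply: measurable_le_set; first exact: measurable_cst.
  by apply: measurableT_comp => //; apply: measurable_funB => //; exact: measurable_cst.
rewrite fin_num_measure// => /(_ isT isT) /= h; apply: le_trans h _.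
have vpE : variance_proxy (d := d) k M = 257 * (k ^+ 2 * d%:R ^+ 2).
  by rewrite /variance_proxy M2; ring.
rewrite vpE; set v := k ^+ 2 * d%:R ^+ 2.
have v0 : 0 < v by rewrite mulr_gt0// exprn_gt0.
have v257 : 0 < 272 * (257 * v).
  by apply: mulr_gt0; [rewrite ltr0n|apply: mulr_gt0 v0; rewrite ltr0n].
have x0 : 0 < (N / 4) ^+ 2 / (272 * (257 * v)).
  by rewrite divr_gt0// exprn_gt0// divr_gt0.
apply: le_trans (ler_wpM2l _ (expRN_le_inv x0)) _; first by [].
rewrite exprMn N2 /Q le_eqVlt; apply/orP; left; apply/eqP; field.
by rewrite (gt_eqF v0) (gt_eqF nR).
Qed.

Lemma near_tail_probability (m delta M eta : R) (j : nat) :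
  admissible_level (n := n) (d := d) k M eta -> delta <= eta * U ->
  2^-1 <= fine (P [set w | Z w <= m + delta]) ->
  2^-1 <= fine (P [set w | m - delta <= Z w]) ->
  2 ^+ j * eta <= N / 4 ->
  2 ^+ j * eta * fine (P [set w | 148 * U * (2 ^+ j * eta) <= `|Z w - m|]) <=
  272 * 32 * variance_proxy (d := d) k M / eta * (2 ^+ j)^-1.
Proof.
move=> [e0 eN M0 kM hM] dU m1 m2 jN.
have j1 : 1 <= 2 ^+ j :> R by rewrite exprn_ege1// ler1n.
have j0 : 0 < 2 ^+ j :> R by rewrite exprn_gt0.
have ej : eta <= 2 ^+ j * eta by rewrite ler_peMl// ltW.
have adm : admissible_level (n := n) (d := d) k M (2 ^+ j * eta).
  split => //; first by rewrite mulr_gt0.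
  apply: le_trans hM _; rewrite ler_pM2r ?invr_gt0//.
  by rewrite lerXn2r ?nnegrE// ?mulr_ge0// ltW.
have := tail_about_median Xind n0 d0 k0 Xexp Xsq L0 cf lf m1 m2 adm.
have dU' : delta <= 2 ^+ j * eta * U.
  by apply: le_trans dU _; rewrite ler_pM2r.
move=> /(_ dU') /fine_le.
have mA : measurable [set w | 148 * U * (2 ^+ j * eta) <= `|Z w - m|].
  apply: measurable_le_set; first exact: measurable_cst.
  by apply: measurableT_comp => //; apply: measurable_funB => //; exact: measurable_cst.
rewrite fin_num_measure// => /(_ isT isT) /= h.
have v0 : 0 < variance_proxy (d := d) k M.
  by rewrite /variance_proxy addr_gt0// mulr_gt0// exprn_gt0.
have v272 : 0 < 272 * variance_proxy (d := d) k M by rewrite mulr_gt0 ?ltr0n.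
have x0 : 0 < (2 ^+ j * eta) ^+ 2 / (272 * variance_proxy (d := d) k M).
  by rewrite divr_gt0// exprn_gt0// mulr_gt0.
have h2 := ler_wpM2l (ler0n R 32) (expRN_le_inv x0).
apply: le_trans (ler_wpM2l _ (le_trans h h2)) _; first by rewrite mulr_ge0// ltW.
rewrite le_eqVlt; apply/orP; left; apply/eqP; field.
by rewrite (gt_eqF v0) (gt_eqF j0) (gt_eqF e0).
Qed.

(** Below the level N/4 the deviation is summed over dyadic levels, where
exp(-x) <= 1/x makes the series geometric.  Above it, Z is compared with its
value at the origin. *)
Lemma expected_deviation (m delta M eta : R) :
  0 < delta -> delta <= eta * U ->
  2^-1 <= fine (P [set w | Z w <= m + delta]) ->
  2^-1 <= fine (P [set w | m - delta <= Z w]) ->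
  admissible_level (n := n) (d := d) k M eta ->
  272 * 64 * variance_proxy (d := d) k M <= eta ^+ 2 ->
  (18 + Q / 2) * (k ^+ 2 * d%:R) <= 148 * eta ->
  (\int[P]_w (`|Z w - m|)%:E <= (3 * (148 * U * eta))%:E)%E.
Proof.
move=> de0 dU m1 m2 adm veta keta.
have [e0 eN _ _ _] := adm.
have v0 : 0 <= variance_proxy (d := d) k M.
  by rewrite /variance_proxy addr_ge0// mulr_ge0// sqr_ge0.
have UN : 0 < U * N by rewrite mulr_gt0.
have dUN : delta <= U * N / 4.
  by apply: le_trans dU _; rewrite mulrC -mulrA ler_pM2l.
pose V := 148 * U.
have V0 : 0 < V by rewrite mulr_gt0 ?ltr0n.
have [J [JN Jmin]] := exists_dyadic (N / 4) e0.
pose al := d%:R / N.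
have al0 : 0 < al by rewrite divr_gt0.
pose near (j : 'I_J) := [set w | V * (2 ^+ j * eta) <= `|Z w - m|].
pose far := [set w | V * (N / 4) <= `|Z w - m|].
have mdev : measurable_fun setT (fun w => `|Z w - m|).
  by apply: measurableT_comp => //; apply: measurable_funB => //; exact: measurable_cst.
have mnear j : measurable (near j).
  by apply: measurable_le_set => //; exact: measurable_cst.
have mfar : measurable far.
  by apply: measurable_le_set => //; exact: measurable_cst.
pose S w := \sum_(j < J) (V * (2 ^+ j * eta)) * \1_(near j) w.
pose B w := V * eta + (S w + (U * N * (al * (sqn w ^+ d + 16)) +
   U * N * (2 * al)^-1 * \1_far w)).
have c0 (j : nat) : 0 <= V * (2 ^+ j * eta).
  by rewrite mulr_ge0 ?(ltW V0)// mulr_ge0 ?exprn_ge0// ltW.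
have ind0 (A : set T) w : 0 <= \1_A w :> R by rewrite indicE.
have S0 w : 0 <= S w by apply: sumr_ge0 => j _; rewrite mulr_ge0.
have q20 w : 0 <= sqn w ^+ d by rewrite exprn_ge0.
have t1 w : 0 <= U * N * (al * (sqn w ^+ d + 16)).
  by rewrite mulr_ge0 ?(ltW UN)// mulr_ge0 ?(ltW al0)// addr_ge0.
have ca0 : 0 <= U * N * (2 * al)^-1.
  by rewrite mulr_ge0 ?(ltW UN)// invr_ge0 mulr_ge0// ltW.
have t2 w : 0 <= U * N * (2 * al)^-1 * \1_far w by rewrite mulr_ge0.
have pointwise w : `|Z w - m| <= B w.
  have [h|h] := ltP `|Z w - m| (V * (N / 4)).
    have xJ : `|Z w - m| / V <= 2 ^+ J * eta.
      by apply: le_trans JN; rewrite ler_pdivrMr// mulrC ltW.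
    have h1 := dyadic_bound e0 xJ.
    have h2 : `|Z w - m| <= V * eta + S w.
      rewrite -(@ler_pM2l _ V^-1) ?invr_gt0// mulrC.
      apply: le_trans h1 _; rewrite mulrDr mulKf ?gt_eqF// lerD2l.
      rewrite /S mulr_sumr; apply: ler_sum => j _.
      have -> : V^-1 * (V * (2 ^+ j * eta) * \1_(near j) w) = 2 ^+ j * eta * \1_(near j) w.
        by rewrite -(mulrA V) mulKf// gt_eqF.
      rewrite ler_wpM2l ?mulr_ge0 ?exprn_ge0 ?(ltW e0)//.
      rewrite indicE ler_nat; case: (boolP (_ <= _)) => // hj.
      rewrite mem_set// /near /=; move: hj; rewrite ler_pdivlMr//.
      by rewrite mulrC.
    rewrite /B addrA; apply: le_trans h2 _; rewrite lerDl.
    by rewrite addr_ge0.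
  have hf : \1_far w = 1 :> R by rewrite indicE mem_set.
  have h1 : `|Z w - m| <= U * N * (q w + 4).
    have -> : Z w - m = (Z w - f 0) + (f 0 - m) by ring.
    apply: le_trans (ler_normD _ _) _; rewrite mulrDr lerD ?distance_to_origin//.
    by rewrite [leRHS]mulrC; exact: median_near_origin dUN m1 m2.
  (* arithmetic-geometric mean inequality; the weight al = d / N balances the
     second moment of q against the probability of the far event *)
  have h2 : q w + 4 <= al * (sqn w ^+ d + 16) + (2 * al)^-1.
    rewrite -q2; set b := (2 * al)^-1.
    have b0 : 0 <= b by rewrite invr_ge0 mulr_ge0// ltW.
    have ab : al * b = 2^-1 by rewrite /b; field; rewrite gt_eqF.
    have : 0 <= b * (al * (q w + 4) - 1) ^+ 2 by rewrite mulr_ge0 ?sqr_ge0.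
    have -> : b * (al * (q w + 4) - 1) ^+ 2 =
        (al * b) * (al * (q w + 4) ^+ 2) - 2 * (al * b) * (q w + 4) + b by ring.
    rewrite ab; have : 0 <= al * (q w - 4) ^+ 2 by rewrite mulr_ge0 ?sqr_ge0 ?(ltW al0).
    lra.
  have h3 := ler_wpM2l (ltW UN) h2.
  have := S0 w; have := c0 0%N; rewrite expr0 mul1r.
  rewrite /B hf mulr1; lra.
have mS : measurable_fun setT S.
  by apply: measurable_sum => j; apply: measurable_funM => //; exact: measurable_indic.
have mq2 : measurable_fun setT (fun w => sqn w ^+ d) by exact: measurable_funX.
have mt0 : measurable_fun setT (fun w => sqn w ^+ d + 16).
  by apply: measurable_funD => //; exact: measurable_cst.
have mt1 : measurable_fun setT (fun w => U * N * (al * (sqn w ^+ d + 16))).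
  by apply: measurable_funM => //; apply: measurable_funM.
have mt2 : measurable_fun setT (fun w => U * N * (2 * al)^-1 * \1_far w).
  by apply: measurable_funM => //; exact: measurable_indic.
have mt12 : measurable_fun setT (fun w => U * N * (al * (sqn w ^+ d + 16)) +
    U * N * (2 * al)^-1 * \1_far w) by exact: measurable_funD.
have mSt : measurable_fun setT (fun w => S w + (U * N * (al * (sqn w ^+ d + 16)) +
    U * N * (2 * al)^-1 * \1_far w)) by exact: measurable_funD.
have mB : measurable_fun setT B by apply: measurable_funD => //; exact: measurable_cst.
apply: le_trans (integral_le P mdev mB (fun w => normr_ge0 _) pointwise) _.
have Ve0 : 0 <= V * eta by apply: mulr_ge0; exact: ltW.
have t12 w : 0 <= U * N * (al * (sqn w ^+ d + 16)) +
    U * N * (2 * al)^-1 * \1_far w by rewrite addr_ge0.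
rewrite /B (integral_add P (@measurable_cst _ _ _ _ _ (V * eta)) mSt)//; last first.
  by move=> w; rewrite addr_ge0.
rewrite (integral_constant P) (integral_add P mS mt12)// (integral_add P mt1 mt2)//.
have iS : (\int[P]_w (S w)%:E <= (V * eta)%:E)%E.
  rewrite integral_bigsum; [|by move=> j; apply: measurable_funM => //; exact: measurable_indic
    |by move=> j w; rewrite mulr_ge0].
  apply: (@le_trans _ _ (\sum_(j < J) (V * (272 * 32 * variance_proxy (d := d) k M / eta * (2 ^+ j)^-1)))%:E).
    rewrite -sumEFin; apply: lee_sum => j _.
    rewrite integral_scale//.
    rewrite integral_indicator// -[P (near j)]fineK ?fin_num_measure// -EFinM lee_fin.
    rewrite -(mulrA V) ler_pM2l//.
    by apply: (near_tail_probability adm dU m1 m2); apply: Jmin.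
  rewrite lee_fin -mulr_sumr ler_pM2l// -mulr_sumr.
  apply: le_trans (ler_wpM2l _ (geometric_half_sum J)) _.
    apply: divr_ge0; last exact: ltW.
    apply: mulr_ge0; last exact: v0.
    by apply: mulr_ge0; exact: ler0n.
  rewrite mulrAC ler_pdivrMr// -expr2; apply: le_trans veta; lra.
have it1 : (\int[P]_w (U * N * (al * (sqn w ^+ d + 16)))%:E <= (18 * (U * d%:R))%:E)%E.
  rewrite integral_scale//; [|exact: measurable_funM|by move=> w; rewrite mulr_ge0 ?addr_ge0 ?(ltW al0)|exact: ltW].
  rewrite integral_scale//; [|by move=> w; rewrite addr_ge0|exact: ltW].
  have m16 : measurable_fun setT (cst 16 : T -> R) by exact: measurable_cst.
  rewrite (integral_add P mq2 m16)//.
  rewrite (integral_constant P).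
  apply: (@le_trans _ _ ((U * N)%:E * (al%:E * (2%:E + 16%:E)))%E).
    rewrite lee_wpmul2l ?lee_fin ?(ltW UN)// lee_wpmul2l ?lee_fin ?(ltW al0)//.
    by rewrite leeD2r// normalized_square_pow_moment.
  rewrite -EFinD -!EFinM lee_fin le_eqVlt; apply/orP; left; apply/eqP.
  by rewrite /al; field; rewrite gt_eqF.
have it2 : (\int[P]_w (U * N * (2 * al)^-1 * \1_far w)%:E <= (Q / 2 * (k ^+ 2 * d%:R) * U)%:E)%E.
  rewrite integral_scale//.
  rewrite integral_indicator// -[P far]fineK ?fin_num_measure// -EFinM lee_fin.
  apply: le_trans (ler_wpM2l ca0 (far_tail_probability de0 dUN m1 m2)) _.
  rewrite le_eqVlt; apply/orP; left; apply/eqP; rewrite /al.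
  move: N2 N0 => xN x0; set c := Q; move: xN x0; set x := N => <- x0.
  by field; rewrite (gt_eqF x0) (gt_eqF dR).
apply: le_trans (leeD (lexx (V * eta)%:E) (leeD iS (leeD it1 it2))) _.
rewrite -!EFinD lee_fin.
have := ler_wpM2r (ltW U0) keta.
have : U * d%:R <= U * (k ^+ 2 * d%:R).
  by rewrite ler_pM2l// ler_peMl ?(ltW dR)// exprn_ege1.
rewrite /V; set Q' := Q / 2; set u := U; lra.
Qed.

(** The mean is within 3 * 148 U eta of the median, so a deviation of
4 * 148 U eta from the mean is one of 148 U eta from the median. *)
Lemma tail_about_mean (M eta t : R) :
  admissible_level (n := n) (d := d) k M eta ->
  272 * 64 * variance_proxy (d := d) k M <= eta ^+ 2 ->
  (18 + Q / 2) * (k ^+ 2 * d%:R) <= 148 * eta ->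
  4 * (148 * U * eta) <= t ->
  (P [set w | t%:E < `|(Z w)%:E - 'E_P[Z]|] <=
    (32 * expR (- (eta ^+ 2 / (272 * variance_proxy (d := d) k M))))%:E)%E.
Proof.
move=> adm veta keta tV.
have e0 : 0 < eta by case: adm.
have eU : 0 < eta * U by rewrite mulr_gt0.
have [m [m1 m2]] := exists_approximate_median P mZ eU.
have dev := expected_deviation eU (lexx _) m1 m2 adm veta keta.
have mZm : measurable_fun setT (fun w => Z w - m).
  by apply: measurable_funB => //; exact: measurable_cst.
have iZm : P.-integrable setT (EFin \o (fun w => Z w - m)).
  apply/integrableP; split; first exact/measurable_EFinP.
  by apply: le_lt_trans dev _; rewrite ltry.
have im : P.-integrable setT (EFin \o cst m).
  by apply: finite_measure_integrable_cst.
have eZ : ('E_P[Z] = \int[P]_w (Z w - m)%:E + m%:E)%E.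
  rewrite unlock -[X in (_ + X)%E](integral_constant P) -integralD_EFin//.
  by apply: eq_integral => w _ /=; rewrite -EFinD subrK.
have fin : (\int[P]_w (Z w - m)%:E)%E \is a fin_num by exact: integrable_fin_num.
pose c := fine (\int[P]_w (Z w - m)%:E)%E.
have cle : `|c| <= 3 * (148 * U * eta).
  rewrite -lee_fin; apply: le_trans dev.
  by rewrite -[X in (X <= _)%E]/(`|c%:E|)%E fineK//; apply: le_abse_integral => //; exact/measurable_EFinP.
have -> : ('E_P[Z])%E = (c + m)%:E by rewrite eZ EFinD fineK.
apply: le_trans (tail_about_median Xind n0 d0 k0 Xexp Xsq L0 cf lf m1 m2 adm (lexx _)).
apply: le_measure; rewrite ?inE.
- rewrite (_ : [set w | _] = ~` [set w | `|Z w - (c + m)| <= t]); last first.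
    apply/seteqP; split => w /=; rewrite lte_fin ltNge; first by move/negP.
    by move=> h; apply/negP.
  apply: measurableC; apply: measurable_le_set; last exact: measurable_cst.
  by apply: measurableT_comp => //; apply: measurable_funB => //; exact: measurable_cst.
- apply: measurable_le_set; first exact: measurable_cst.
  by apply: measurableT_comp => //; apply: measurable_funB => //; exact: measurable_cst.
move=> w /=; rewrite lte_fin => h.
have : `|Z w - (c + m)| <= `|Z w - m| + `|c|.
  by rewrite (_ : Z w - (c + m) = (Z w - m) - c); [exact: ler_normB|ring].
move: h cle tV; set a := 148 * U * eta; lra.
Qed.

End function.
End mean_deviation.

(** * The rate function *)
Section rate_function_bounds.
Context {R : realType}.
Variables (n d : nat) (s : R).
Hypothesis n0 : (0 < n)%N.
Hypothesis d0 : (0 < d)%N.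
Hypothesis s0 : 0 < s.

Local Notation ell := (ln (expR 1 + n%:R * d%:R / s ^+ 2) : R).

Let nR : 0 < n%:R :> R. Proof. by rewrite ltr0n. Qed.
Let dR : 0 < d%:R :> R. Proof. by rewrite ltr0n. Qed.
Let s20 : 0 < s ^+ 2. Proof. by rewrite exprn_gt0. Qed.
Let x0 : 0 < n%:R * d%:R / s ^+ 2. Proof. by rewrite divr_gt0// mulr_gt0. Qed.

Lemma one_le_ln_shifted (x : R) : 0 <= x -> 1 <= ln (expR 1 + x).
Proof.
by move=> x1; rewrite -[X in X <= _](@expRK R 1) ler_ln ?posrE ?expR_gt0// ?lerDl// ltr_wpDr// expR_gt0.
Qed.

Let ell1 : 1 <= ell. Proof. by apply: one_le_ln_shifted; exact: ltW. Qed.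

Lemma rate_function_ge0 : 0 <= rate_function n d s.
Proof.
rewrite /rate_function; case: ifP => // _.
by rewrite le_min !divr_ge0// ?sqr_ge0// mulr_ge0// (le_trans _ ell1).
Qed.

Lemma rate_function_le_sq : rate_function n d s * d%:R ^+ 2 <= s ^+ 2.
Proof.
by rewrite /rate_function gt_eqF// -ler_pdivlMr ?exprn_gt0// ge_min lexx.
Qed.

Lemma rate_function_le_ln : rate_function n d s * (d%:R * ell) <= s ^+ 2.
Proof.
rewrite /rate_function gt_eqF// -ler_pdivlMr ?ge_min ?lexx ?orbT//.
by rewrite mulr_gt0// (lt_le_trans _ ell1).
Qed.

(** M^2 = 2 k log(e + B n d/s^2) with B = 8 k a^2 makes exp(-M^2/(2 k)) at most
s^2/(B n d), which is the admissibility condition for eta = s/a.  The factor B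
multiplies the logarithm by at most B, since log(e + B x) <= B log(e + x). *)
Lemma exists_truncation (k a : R) : 1 <= k -> 4 <= a -> s <= Num.sqrt n%:R ->
  exists2 M : R, admissible_level (n := n) (d := d) k M (s / a) &
    variance_proxy (d := d) k M * rate_function n d s <= 24 * (k ^+ 2 * a ^+ 2) * s ^+ 2.
Proof.
move=> k1 a4 sN.
have k0 : 0 < k by lra.
have a0 : 0 < a by lra.
have A0 : 0 < a ^+ 2 by rewrite exprn_gt0.
pose B := 8 * k * a ^+ 2.
have B0 : 0 < B by rewrite !mulr_gt0.
have kB : k <= B.
  have : 1 <= a ^+ 2 by rewrite exprn_ege1//; lra.
  by rewrite /B; move=> h; have := ler_wpM2l (ltW k0) h; lra.
have Bx0 : 0 < B * (n%:R * d%:R / s ^+ 2) by rewrite mulr_gt0.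
pose l := ln (expR 1 + B * (n%:R * d%:R / s ^+ 2)).
have l1 : 1 <= l by apply: one_le_ln_shifted; exact: ltW.
have M20 : 0 < 2 * k * l by rewrite !mulr_gt0//; lra.
exists (Num.sqrt (2 * k * l)).
  split; rewrite ?sqr_sqrtr ?(ltW M20)//.
  - by rewrite divr_gt0.
  - have N0 : 0 <= Num.sqrt n%:R :> R by exact: sqrtr_ge0.
    rewrite ler_pdivrMr// ; apply: le_trans sN _.
    by rewrite -mulrA ler_peMr//; lra.
  - by rewrite sqrtr_gt0.
  - by have := ler_wpM2l (ltW k0) l1; lra.
  - rewrite (_ : 2 * k * l / (2 * k) = l); last by field; rewrite gt_eqF.
    rewrite expRN lnK ?posrE; last by rewrite addr_gt0// expR_gt0.
    apply: (@le_trans _ _ (8 * k * n%:R * (B * (n%:R * d%:R / s ^+ 2))^-1)).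
      rewrite ler_wpM2l ?mulr_ge0 ?(ltW k0)// lef_pV2 ?posrE ?addr_gt0 ?expR_gt0//.
      by rewrite lerDr expR_ge0.
    rewrite /B le_eqVlt; apply/orP; left; apply/eqP; field.
    by rewrite !gt_eqF.
have lB : l <= B * ell.
  have B1 : 1 <= B by lra.
  apply: (@le_trans _ _ (ln (B * (expR 1 + n%:R * d%:R / s ^+ 2)))).
    rewrite ler_ln ?posrE; first by rewrite mulrDr lerD2r ler_peMl// expR_ge0.
      by rewrite addr_gt0// expR_gt0.
    by rewrite mulr_gt0// addr_gt0// expR_gt0.
  have -> : ln (B * (expR 1 + n%:R * d%:R / s ^+ 2)) = ln B + ell.
    by rewrite lnM// posrE addr_gt0// expR_gt0.
  have h1 : ln B <= B - 1 by rewrite -[X in ln X <= _](subrKC 1); apply: le_ln1Dx; lra.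
  have h2 : 0 <= (B - 1) * (ell - 1) by rewrite mulr_ge0 ?subr_ge0.
  by move: h1 h2; move: (ln B) ell => b e; lra.
rewrite /variance_proxy sqr_sqrtr ?(ltW M20)//.
have r0 := rate_function_ge0.
have h1 : 2 * k * l * d%:R * rate_function n d s <= 2 * k * B * s ^+ 2.
  apply: (@le_trans _ _ (2 * k * B * (rate_function n d s * (d%:R * ell)))).
    have := ler_wpM2l (mulr_ge0 (mulr_ge0 (mulr_ge0 (ler0n R 2) (ltW k0)) r0) (ltW dR)) lB.
    lra.
  by rewrite ler_wpM2l ?rate_function_le_ln// !mulr_ge0// ltW.
have h2 : k ^+ 2 * d%:R ^+ 2 * rate_function n d s <= k * B * s ^+ 2.
  have := ler_wpM2l (sqr_ge0 k) rate_function_le_sq.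
  have := ler_wpM2r (mulr_ge0 (ltW k0) (ltW s20)) kB.
  lra.
rewrite mulrDl; apply: le_trans (lerD h1 h2) _.
by rewrite /B; lra.
Qed.

End rate_function_bounds.

(** * Concentration at the prescribed rate *)
Lemma measurable_tail_about {R : realType} {disp : measure_display}
    {T : measurableType disp} (g : T -> R) (t : R) (c : \bar R) :
  measurable_fun setT g -> measurable [set w | (t%:E < `|(g w)%:E - c|)%E].
Proof.
move=> mg; rewrite -[X in measurable X]setTI.
apply: emeasurable_fun_o_infty => //; apply: measurableT_comp => //.
by apply: emeasurable_funB; [exact/measurable_EFinP|exact: measurable_cst].
Qed.

(** 32 exp(-1) exceeds 1. *)
Lemma probability_le_constant_expR {R : realType} {disp : measure_display}
    {T : measurableType disp} (P : probability T R) (A : set T) (x : R) :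
  measurable A -> x <= 1 -> (P A <= (32 * expR (- x))%:E)%E.
Proof.
move=> mA x1; apply: le_trans (probability_le1 P mA) _; rewrite lee_fin.
have e1 : expR x <= 4.
  apply: (@le_trans _ _ (expR 1)); first by rewrite ler_expR.
  have -> : expR 1 = expR 2^-1 ^+ 2 :> R by rewrite -expRM_natl; congr expR; field.
  by have := @expR_half R; have := expR_ge0 (2^-1 : R); nra.
rewrite expRN ler_pdivlMr ?expR_gt0// mul1r; lra.
Qed.

Lemma terms_le_sum {R : realType} (x1 x2 x3 x4 : R) :
  0 <= x1 -> 0 <= x2 -> 0 <= x3 -> 0 <= x4 ->
  [/\ 1 <= 1 + (x1 + x2 + x3 + x4), x1 <= 1 + (x1 + x2 + x3 + x4),
    x2 <= 1 + (x1 + x2 + x3 + x4), x3 <= 1 + (x1 + x2 + x3 + x4) &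
    x4 <= 1 + (x1 + x2 + x3 + x4)].
Proof. by move=> *; split; lra. Qed.

Lemma powR_half (R : realType) (n d : nat) : n%:R `^ (d%:R / 2) = Num.sqrt n%:R ^+ d :> R.
Proof.
by rewrite mulrC powRrM powR12_sqrt ?ler0n// powR_mulrn ?sqrtr_ge0.
Qed.

Section rate.
Context {R : realType} {disp : measure_display} {T : measurableType disp}
  {P : probability T R} {n d : nat} (X : 'I_n -> {RV P >-> R}).
Hypothesis Xind : mutually_independent X.
Variable k : R.
Hypothesis n0 : (0 < n)%N.
Hypothesis d0 : (0 < d)%N.
Hypothesis k0 : 0 < k.
Hypothesis Xexp : forall i, (\int[P]_w (expR (X i w ^+ 2 / k))%:E <= 2%:E)%E.
Hypothesis Xsq : forall i, (\int[P]_w (X i w ^+ 2)%:E = 1)%E.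
Variables (f : tensor_space R n d -> R) (L : R).
Hypothesis L0 : 0 < L.
Hypothesis lf : tensor_lipschitz L f.
Hypothesis cf : convex_function setT f.

Local Notation N := (Num.sqrt n%:R : R).
Local Notation Z := (fun w => f (tensor_power (fun i => X i w))).

(** If c times the rate is at most 1 the bound exceeds 1.  Otherwise the rate is
at least 1/c, hence larger than each term of 1/c: these bounds give the three
hypotheses of [tail_about_mean] for eta = s/592 and compare the exponents.
The constants are variables with prescribed values, so that they are never
computed with. *)
Lemma concentration_at_rate (a e e' q g c s : R) :
  a = 592 -> e = 272 -> e' = 64 -> q = 18 + 32 * (16 * (272 * 257)) / 2 ->
  g = 24 * (k ^+ 2 * a ^+ 2) ->
  c = (1 + (e * (1 + e') * g * a ^+ 2 + (4 * q * k ^+ 2) ^+ 2 + 136 * k ^+ 2))^-1 ->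
  0 <= s -> s <= c * N ->
  (P [set w | (L * N ^+ d.-1 * s)%:E < `|(Z w)%:E - 'E_P[Z]|] <=
    (32 * expR (- (c * rate_function n d s)))%:E)%E.
Proof.
move=> aE eE e'E qE gE cE s0 sN.
have mE := measurable_tail_about (L * N ^+ d.-1 * s) 'E_P[Z]
  (measurable_tensor_function X (ltW L0) lf).
have [h|h] := leP (c * rate_function n d s) 1.
  exact: probability_le_constant_expR.
have k1 : 1 <= k := exp_moment_scale_ge1 k0 (Xexp (Ordinal n0)) (Xsq _).
have a4 : 4 <= a by rewrite aE ler_nat.
have a0 : 0 < a by lra.
have q0 : 0 <= q.
  rewrite qE; apply: addr_ge0; first exact: ler0n.
  apply: divr_ge0; last exact: ler0n.
  by do 3 (apply: mulr_ge0; first exact: ler0n); exact: ler0n.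
have sE : 0 < s.
  rewrite lt_neqAle s0 andbT; apply/negP => /eqP s00.
  by move: h; rewrite -s00 /rate_function eqxx mulr0; lra.
have k20 : 0 < k ^+ 2 by rewrite exprn_gt0.
have a20 : 0 < a ^+ 2 by rewrite exprn_gt0.
have s20 : 0 < s ^+ 2 by rewrite exprn_gt0.
have nR : 0 < n%:R :> R by rewrite ltr0n.
have dR : 0 < d%:R :> R by rewrite ltr0n.
have N2 : N ^+ 2 = n%:R by rewrite sqr_sqrtr// ltW.
have r0 := rate_function_ge0 n0 d0 sE.
have rd := rate_function_le_sq n d0 sE.
have admN := exists_truncation n0 d0 sE k1 a4.
move: h r0 rd admN; set r := rate_function n d s => h r0 rd admN.
have e0 : 0 < e by rewrite eE ltr0n.
have e'0 : 0 < e' by rewrite e'E ltr0n.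
have g0 : 0 < g by rewrite gE !mulr_gt0 ?ltr0n.
have [D DE] : exists D : R,
  D = 1 + (e * (1 + e') * g * a ^+ 2 + (4 * q * k ^+ 2) ^+ 2 + 136 * k ^+ 2) by eexists.
have cD : c = D^-1 by rewrite DE.
have ega0 : 0 < e * g * a ^+ 2 by rewrite !mulr_gt0.
have eega0 : 0 < e * e' * g * a ^+ 2 by rewrite !mulr_gt0.
have q20 : 0 <= (4 * q * k ^+ 2) ^+ 2 by rewrite sqr_ge0.
have k136 : 0 <= 136 * k ^+ 2 by rewrite mulr_ge0 ?ler0n// ltW.
have [D1 De De' Dq Dk] : [/\ 1 <= D, e * g * a ^+ 2 <= D, e * e' * g * a ^+ 2 <= D,
    (4 * q * k ^+ 2) ^+ 2 <= D & 136 * k ^+ 2 <= D].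
  have -> : D = 1 + (e * g * a ^+ 2 + e * e' * g * a ^+ 2 + (4 * q * k ^+ 2) ^+ 2 + 136 * k ^+ 2).
    by rewrite DE; ring.
  exact: terms_le_sum (ltW ega0) (ltW eega0) q20 k136.
have D0 : 0 < D by apply: lt_le_trans D1.
have Dr : D < r by move: h; rewrite cD mulrC ltr_pdivlMr// mul1r.
have c0 : 0 < c by rewrite cD invr_gt0.
have cDe : c * D = 1 by rewrite cD mulVf// gt_eqF.
have c1 : c <= 1 by rewrite cD invf_le1.
have cle x : x <= D -> c * x <= 1 by move=> xD; rewrite -[leRHS]cDe ler_pM2l.
have sN1 : s <= N by apply: le_trans sN _; rewrite ler_piMl ?sqrtr_ge0.
have [M adm vr] := admN sN1.
move: vr; rewrite -gE; set v := variance_proxy k M => vr.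
have v0 : 0 < v.
  apply: ltr_wpDl; first by rewrite mulr_ge0 ?sqr_ge0 ?ler0n.
  by apply: mulr_gt0 => //; rewrite exprn_gt0.
have dn : 136 * k ^+ 2 * d%:R ^+ 2 <= n%:R.
  rewrite leNgt; apply/negP => nd.
  have s2n : s ^+ 2 <= c ^+ 2 * n%:R.
    by rewrite -N2 -exprMn lerXn2r ?nnegrE ?mulr_ge0 ?sqrtr_ge0// ltW.
  have c20 : 0 < c ^+ 2 by rewrite exprn_gt0.
  have d20 : 0 < d%:R ^+ 2 :> R by rewrite exprn_gt0.
  have rc : r * d%:R ^+ 2 < c ^+ 2 * (136 * k ^+ 2) * d%:R ^+ 2.
    rewrite -mulrA; apply: le_lt_trans rd _; apply: le_lt_trans s2n _.
    by rewrite ltr_pM2l.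
  rewrite ltr_pM2r// in rc.
  have ck : c * (136 * k ^+ 2) <= 1 by exact: cle.
  have : c ^+ 2 * (136 * k ^+ 2) <= c.
    by rewrite expr2 -mulrA ler_piMr// ltW.
  by move=> /(lt_le_trans rc)/lt_le_trans/(_ (le_trans c1 D1))/(lt_trans Dr); rewrite ltxx.
have veta : e * e' * v <= (s / a) ^+ 2.
  rewrite expr_div_n ler_pdivlMr// -(ler_pM2l g0).
  apply: le_trans vr.
  have -> : g * (e * e' * v * a ^+ 2) = v * (e * e' * g * a ^+ 2) by ring.
  by rewrite ler_pM2l//; apply: ltW; apply: le_lt_trans Dr.
have a148 : a = 4 * 148 by rewrite aE -natrM.
have keta : q * (k ^+ 2 * d%:R) <= 148 * (s / a).
  have qs : 4 * q * k ^+ 2 * d%:R <= s.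
    rewrite -(@ler_pXn2r _ 2)// ?nnegrE// ?mulr_ge0 ?ler0n ?(ltW k0)//.
    apply: le_trans rd; rewrite exprMn ler_wpM2r ?sqr_ge0//.
    by apply: ltW; apply: le_lt_trans Dr.
  rewrite [leRHS](_ : _ = s / 4); last by rewrite a148; field.
  by rewrite ler_pdivlMr// (_ : _ * 4 = 4 * q * k ^+ 2 * d%:R)//; ring.
have tV : 4 * (148 * (L * N ^+ d.-1) * (s / a)) <= L * N ^+ d.-1 * s.
  rewrite le_eqVlt; apply/orP; left; apply/eqP.
  by rewrite a148; field.
move: veta keta; rewrite eE e'E qE => veta keta.
apply: le_trans (tail_about_mean Xind n0 d0 k0 Xexp Xsq dn L0 lf cf adm veta keta tV) _.
rewrite lee_fin ler_wpM2l ?ler0n// ler_expR lerN2 -/v -eE.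
rewrite ler_pdivlMr ?mulr_gt0// expr_div_n ler_pdivlMr//.
have ce : c * (e * g * a ^+ 2) <= 1 by exact: cle.
apply: (@le_trans _ _ (c * (e * g * a ^+ 2) * s ^+ 2)); last by rewrite ler_piMl// ltW.
have -> : c * r * (e * v) * a ^+ 2 = c * (e * a ^+ 2) * (v * r) by ring.
have -> : c * (e * g * a ^+ 2) * s ^+ 2 = c * (e * a ^+ 2) * (g * s ^+ 2) by ring.
by rewrite ler_wpM2l// !mulr_ge0// ltW.
Qed.

End rate.

Theorem theorem2p2 (R : realType) :
  exists C : R, 0 < C /\
  forall K : R, 0 < K ->
  exists cK : R, 0 < cK /\
  forall (disp : measure_display) (T : measurableType disp)
    (P : probability T R) (n d : nat) (X : 'I_n -> {RV P >-> R}),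
    (1 <= n)%N -> (1 <= d)%N ->
    mutually_independent X ->
    (forall i, 'E_P[X i] = 0)%E ->
    (forall i, 'E_P[(fun w => (X i w ^+ 2)%R)] = 1)%E ->
    (forall i, psi2_norm P (X i) <= K%:E)%E ->
  forall (L : R) (f : tensor_space R n d -> R),
    0 < L ->
    convex_function setT f ->
    tensor_lipschitz L f ->
  let Z := fun w : T => f (tensor_power (fun i => X i w)) in
  forall t : R, 0 <= t -> t <= cK * L * n%:R `^ (d%:R / 2) ->
    (P [set w | t%:E < `|(Z w)%:E - 'E_P[Z]|] <=
     (C * expR (- (cK * rate_function n d
        (t / (L * n%:R `^ ((d%:R - 1) / 2))))))%:E)%E.
Proof.
exists 32; split; first exact: ltr0n.
move=> K K0; pose k : R := 4 * K ^+ 2.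
have k0 : 0 < k by rewrite mulr_gt0// exprn_gt0.
have [a aE] : exists a : R, a = 592 by eexists.
have [e eE] : exists e : R, e = 272 by eexists.
have [e' e'E] : exists e' : R, e' = 64 by eexists.
have [q qE] : exists q : R, q = 18 + 32 * (16 * (272 * 257)) / 2 by eexists.
have [g gE] : exists g : R, g = 24 * (k ^+ 2 * a ^+ 2) by eexists.
have [c cE] : exists c : R, c =
  (1 + (e * (1 + e') * g * a ^+ 2 + (4 * q * k ^+ 2) ^+ 2 + 136 * k ^+ 2))^-1 by eexists.
have c0 : 0 < c.
  have e0 : 0 <= e by rewrite eE ler0n.
  have e'0 : 0 <= e' by rewrite e'E ler0n.
  have g0 : 0 <= g by rewrite gE mulr_ge0 ?ler0n// mulr_ge0// sqr_ge0.
  have k20 : 0 <= 136 * k ^+ 2 by rewrite mulr_ge0 ?ler0n// sqr_ge0.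
  rewrite cE invr_gt0 ltr_pwDl// addr_ge0// addr_ge0 ?sqr_ge0//.
  by rewrite mulr_ge0 ?sqr_ge0// mulr_ge0// mulr_ge0// addr_ge0.
exists c; split => // disp T P n d X n0 d0 Xind _ Xsq XK L f L0 cf lf Z t t0.
set N := Num.sqrt n%:R : R.
have N0 : 0 < N by rewrite sqrtr_gt0 ltr0n.
have dE : d%:R - 1 = d.-1%:R :> R by rewrite -[in LHS](prednK d0) -addn1 natrD addrK.
rewrite dE !powR_half -/N.
have U0 : 0 < L * N ^+ d.-1 by rewrite mulr_gt0// exprn_gt0.
move=> tN; set s := t / _.
have tE : t = L * N ^+ d.-1 * s by rewrite mulrC divfK// gt_eqF.
rewrite {1}tE; apply: (concentration_at_rate Xind n0 d0 k0 _ _ L0 lf cf aE eE e'E qE gE cE).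
- by move=> i; exact: psi2_norm_exp_moment.
- by move=> i; have := Xsq i; rewrite unlock.
- by rewrite /s divr_ge0// ltW.
rewrite /s ler_pdivrMr//; apply: le_trans tN _.
have -> : N ^+ d = N * N ^+ d.-1 by rewrite -exprS prednK.
by rewrite -/N le_eqVlt; apply/orP; left; apply/eqP; ring.
Qed.
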